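(* Consider the broken sample detection problem for the Gaussian model: $\mathcal X=\mathcal Y=\mathbb R^d$ and $\mathsf P_{X,Y}=\big(\mathcal N(0,\Sigma)\big)^{\otimes d}$ with $\Sigma=\begin{pmatrix}1&\rho\\ \rho&1\end{pmatrix}$, $\rho\in(0,1)$ (i.e. the $d$ coordinate pairs $(X_{\cdot,j},Y_{\cdot,j})$ are i.i.d. bivariate standard Gaussian with correlation $\rho$), where $\rho=\rho_n$ may depend on $n$, and $m=\alpha n$ for a constant $\alpha\in(0,1]$. The necessary and sufficient condition for strong detection as $n\to\infty$ is as follows: - if $d$ is fixed (not depending on $n$): $\rho^2=1-o(1)$; - if $d=d_n\to\infty$ as $n\to\infty$: $\rho^2d=\omega(1)$, i.e. $\rho^2d\to\infty$.
   Context: Broken sample detection problem. $\mathsf P_{X,Y}$ is a known joint distribution on $\mathcal X\times\mathcal Y$ with marginals $\mathsf P_X,\mathsf P_Y$. One observes $\mathbf X=(X_1,\dots,X_n)\in\mathcal X^n$ and $\mathbf Y=(Y_1,\dots,Y_m)\in\mathcal Y^m$, $m\le n$. Under $\mathcal H_0$: $(\mathbf X,\mathbf Y)\sim \mathsf P_X^{\otimes n}\otimes\mathsf P_Y^{\otimes m}$. Under $\mathcal H_1$: $\pi$ is drawn uniformly from the set $S_{m,n}$ of injections $[m]\to[n]$, and conditionally on $\pi$ the pairs $(X_{\pi(i)},Y_i)$, $i\in[m]$, are i.i.d. from $\mathsf P_{X,Y}$ and, independently, the $X_j$, $j\in[n]\setminus\pi([m])$, are i.i.d. from $\mathsf P_X$.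 Only $(\mathbf X,\mathbf Y)$ is observed. Strong detection is possible if there is a sequence of tests (based on $(\mathbf X,\mathbf Y)$) whose Type-I and Type-II error probabilities both tend to $0$ as $n\to\infty$. Here $m=\alpha n$ is read as $m=\lfloor\alpha n\rfloor$ when $\alpha n$ is not an integer. *)

(* Defs.v *)
From HB Require Import structures.
From mathcomp Require Import all_boot all_order all_algebra.
From mathcomp Require Import all_classical all_reals all_analysis.
From mathcomp Require Import measurable_realfun ring lra.

Set Implicit Arguments.
Unset Strict Implicit.
Unset Printing Implicit Defensive.

Import Order.TTheory GRing.Theory Num.Theory.
Import numFieldNormedType.Exports.

Local Open Scope classical_set_scope.
Local Open Scope ring_scope.

Section tuple_probability.
Context d (T : measurableType d) (R : realType).

Definition cons_pair n (p : T * n.-tuple T) : n.+1.-tuple T :=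
  [tuple of p.1 :: p.2].

Lemma measurable_cons_pair n : measurable_fun setT (@cons_pair n).
Proof. exact: measurable_cons. Qed.

HB.instance Definition _ n := isMeasurableFun.Build _ _ _ _ (@cons_pair n)
  (@measurable_cons_pair n).

Fixpoint tuple_prob (n : nat) (P : probability T R) :
    probability (n.-tuple T) R :=
  match n with
  | 0 => dirac [tuple]
  | n'.+1 => distribution (P \x tuple_prob n' P)%E (@cons_pair n')
  end.

End tuple_probability.

Section unzip_tuple.
Context d1 d2 (T1 : measurableType d1) (T2 : measurableType d2).

Definition unzip_tuple n (z : n.-tuple (T1 * T2)) : n.-tuple T1 * n.-tuple T2 :=
  ([tuple (tnth z i).1 | i < n], [tuple (tnth z i).2 | i < n]).

Lemma measurable_unzip_tuple n : measurable_fun setT (@unzip_tuple n).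
Proof.
apply: measurable_fun_pair; apply/measurable_fun_tnthP => i.
  rewrite (_ : _ \o _ = fun z : n.-tuple (T1 * T2) => (tnth z i).1).
    exact: (measurableT_comp measurable_fst (measurable_tnth i)).
  by apply/funext => z /=; rewrite tnth_mktuple.
rewrite (_ : _ \o _ = fun z : n.-tuple (T1 * T2) => (tnth z i).2).
  exact: (measurableT_comp measurable_snd (measurable_tnth i)).
by apply/funext => z /=; rewrite tnth_mktuple.
Qed.

HB.instance Definition _ n := isMeasurableFun.Build _ _ _ _ (@unzip_tuple n)
  (@measurable_unzip_tuple n).

End unzip_tuple.

Section broken_sample.
Context d1 d2 (T1 : measurableType d1) (T2 : measurableType d2) (R : realType).
Variable PXY : probability (T1 * T2)%type R.

HB.instance Definition _ := isMeasurableFun.Build _ _ _ _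
  (@fst T1 T2) measurable_fst.
HB.instance Definition _ := isMeasurableFun.Build _ _ _ _
  (@snd T1 T2) measurable_snd.

Definition marginalX : probability T1 R := distribution PXY (@fst T1 T2).
Definition marginalY : probability T2 R := distribution PXY (@snd T1 T2).

Variables n m : nat.

Definition null_law : probability (n.-tuple T1 * m.-tuple T2)%type R :=
  (tuple_prob n marginalX \x tuple_prob m marginalY)%E.

(* From m matched pairs z and n fresh X-samples w: the pi(i)-th entry of X and
   the i-th entry of Y are the two halves of z_i, and the entries of X outside
   the range of pi are read from w. *)
Definition plant (pi : {ffun 'I_m -> 'I_n})
    (p : m.-tuple (T1 * T2) * n.-tuple T1) : n.-tuple T1 * m.-tuple T2 :=
  ([tuple if [pick i | pi i == j] is Some i then (tnth p.1 i).1 else tnth p.2 j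
     | j < n],
   [tuple (tnth p.1 i).2 | i < m]).

Lemma measurable_plant pi : measurable_fun setT (plant pi).
Proof.
apply: measurable_fun_pair; apply/measurable_fun_tnthP => j.
  rewrite (_ : _ \o _ = fun p : m.-tuple (T1 * T2) * n.-tuple T1 =>
      if [pick i | pi i == j] is Some i then (tnth p.1 i).1 else tnth p.2 j).
    case: pickP => [i _|_].
      apply: measurableT_comp => //.
      by apply: (measurableT_comp (measurable_tnth i)).
    exact: (measurableT_comp (measurable_tnth j)).
  by apply/funext => z /=; rewrite tnth_mktuple.
rewrite (_ : _ \o _ = fun p : m.-tuple (T1 * T2) * n.-tuple T1 => (tnth p.1 j).2).
  apply: measurableT_comp => //.
  exact: (measurableT_comp (measurable_tnth j)).
by apply/funext => z /=; rewrite tnth_mktuple.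
Qed.

HB.instance Definition _ pi := isMeasurableFun.Build _ _ _ _ (plant pi)
  (@measurable_plant pi).

Definition planted_law_given (pi : {ffun 'I_m -> 'I_n}) :
    probability (n.-tuple T1 * m.-tuple T2)%type R :=
  distribution (tuple_prob m PXY \x tuple_prob n marginalX)%E (plant pi).

Definition injections : {set {ffun 'I_m -> 'I_n}} :=
  [set pi : {ffun 'I_m -> 'I_n} | injectiveb pi].

(* Uniform mixture over the injections; it is only meaningful for m <= n
   (otherwise there are no injections). *)
Definition planted_law (A : set (n.-tuple T1 * m.-tuple T2)) : \bar R :=
  ((#|injections|%:R^-1)%:E *
     \sum_(pi in injections) planted_law_given pi A)%E.

End broken_sample.

(* A test returns true to decide for the alternative P1. *)
Definition strong_detection (R : realType) (d : measure_display)
    (T : nat -> measurableType d) (P0 P1 : forall n, set (T n) -> \bar R) :=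
  exists phi : forall n, T n -> bool,
    [/\ forall n, measurable_fun setT (phi n),
        P0 n (phi n @^-1` [set true]) @[n --> \oo] --> 0%E &
        P1 n (phi n @^-1` [set false]) @[n --> \oo] --> 0%E].

Section gaussian.
Context (R : realType).
Local Notation mu := (@lebesgue_measure R).

Definition gauss2_pdf (Sigma : 'M[R]_2) (z : R * R) : R :=
  let v : 'rV[R]_2 := \row_(i < 2) (if i == 0 then z.1 else z.2) in
  (2 * pi * Num.sqrt (\det Sigma))^-1
    * expR (- ((v *m invmx Sigma *m v^T) 0 0 / 2)).

Definition corr_mx (rho : R) : 'M[R]_2 :=
  \matrix_(i < 2, j < 2) (if i == j then 1 else rho).

(* Outside |rho| < 1, where N(0, corr_mx rho) has no density, rho is replaced
   by 0 so that bigauss_prob is a probability measure for every rho. *)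
Definition bigauss_pdf (rho : R) : R * R -> R :=
  gauss2_pdf (corr_mx (if `|rho| < 1 then rho else 0)).

Lemma det_corr_mx rho : \det (corr_mx rho) = 1 - rho ^+ 2.
Proof.
rewrite (expand_det_row _ 0) !big_ord_recl big_ord0 /cofactor !det_mx11 !mxE /=.
rewrite /= ?eqxx; ring.
Qed.

Lemma inv_corr_mx rho : `|rho| < 1 ->
  invmx (corr_mx rho) = (1 - rho ^+ 2)^-1 *: corr_mx (- rho).
Proof.
move=> r1.
have r2 : 1 - rho ^+ 2 != 0.
  by rewrite subr_eq0 eq_sym lt_eqF// -real_normK ?num_real// expr_lt1.
have E : corr_mx rho *m ((1 - rho ^+ 2)^-1 *: corr_mx (- rho)) = 1%:M.
  apply/matrixP => i j; rewrite !mxE !big_ord_recl big_ord0 !mxE /=.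
  case: i => [[|[|//]] hi]; case: j => [[|[|//]] hj] /=; rewrite ?addr0; field;
    exact: r2.
have [u _] := mulmx1_unit E.
by rewrite -[RHS](mulKmx u) E mulmx1.
Qed.

Lemma gauss2_pdfE rho x y : `|rho| < 1 ->
  gauss2_pdf (corr_mx rho) (x, y) =
  normal_pdf 0 1 x * normal_pdf (rho * x) (Num.sqrt (1 - rho ^+ 2)) y.
Proof.
move=> r1.
have r2 : 0 < 1 - rho ^+ 2.
  by rewrite subr_gt0 -real_normK ?num_real// expr_lt1.
have s0 : Num.sqrt (1 - rho ^+ 2) != 0 by rewrite gt_eqF// sqrtr_gt0.
rewrite !normal_pdfE ?oner_neq0// /normal_fun /normal_peak.
rewrite mulrACA -expRD sqr_sqrtr ?ltW// /gauss2_pdf det_corr_mx inv_corr_mx//.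
congr (_ * expR _).
  rewrite -invfM -sqrtrM; last by rewrite mulrn_wge0// mulr_ge0// ?pi_ge0.
  congr (_^-1); apply: (@eq_trans _ _ (Num.sqrt ((2 * pi) ^+ 2 * (1 - rho ^+ 2)))).
    by rewrite sqrtrM ?sqr_ge0// sqrtr_sqr ger0_norm// mulr_ge0// pi_ge0.
  by congr Num.sqrt; ring.
rewrite !(mxE, big_ord_recl, big_ord0) /=.
by field; rewrite gt_eqF.
Qed.

Definition bigauss_prob (rho : R) : set (R * R) -> \bar R :=
  fun A => (\int[mu \x mu]_(z in A) (bigauss_pdf rho z)%:E)%E.

Section bigauss_probability.
Variable rho : R.

Let r := if `|rho| < 1 then rho else 0.
Let r1 : `|r| < 1. Proof. by rewrite /r; case: ifPn => // _; rewrite normr0. Qed.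

Let pdfE z : bigauss_pdf rho z =
  normal_pdf 0 1 z.1 * normal_pdf (r * z.1) (Num.sqrt (1 - r ^+ 2)) z.2.
Proof. by case: z => x y; rewrite /bigauss_pdf gauss2_pdfE. Qed.

Lemma bigauss_pdf_ge0 z : 0 <= bigauss_pdf rho z.
Proof. by rewrite pdfE mulr_ge0// normal_pdf_ge0. Qed.

Lemma measurable_bigauss_pdf : measurable_fun setT (bigauss_pdf rho).
Proof.
have s0 : Num.sqrt (1 - r ^+ 2) != 0.
  by rewrite gt_eqF// sqrtr_gt0 subr_gt0 -real_normK ?num_real// expr_lt1.
rewrite (_ : bigauss_pdf rho = fun z =>
  normal_pdf 0 1 z.1 * normal_pdf (r * z.1) (Num.sqrt (1 - r ^+ 2)) z.2);
  last by apply/funext => z; exact: pdfE.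
apply: measurable_funM.
  by apply: measurableT_comp => //; exact: measurable_normal_pdf.
under eq_fun do rewrite (normal_pdfE _ s0).
apply: measurable_funM => //; apply: measurableT_comp => //=.
apply: measurable_funM => //=; apply: measurableT_comp => //=.
apply: measurable_funX => //=; apply: measurable_funB => //=.
exact: measurable_funM.
Qed.

Let bigauss0 : bigauss_prob rho set0 = 0%E.
Proof. by rewrite /bigauss_prob integral_set0. Qed.

Let bigauss_ge0 A : (0 <= bigauss_prob rho A)%E.
Proof. by apply: integral_ge0 => z _; rewrite lee_fin bigauss_pdf_ge0. Qed.

Let bigauss_sigma_additive : semi_sigma_additive (bigauss_prob rho).
Proof.
move=> /= A mA tA mUA; rewrite /bigauss_prob ge0_integral_bigcup//=.
- apply: is_cvg_ereal_nneg_natsum_cond => n _ _.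
  by apply: integral_ge0 => z _; rewrite lee_fin bigauss_pdf_ge0.
- by apply/measurable_EFinP/measurable_funTS; exact: measurable_bigauss_pdf.
- by move=> z _; rewrite lee_fin bigauss_pdf_ge0.
Qed.

HB.instance Definition _ := isMeasure.Build _ _ _
  (bigauss_prob rho) bigauss0 bigauss_ge0 bigauss_sigma_additive.

Let bigauss_setT : bigauss_prob rho [set: _] = 1%E.
Proof.
rewrite /bigauss_prob fubini_tonelli1//=; first last.
- by move=> z; rewrite lee_fin bigauss_pdf_ge0.
- by apply/measurable_EFinP; exact: measurable_bigauss_pdf.
rewrite /fubini_F -[RHS](integral_normal_pdf 0 1); apply: eq_integral => x _.
under eq_integral do rewrite pdfE EFinM /=.
rewrite (@ge0_integralZl _ _ R mu setT measurableT
  (fun y => (normal_pdf (r * x) (Num.sqrt (1 - r ^+ 2)) y)%:E))//=.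
- by rewrite integral_normal_pdf mule1.
- by apply/measurable_EFinP; exact: measurable_normal_pdf.
- by move=> y _; rewrite lee_fin normal_pdf_ge0.
- by rewrite lee_fin normal_pdf_ge0.
Qed.

HB.instance Definition _ := @Measure_isProbability.Build _ _ R
  (bigauss_prob rho) bigauss_setT.

End bigauss_probability.

Definition gaussian_pair_law (d : nat) (rho : R) :
    probability (d.-tuple R * d.-tuple R)%type R :=
  distribution (tuple_prob d (bigauss_prob rho)) (@unzip_tuple _ _ R R d).

Definition gaussian_strong_detection (alpha : R) (dim : nat -> nat)
    (rho : nat -> R) :=
  let m n := Num.truncn (alpha * n%:R) in
  strong_detection
    (fun n => null_law (gaussian_pair_law (dim n) (rho n)) n (m n))
    (fun n => @planted_law _ _ _ _ _
                (gaussian_pair_law (dim n) (rho n)) n (m n)).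

End gaussian.

(* Main.v *)
From HB Require Import structures.
Require Import Defs.
From mathcomp Require Import all_boot all_order all_algebra all_fingroup.
From mathcomp Require Import all_classical all_reals all_analysis.
From mathcomp Require Import measurable_realfun ring lra.
Set Implicit Arguments.
Unset Strict Implicit.
Unset Printing Implicit Defensive.
Import Order.TTheory GRing.Theory Num.Theory.
Import numFieldNormedType.Exports.
Local Open Scope classical_set_scope.
Local Open Scope ring_scope.

(** Let [P0] and [P1] be the laws of the sample under the two hypotheses.

    Impossibility. The Gaussian pair law has the density [mehler_tuple rho] with
    respect to the product of its marginals. For [m = n] the likelihood ratio [L]
    is the average over the permutations [s] of the products of
    [mehler_tuple rho (X_j) (Y_(s j))]. Since [1_A * L <= C / 2 * 1_A + L ^+ 2 / (2 * C)],
    a bound [C] on the mean of [L ^+ 2] under [P0] gives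
    [P1 A <= C / 2 * P0 A + 1 / 2] for every event [A] ([planted_law_le], which
    reduces [m < n] to this case), and excludes tests with vanishing errors.
    Mehler kernels form a semigroup in which correlations multiply, so that the
    mean of [L ^+ 2] is the average over the permutations of a product over their
    cycles, where a cycle of length [a] contributes the trace
    [(1 - rho ^+ (2 * a)) ^- d]. The average is bounded by a recursion that
    removes one point from the permutation ([perm_kernel_integralS]). If
    [(1 - rho ^+ 2) ^- d <= N], the traces are at most [1 + B * rho ^+ (2 * a)] with
    [B = d * N]; for traces equal to this bound the recursion has the explicit
    solution [trace_poly], and the average is at most
    [(1 - rho ^+ 2) ^- B <= N ^ N] ([perm_kernel_integral_le]). Strong detection
    therefore forces [(1 - rho ^+ 2) ^- d] to tend to infinity
    ([gaussian_detection_necessary]), which is the condition of the theorem in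
    each of the two regimes.

    Detection. The test compares the sum of [h (X_j) (Y_i)] over all [i] and [j]
    with half of its mean under [P1]. Here [h] is a sum over the coordinates of
    [f (x, y) = \sum_b phi b x * phi b y], for [K] odd functions [phi b] with
    disjoint supports and second moment at most 1 ([odd_kernel]). As [h] has mean
    zero in each argument, the terms at mismatched indices are pairwise
    orthogonal, up to transposition of the indices, under both laws
    ([labelled_stat_second_moment]). The variance is thus of order [n * m * d * K],
    while the mean under [P1] is [m * d * c], where [c] is the mean of [f] under
    correlation [rho]. With [m] proportional to [n], both errors are small once
    [d * c ^+ 2 / K] and [n] are large ([gaussian_detection_sufficient]). In growing
    dimension the sign function suffices: then [K = 1] and [c] is at least a
    constant times [rho]. In fixed dimension, the [phi b] are normalized signs on
    [K] shells; as [rho] tends to 1, [c] tends to [K], and [c ^+ 2 / K] can be made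
    as large as needed by the choice of [K]. *)

(** * Laws of i.i.d. tuples *)

(** Measurability of the identity into [T] expresses that [G] generates all
    measurable sets; this is the form in which it is available for
    products and tuples, whose measurable functions are characterized by
    their coordinates. *)
Lemma probability_eq_on_generator d (T : measurableType d) (R : realType)
    (G : set (set T)) (m1 m2 : probability T R) :
  setI_closed G -> G setT -> G `<=` measurable ->
  measurable_fun setT (id : g_sigma_algebraType G -> T) ->
  (forall A, G A -> m1 A = m2 A) ->
  forall A, measurable A -> m1 A = m2 A.
Proof.
move=> GI GT Gm mid m12 A mA.
apply: (@measure_unique _ _ _ G (fun=> setT)) => //.
- apply/seteqP; split => [X mX|X].
    have := mid measurableT X mX; rewrite setTI preimage_id.
    exact.
  apply: smallest_sub => //; exact: sigma_algebra_measurable.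
- by rewrite bigcup_const //; exists 0%N.
- by move=> k /=; rewrite probability_setT ltry.
Qed.

Section boxes.
Context d (T : measurableType d).

Definition tuple_box n (A : 'I_n -> set T) : set (n.-tuple T) :=
  [set t | forall i, A i (tnth t i)].

Lemma measurable_tuple_box n (A : 'I_n -> set T) :
  (forall i, measurable (A i)) -> measurable (tuple_box A).
Proof.
move=> mA.
rewrite (_ : tuple_box A = \bigcap_(i in [set: 'I_n]) ((@tnth n T)^~ i @^-1` A i)).
  apply: fin_bigcap_measurable => // i _; rewrite -[X in measurable X]setTI.
  exact: measurable_tnth.
by apply/seteqP; split => [t tA i _|t tA i]; exact: tA.
Qed.

Lemma tuple_boxI n (A B : 'I_n -> set T) :
  tuple_box A `&` tuple_box B = tuple_box (fun i => A i `&` B i).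
Proof.
apply/seteqP; split => [t [tA tB] i|t tAB]; first by split; [exact: tA|exact: tB].
by split => i; have [] := tAB i.
Qed.

Lemma tuple_boxT n : tuple_box (fun _ : 'I_n => setT) = setT.
Proof. by apply/seteqP; split. Qed.

Lemma tnth_preimage_box n (i : 'I_n) (A : set T) :
  (@tnth n T)^~ i @^-1` A = tuple_box (fun j => if j == i then A else setT).
Proof.
apply/seteqP; split => [t At j|t /(_ i)]; last by rewrite eqxx.
by have [->|//] := eqVneq j i.
Qed.

End boxes.

Lemma tuple_probability_unique d (T : measurableType d) (R : realType) n
    (m1 m2 : probability (n.-tuple T) R) :
  (forall A : 'I_n -> set T, (forall i, measurable (A i)) ->
     m1 (tuple_box A) = m2 (tuple_box A)) ->
  forall X, measurable X -> m1 X = m2 X.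
Proof.
move=> m12; pose G := [set tuple_box A | A in
  [set A : 'I_n -> set T | forall i, measurable (A i)]].
apply: (@probability_eq_on_generator _ _ _ G).
- move=> _ _ [A mA <-] [B mB <-]; rewrite tuple_boxI.
  by exists (fun i => A i `&` B i) => // i; exact: measurableI.
- by exists (fun=> setT) => //; rewrite tuple_boxT.
- by move=> _ [A mA <-]; exact: measurable_tuple_box.
- apply/measurable_fun_tnthP => i _ B mB; rewrite setTI.
  apply: sub_sigma_algebra; exists (fun j => if j == i then B else setT).
    by move=> j /=; case: ifP.
  by rewrite -tnth_preimage_box.
- by move=> _ [A mA <-]; exact: m12.
Qed.

Lemma tuple_pair_probability_unique d1 d2 (T1 : measurableType d1)
    (T2 : measurableType d2) (R : realType) n m
    (m1 m2 : probability (n.-tuple T1 * m.-tuple T2)%type R) :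
  (forall (A : 'I_n -> set T1) (B : 'I_m -> set T2),
     (forall i, measurable (A i)) -> (forall i, measurable (B i)) ->
     m1 (tuple_box A `*` tuple_box B) = m2 (tuple_box A `*` tuple_box B)) ->
  forall X, measurable X -> m1 X = m2 X.
Proof.
move=> m12; pose G := [set tuple_box AB.1 `*` tuple_box AB.2 | AB in
  [set AB : ('I_n -> set T1) * ('I_m -> set T2) |
    (forall i, measurable (AB.1 i)) /\ forall i, measurable (AB.2 i)]].
apply: (@probability_eq_on_generator _ _ _ G).
- move=> _ _ [[A A'] [/= mA mA'] <-] [[B B'] [/= mB mB'] <-].
  rewrite -setXI !tuple_boxI.
  exists (fun i => A i `&` B i, fun i => A' i `&` B' i) => //.
  by split => i /=; exact: measurableI.
- by exists (fun=> setT, fun=> setT) => //=; rewrite !tuple_boxT setXTT.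
- by move=> _ [[A B] [/= mA mB] <-]; apply: measurableX; exact: measurable_tuple_box.
- apply/prod_measurable_funP; split; apply/measurable_fun_tnthP => i _ B mB;
    rewrite setTI; apply: sub_sigma_algebra.
    exists (fun j => if j == i then B else setT, fun=> setT) => /=.
      by split => // j; case: ifP.
    by rewrite tuple_boxT -tnth_preimage_box; apply/seteqP; split => [x []|x].
  exists (fun=> setT, fun j => if j == i then B else setT) => /=.
    by split => // j; case: ifP.
  by rewrite tuple_boxT -tnth_preimage_box; apply/seteqP; split => [x []|x].
- by move=> _ [[A B] [/= mA mB] <-]; exact: m12.
Qed.

Section tuple_prob_theory.
Context d (T : measurableType d) (R : realType).
Implicit Type P : probability T R.

Lemma tuple_prob_box P n (A : 'I_n -> set T) : (forall i, measurable (A i)) ->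
  tuple_prob n P (tuple_box A) = (\prod_(i < n) P (A i))%E.
Proof.
elim: n A => [|n IH] A mA.
  by rewrite big_ord0 /= diracE mem_set// => -[].
rewrite big_ord_recl -IH; last by move=> i; exact: mA.
rewrite [LHS]/= /distribution /pushforward.
rewrite -product_measure1E//; last exact: measurable_tuple_box.
congr (product_measure1 _ _ _); apply/seteqP; split => -[x t] /=.
  move=> xtA; split => /=; first by have := xtA ord0; rewrite tnth0.
  by move=> i; have := xtA (lift ord0 i); rewrite tnthS.
move=> -[/= Ax At] i; have [j ->|->] := unliftP ord0 i; last by rewrite tnth0.
by rewrite tnthS; exact: At.
Qed.

End tuple_prob_theory.

(** * Coordinatewise images of i.i.d. tuples *)

Lemma product_probabilityE d1 d2 (T1 : measurableType d1) (T2 : measurableType d2)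
    (R : realType) (P1 : probability T1 R) (P2 : probability T2 R) A B :
  measurable A -> measurable B ->
  (P1 \x P2)%E (A `*` B) = (P1 A * P2 B)%E.
Proof. by move=> mA mB; exact: product_measure1E. Qed.

Lemma prod_pick_preimage (R : realType) m n (f : 'I_m -> 'I_n)
    (F : 'I_m -> 'I_n -> \bar R) (H : 'I_n -> \bar R) : injective f ->
  (\prod_(j < n) (if [pick i | f i == j] is Some i then F i j else H j) =
   (\prod_(i < m) F i (f i)) * \prod_(j < n | j \notin codom f) H j)%E.
Proof.
move=> finj; rewrite (bigID (fun j => j \in codom f)) /=; congr (_ * _)%E.
  rewrite (eq_bigl (mem (f @: [set: 'I_m]%SET))); last first.
    by move=> j; apply/codomP/imsetP => [[i ->]|[i _ ->]]; exists i.
  rewrite big_imset /=; last by move=> i i' _ _; exact: finj.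
  under eq_bigl do rewrite finset.in_setT; apply: eq_bigr => i _.
  case: pickP => [i' /eqP/finj -> //|/(_ i)]; by rewrite eqxx.
apply: eq_bigr => j jf; case: pickP => // i /eqP fij.
by rewrite -fij codom_f in jf.
Qed.

Section tuple_select.
Context d d' (T : measurableType d) (T' : measurableType d').

Definition tuple_select m n (g : T -> T') (f : 'I_m -> 'I_n)
  (t : n.-tuple T) : m.-tuple T' := [tuple g (tnth t (f i)) | i < m].

Lemma measurable_tuple_select m n (g : T -> T') (f : 'I_m -> 'I_n) :
  measurable_fun setT g -> measurable_fun setT (tuple_select g f).
Proof.
move=> mg; apply/measurable_fun_tnthP => i.
rewrite (_ : _ \o _ = g \o (@tnth n T ^~ (f i))).
  by apply: measurableT_comp => //; exact: measurable_tnth.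
by apply/funext => t /=; rewrite tnth_mktuple.
Qed.

End tuple_select.

Section sample_pair.
Context d1 d2 (T1 : measurableType d1) (T2 : measurableType d2) (R : realType).
Implicit Types PXY : probability (T1 * T2)%type R.

(** A pair is attached to every index of X, and [f] selects the second halves
    that are observed. Under either hypothesis the observed sample is the
    image of an i.i.d. tuple of pairs under such a map, so that all later
    computations take place on a single i.i.d. tuple. *)
Definition sample_pair n m (f : 'I_m -> 'I_n) (z : n.-tuple (T1 * T2)) :
    n.-tuple T1 * m.-tuple T2 :=
  ([tuple (tnth z j).1 | j < n], [tuple (tnth z (f i)).2 | i < m]).

Lemma measurable_sample_pair n m (f : 'I_m -> 'I_n) :
  measurable_fun setT (sample_pair f).
Proof.
have := measurable_tuple_select (@id 'I_n) (@measurable_fst _ _ T1 T2).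
have := measurable_tuple_select f (@measurable_snd _ _ T1 T2).
exact: (fun p q => measurable_fun_pair q p).
Qed.

HB.instance Definition _ n m (f : 'I_m -> 'I_n) :=
  isMeasurableFun.Build _ _ _ _ (sample_pair f) (measurable_sample_pair f).

Lemma tuple_prob_sample_pair_box PXY n m (f : 'I_m -> 'I_n)
    (A : 'I_n -> set T1) (B : 'I_m -> set T2) : injective f ->
  (forall i, measurable (A i)) -> (forall i, measurable (B i)) ->
  tuple_prob n PXY (sample_pair f @^-1` (tuple_box A `*` tuple_box B)) =
  ((\prod_(i < m) PXY (A (f i) `*` B i)) *
   \prod_(j < n | j \notin codom f) marginalX PXY (A j))%E.
Proof.
move=> finj mA mB.
rewrite -(prod_pick_preimage (fun i j => PXY (A j `*` B i)))//.
have -> : sample_pair f @^-1` (tuple_box A `*` tuple_box B) = tuple_box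
    (fun j => if [pick i | f i == j] is Some i then A j `*` B i else A j `*` setT).
  apply/seteqP; split => z.
    move=> [zA zB] j; have := zA j; rewrite tnth_mktuple => Aj.
    case: pickP => // i /eqP fij; split => //.
    by have := zB i; rewrite tnth_mktuple fij.
  move=> zAB; split => i; rewrite tnth_mktuple.
    by have := zAB i; case: pickP => [i' _ []|_ []].
  by have := zAB (f i); case: pickP => [i' /eqP/finj -> []//|/(_ i)]; rewrite eqxx.
rewrite tuple_prob_box; last by move=> j; case: pickP => *; exact: measurableX.
apply: eq_bigr => j _; case: pickP => // _.
by rewrite /marginalX /distribution /pushforward; congr (PXY _);
  apply/seteqP; split => [x []|x].
Qed.

(** Instead of merging matched pairs with fresh first halves, one may draw a
    full pair for every index of X and forget the second halves outside
    the range of [pi]. Both laws are products on boxes. *)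
Lemma planted_law_givenE PXY n m (pi : {ffun 'I_m -> 'I_n}) A :
  injective pi -> measurable A ->
  planted_law_given PXY pi A = tuple_prob n PXY (sample_pair pi @^-1` A).
Proof.
move=> pinj mA.
apply: (@tuple_pair_probability_unique _ _ _ _ _ _ _ _
  (distribution (tuple_prob n PXY) (sample_pair pi))) A mA => A B mA mB.
rewrite [RHS]tuple_prob_sample_pair_box//.
transitivity ((tuple_prob m PXY \x tuple_prob n (marginalX PXY))%E
    (tuple_box (fun i => A (pi i) `*` B i) `*`
     tuple_box (fun j => if j \notin codom pi then A j else setT))).
  apply: (congr1 (product_measure1 (tuple_prob m PXY) _)); apply/seteqP; split => -[z w].
    move=> [zA zB]; split => /= i.
      have := zA (pi i); have := zB i; rewrite !tnth_mktuple /=.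
      by case: pickP => [i' /eqP/pinj ->//|/(_ i)]; rewrite eqxx.
    have := zA i; rewrite tnth_mktuple; case: ifP => // ni.
    by case: pickP => //= i' /eqP ii'; rewrite -ii' codom_f in ni.
  move=> [/= zA wA]; split => /= i; rewrite tnth_mktuple.
    case: pickP => [i' /eqP <-|nopi]; first by have [] := zA i'.
    have := wA i; case: ifPn => // /negPn/codomP[i' ii'].
    by have := nopi i'; rewrite ii' eqxx.
  by have [] := zA i.
rewrite product_measure1E; last 2 first.
  by apply: measurable_tuple_box => i; exact: measurableX.
  by apply: measurable_tuple_box => i; case: ifP.
congr (_ * _)%E; first by apply: tuple_prob_box => i; exact: measurableX.
rewrite [RHS]big_mkcond /=; apply: etrans; first apply: tuple_prob_box.
  by move=> i; case: ifP.
by apply: eq_bigr => j _; case: ifP => // _; rewrite probability_setT.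
Qed.

(** If the two halves of a pair are independent, it does not matter which
    second halves are kept; this brings the null law to the form used for
    the planted one. *)
Lemma product_tuple_probE (P1 : probability T1 R) (P2 : probability T2 R) n m
    (f : 'I_m -> 'I_n) A : injective f -> measurable A ->
  (tuple_prob n P1 \x tuple_prob m P2)%E A =
  tuple_prob n (P1 \x P2)%E (sample_pair f @^-1` A).
Proof.
move=> finj mA.
apply: (@tuple_pair_probability_unique _ _ _ _ _ _ _
  (tuple_prob n P1 \x tuple_prob m P2)%E
  (distribution (tuple_prob n (P1 \x P2)%E) (sample_pair f))) A mA => A B mA mB.
rewrite [RHS]tuple_prob_sample_pair_box//.
transitivity ((\prod_(j < n) P1 (A j)) * \prod_(i < m) P2 (B i))%E.
  rewrite [LHS]product_probabilityE; try exact: measurable_tuple_box.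
  by rewrite !tuple_prob_box.
have mX j : marginalX (P1 \x P2)%E (A j) = P1 (A j).
  transitivity ((P1 \x P2)%E (A j `*` setT)).
    apply: (congr1 (product_measure1 P1 _)).
    by apply/seteqP; split => [x|x []].
  by rewrite product_probabilityE// probability_setT mule1.
rewrite [X in _ = (_ * X)%E](eq_bigr _ (fun j _ => mX j)).
rewrite [X in _ = (X * _)%E](eq_bigr _ (fun i _ =>
  product_probabilityE P1 P2 (mA (f i)) (mB i))).
have -> : (\prod_(i < n) P1 (A i) = (\prod_(i < m) P1 (A (f i))) *
  \prod_(j < n | j \notin codom f) P1 (A j))%E.
  rewrite -(prod_pick_preimage (fun _ j => P1 (A j)))//.
  by apply: eq_bigr => j _; case: pickP.
by rewrite big_split /= muleAC.
Qed.

Lemma null_lawE PXY (P1 : probability T1 R) (P2 : probability T2 R) n m A :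
  (forall B, measurable B -> marginalX PXY B = P1 B) ->
  (forall B, measurable B -> marginalY PXY B = P2 B) -> measurable A ->
  null_law PXY n m A = (tuple_prob n P1 \x tuple_prob m P2)%E A.
Proof.
move=> PX PY mA.
apply: (@tuple_pair_probability_unique _ _ _ _ _ _ _ (null_law PXY n m)
  (tuple_prob n P1 \x tuple_prob m P2)%E) A mA => A B mA mB.
have mBA := measurable_tuple_box mA; have mBB := measurable_tuple_box mB.
transitivity (tuple_prob n (marginalX PXY) (tuple_box A) *
              tuple_prob m (marginalY PXY) (tuple_box B))%E.
  exact: product_probabilityE.
rewrite [RHS]product_probabilityE// !tuple_prob_box//.
by congr (_ * _)%E; apply: eq_bigr => i _; rewrite ?PX ?PY.
Qed.

End sample_pair.

(** * Integration against i.i.d. tuples *)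

Section density.
Import HBNNSimple.

(** By linearity for simple functions and monotone convergence. *)
Lemma ge0_integral_density d (T : measurableType d) (R : realType)
    (mu nu : {measure set T -> \bar R}) (g : T -> R) (f : T -> \bar R) :
  measurable_fun setT g -> (forall x, 0 <= g x) ->
  (forall A, measurable A -> nu A = (\int[mu]_(x in A) (g x)%:E)%E) ->
  measurable_fun setT f -> (forall x, 0 <= f x)%E ->
  (\int[nu]_x f x = \int[mu]_x (f x * (g x)%:E))%E.
Proof.
move=> mg g0 nuE mf f0.
have nu_nnsfun (h : {nnsfun T >-> R}) :
    (\int[nu]_x (h x)%:E = \int[mu]_x ((h x)%:E * (g x)%:E))%E.
  rewrite integral_nnsfun// sintegralE.
  under [RHS]eq_integral => x _.
    rewrite (fimfunE h x) -fsumEFin// ge0_mule_fsuml; last first.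
      by move=> r; exact: nnfun_muleindic_ge0.
    over.
  rewrite ge0_integral_fsum//; last 2 first.
  - move=> r; apply: emeasurable_funM; last exact/measurable_EFinP.
    by apply/measurable_EFinP/measurable_funM => //; exact: measurable_indic.
  - move=> r x _; apply: mule_ge0; last by rewrite lee_fin.
    exact: nnfun_muleindic_ge0.
  rewrite patch_setT; apply: eq_fsbigr => r; rewrite inE => -[x _ <-].
  rewrite nuE//.
  transitivity (\int[mu]_y ((h x)%:E *
      ((\1_(h @^-1` [set h x]) y)%:E * (g y)%:E)))%E; last first.
    by apply: eq_integral => y _; rewrite muleA -EFinM.
  rewrite ge0_integralZl//; last 3 first.
  - apply: emeasurable_funM; last exact/measurable_EFinP.
    exact/measurable_EFinP/measurable_indic.
  - by move=> y _; rewrite mule_ge0 ?lee_fin.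
  - by rewrite lee_fin.
  congr (_ * _)%E; rewrite [LHS]integral_mkcond; apply: eq_integral => y _.
  by rewrite patchE indicE; case: ifP; rewrite ?mul1e ?mul0e.
pose h_ := nnsfun_approx measurableT mf.
transitivity (lim ((\int[nu]_x (h_ n x)%:E)%E @[n --> \oo])).
  rewrite -monotone_convergence//=.
  - by apply: eq_integral => x _; apply/esym/cvg_lim => //; exact: cvg_nnsfun_approx.
  - by move=> n; exact/measurable_EFinP/measurable_funTS.
  - by move=> n x _; rewrite lee_fin.
  - by move=> x _ a b ab; rewrite lee_fin; exact/lefP/nd_nnsfun_approx.
under eq_fun do rewrite nu_nnsfun.
rewrite -monotone_convergence//=.
- apply: eq_integral => x _; apply/cvg_lim => //.
  by apply: cvgeZr => //; exact: cvg_nnsfun_approx.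
- by move=> n; apply: emeasurable_funM; exact/measurable_EFinP.
- by move=> n x _; rewrite mule_ge0 ?lee_fin.
- move=> x _ a b ab; rewrite lee_wpmul2r ?lee_fin//.
  exact/lefP/nd_nnsfun_approx.
Qed.

End density.

Section integral_tuple_prob.
Context d (T : measurableType d) (R : realType) (P : probability T R).

Lemma ge0_integral_tuple_prob0 (f : 0.-tuple T -> \bar R) :
  measurable_fun setT f -> (\int[tuple_prob 0 P]_t f t = f [tuple])%E.
Proof.
by move=> mf; rewrite /= integral_dirac// diracT mul1e.
Qed.

Lemma ge0_integral_tuple_probS n (f : n.+1.-tuple T -> \bar R) :
  measurable_fun setT f -> (forall t, 0 <= f t)%E ->
  (\int[tuple_prob n.+1 P]_t f t =
   \int[P]_x \int[tuple_prob n P]_t f [tuple of x :: t])%E.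
Proof.
move=> mf f0 /=; rewrite ge0_integral_distribution// fubini_tonelli1//.
  by apply: measurableT_comp => //; exact: measurable_cons_pair.
by move=> p; exact: f0.
Qed.

Lemma ge0_integral_tuple_probS2 n (f : n.+1.-tuple T -> \bar R) :
  measurable_fun setT f -> (forall t, 0 <= f t)%E ->
  (\int[tuple_prob n.+1 P]_t f t =
   \int[tuple_prob n P]_t \int[P]_x f [tuple of x :: t])%E.
Proof.
move=> mf f0 /=; rewrite ge0_integral_distribution// fubini_tonelli2//.
  by apply: measurableT_comp => //; exact: measurable_cons_pair.
by move=> p; exact: f0.
Qed.

Lemma measurable_prod_tnth n (g : 'I_n -> T -> R) :
  (forall i, measurable_fun setT (g i)) ->
  measurable_fun setT (fun t : n.-tuple T => \prod_(i < n) g i (tnth t i)).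
Proof.
move=> mg; apply: measurable_prod => i _.
by apply: measurableT_comp => //; exact: measurable_tnth.
Qed.

Lemma integral_tuple_prob_prod n (g : 'I_n -> T -> R) :
  (forall i, measurable_fun setT (g i)) -> (forall i x, 0 <= g i x) ->
  (\int[tuple_prob n P]_t (\prod_(i < n) g i (tnth t i))%:E =
   \prod_(i < n) \int[P]_x (g i x)%:E)%E.
Proof.
elim: n g => [|n IH] g mg g0.
  rewrite ge0_integral_tuple_prob0 ?big_ord0//.
  by apply/measurable_EFinP; apply: measurable_prod_tnth; exact: mg.
rewrite ge0_integral_tuple_probS; last 2 first.
- by apply/measurable_EFinP; apply: measurable_prod_tnth.
- by move=> t; rewrite lee_fin prodr_ge0.
pose G := fun t : n.-tuple T => \prod_(i < n) g (lift ord0 i) (tnth t i).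
have mG : measurable_fun setT (EFin \o G).
  apply/measurable_EFinP.
  by apply: (measurable_prod_tnth (g := fun i => g (lift ord0 i))) => i; exact: mg.
have G0 t : (0 <= (G t)%:E)%E by rewrite lee_fin prodr_ge0.
transitivity (\int[P]_x ((g ord0 x)%:E * \int[tuple_prob n P]_t (G t)%:E))%E.
  apply: eq_integral => x _; rewrite -ge0_integralZl//; last by rewrite lee_fin.
  apply: eq_integral => t _; rewrite -EFinM big_ord_recl tnth0.
  by under eq_bigr do rewrite tnthS.
rewrite ge0_integralZr//.
- by rewrite (IH (fun i => g (lift ord0 i)))// big_ord_recl.
- exact/measurable_EFinP.
- by move=> x _; rewrite lee_fin.
- exact: integral_ge0.
Qed.

(** By induction on [n]: the first entry is integrated by itself, and its
    density is a constant for the integral over the others. *)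
Lemma ge0_integral_tuple_density (Q : probability T R) (l : T -> R) :
  measurable_fun setT l -> (forall x, 0 <= l x) ->
  (forall A, measurable A -> Q A = (\int[P]_(x in A) (l x)%:E)%E) ->
  forall n (f : n.-tuple T -> \bar R), measurable_fun setT f ->
  (forall t, 0 <= f t)%E ->
  (\int[tuple_prob n Q]_t f t =
   \int[tuple_prob n P]_t (f t * (\prod_(i < n) l (tnth t i))%:E))%E.
Proof.
move=> ml l0 QE.
have mp n : measurable_fun setT (fun t : n.-tuple T =>
    (\prod_(i < n) l (tnth t i))%:E).
  apply/measurable_EFinP; exact: (measurable_prod_tnth (g := fun=> l)).
elim => [|n IH] f mf f0.
  rewrite ge0_integral_tuple_prob0; last first.
    by apply: emeasurable_funM => //; exact: mp.
  by rewrite big_ord0 mule1 /= integral_dirac// diracT mul1e.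
have mcons (h : n.+1.-tuple T -> \bar R) : measurable_fun setT h ->
    measurable_fun setT (fun p : T * n.-tuple T => h [tuple of p.1 :: p.2]).
  by move=> mh; apply: measurableT_comp => //; exact: measurable_cons_pair.
have mprod : measurable_fun setT (fun t : n.+1.-tuple T =>
    (f t * (\prod_(i < n.+1) l (tnth t i))%:E)%E).
  by apply: emeasurable_funM => //; exact: mp.
transitivity (\int[Q]_x \int[tuple_prob n Q]_t f [tuple of x :: t])%E.
  rewrite /= ge0_integral_distribution// fubini_tonelli1//.
    exact: mcons.
  by move=> p; exact: f0.
have mfp : measurable_fun setT (fun p : T * n.-tuple T =>
    f [tuple of p.1 :: p.2] * (\prod_(i < n) l (tnth p.2 i))%:E)%E.
  apply: emeasurable_funM; first exact: mcons.
  exact: (measurableT_comp (mp n)).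
have fp0 (p : T * n.-tuple T) : (0 <= f [tuple of p.1 :: p.2] *
    (\prod_(i < n) l (tnth p.2 i))%:E)%E.
  by rewrite mule_ge0// lee_fin prodr_ge0.
transitivity (\int[Q]_x \int[tuple_prob n P]_t
    (f [tuple of x :: t] * (\prod_(i < n) l (tnth t i))%:E))%E.
  apply: eq_integral => x _; rewrite (IH (fun t => f [tuple of x :: t]))//.
  exact: (measurableT_comp (mcons _ mf) (pair1_measurable x)).
pose F x := (\int[tuple_prob n P]_t
    (f [tuple of x :: t] * (\prod_(i < n) l (tnth t i))%:E))%E.
have mF : measurable_fun setT F.
  exact: (@measurable_fun_fubini_tonelli_F _ _ _ _ _ (tuple_prob n P) _ mfp fp0).
have F0 x : (0 <= F x)%E by apply: integral_ge0 => t _; exact: (fp0 (x, t)).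
rewrite (ge0_integral_density ml l0 QE mF F0).
rewrite ge0_integral_tuple_probS//; last first.
  by move=> t; rewrite mule_ge0// lee_fin prodr_ge0.
apply: eq_integral => x _; rewrite -ge0_integralZr//; last 3 first.
- exact: (measurableT_comp mfp (pair1_measurable x)).
- by move=> t _; exact: (fp0 (x, t)).
- by rewrite lee_fin.
apply: eq_integral => t _; rewrite -muleA -EFinM; congr (_ * _%:E)%E.
rewrite [RHS]big_ord_recl tnth0 mulrC; congr (_ * _).
by apply: eq_bigr => i _; rewrite tnthS.
Qed.

End integral_tuple_prob.

(** * Integrals of products of kernels along permutations *)

Section insertion.
Local Open Scope group_scope.

(** The point 0 is inserted in the cycle of [i] between [i] and [s i] when
    [j = lift ord0 i], and becomes a fixed point when [j = ord0]. *)
Definition perm_insert n (j : 'I_n.+1) (s : 'S_n) : 'S_n.+1 :=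
  (tperm ord0 j * lift_perm ord0 ord0 s)%g.

Lemma perm_insert_bij n :
  bijective (fun p : 'S_n * 'I_n.+1 => perm_insert p.2 p.1).
Proof.
apply: inj_card_bij; last first.
  by rewrite card_prod !card_Sn card_ord factS mulnC.
move=> [s1 j1] [s2 j2] /= E.
have E0 j s : @perm_insert n j s j = ord0 by rewrite permM tpermR lift_perm_id.
have j12 : j1 = j2 by apply: (@perm_inj _ (perm_insert j1 s1)); rewrite {2}E !E0.
move: E; rewrite j12 => /mulgI E; congr (_, _); apply/permP => i.
by apply: (@lift_inj _ ord0); rewrite -!(lift_perm_lift ord0) E.
Qed.

End insertion.

Section prod_insert.
Variables (R : comRingType) (n : nat) (a : 'I_n.+1 -> 'I_n.+1 -> R) (s : 'S_n).

Lemma prod_perm_insert0 : \prod_i a i (perm_insert ord0 s i) =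
  a ord0 ord0 * \prod_i a (lift ord0 i) (lift ord0 (s i)).
Proof.
rewrite big_ord_recl permM tperm1 perm1 lift_perm_id; congr (_ * _).
by apply: eq_bigr => i _; rewrite permM tperm1 perm1 lift_perm_lift.
Qed.

Lemma prod_perm_insert_lift i : \prod_j a j (perm_insert (lift ord0 i) s j) =
  a ord0 (lift ord0 (s i)) * a (lift ord0 i) ord0 *
  \prod_(j | j != i) a (lift ord0 j) (lift ord0 (s j)).
Proof.
rewrite big_ord_recl permM tpermL lift_perm_lift -mulrA; congr (_ * _).
rewrite (bigD1 i) //= permM tpermR lift_perm_id; congr (_ * _).
apply: eq_bigr => j ji; rewrite permM tpermD ?lift_perm_lift//.
by rewrite (inj_eq lift_inj) eq_sym.
Qed.

Lemma sum_perm_insert (F : 'S_n.+1 -> R) :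
  \sum_(t : 'S_n.+1) F t =
  \sum_(t : 'S_n) (F (perm_insert ord0 t) +
                   \sum_(i < n) F (perm_insert (lift ord0 i) t)).
Proof.
rewrite (reindex _ (onW_bij _ (perm_insert_bij n))) /=.
rewrite -(pair_big predT predT (fun t j => F (perm_insert j t))) /=.
by apply: eq_bigr => t _; rewrite big_ord_recl.
Qed.

End prod_insert.

Section cyclic_integrals.
Context d (T : measurableType d) (R : realType) (P : probability T R).
Variable k : nat -> T -> T -> R.
Hypothesis mk : forall a, measurable_fun setT (fun p : T * T => k a p.1 p.2).
Hypothesis k_ge0 : forall a x y, 0 <= k a x y.
Hypothesis k_semigroup : forall a b x z, (0 < a)%N -> (0 < b)%N ->
  (\int[P]_y (k a x y * k b y z)%:E = (k (a + b) x z)%:E)%E.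

Definition kernel_trace a := (\int[P]_x (k a x x)%:E)%E.

(** A permanent. The weight of a factor counts the factors of the original
    kernel that have been merged into it by the semigroup property. *)
Definition perm_kernel n (w : 'I_n -> nat) (t : n.-tuple T) : R :=
  \sum_(s : 'S_n) \prod_(i < n) k (w i) (tnth t i) (tnth t (s i)).

(** When 0 lies between [i] and [s i] in its cycle, integrating out the
    variable of 0 merges its factor with that of [i]. *)
Definition merge_weight n (w : 'I_n.+1 -> nat) (i : 'I_n) (j : 'I_n) : nat :=
  (w (lift ord0 j) + (if j == i then w ord0 else 0))%N.

Let mk_tnth n a (i j : 'I_n) :
  measurable_fun setT (fun t : n.-tuple T => k a (tnth t i) (tnth t j)).
Proof.
have mij : measurable_fun setT (fun t : n.-tuple T => (tnth t i, tnth t j)).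
  by apply: measurable_fun_pair; exact: measurable_tnth.
exact: (measurableT_comp (mk a) mij).
Qed.

Lemma perm_kernel_ge0 n (w : 'I_n -> nat) t : 0 <= perm_kernel w t.
Proof. by apply: sumr_ge0 => s _; apply: prodr_ge0. Qed.

Lemma measurable_perm_kernel n (w : 'I_n -> nat) :
  measurable_fun setT (perm_kernel w).
Proof.
apply: measurable_sum => s; apply: measurable_prod => i _; exact: mk_tnth.
Qed.

Let mkl a y : measurable_fun setT (fun x => k a x y).
Proof. exact: (measurableT_comp (mk a) (pair2_measurable y)). Qed.

Let mkr a x : measurable_fun setT (fun y => k a x y).
Proof. exact: (measurableT_comp (mk a) (pair1_measurable x)). Qed.

Let mkd a : measurable_fun setT (fun x => k a x x).
Proof.
have mxx : measurable_fun setT (fun x : T => (x, x)).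
  by apply: measurable_fun_pair; exact: measurable_id.
exact: (measurableT_comp (mk a) mxx).
Qed.

(** Every permutation arises from one of the other points by inserting 0. If 0
    is a fixed point, the integral produces the trace of its factor;
    otherwise the semigroup property merges the two factors that contain
    the variable. *)
Lemma integral_perm_kernel_cons n (w : 'I_n.+1 -> nat) (t : n.-tuple T) :
  (forall i, (0 < w i)%N) ->
  (\int[P]_x (perm_kernel w [tuple of x :: t])%:E =
   kernel_trace (w ord0) * (perm_kernel (fun i => w (lift ord0 i)) t)%:E +
   \sum_(i < n) (perm_kernel (merge_weight w i) t)%:E)%E.
Proof.
move=> w0.
pose p (s : 'S_n) := \prod_(i < n) k (w (lift ord0 i)) (tnth t i) (tnth t (s i)).
pose p' (s : 'S_n) i := \prod_(j < n | j != i)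
   k (w (lift ord0 j)) (tnth t j) (tnth t (s j)).
have p_ge0 s : 0 <= p s by apply: prodr_ge0.
have p'_ge0 s i : 0 <= p' s i by apply: prodr_ge0.
transitivity (\int[P]_x \sum_(s : 'S_n) ((p s)%:E * (k (w ord0) x x)%:E +
    \sum_(i < n) (p' s i)%:E *
      (k (w (lift ord0 i)) (tnth t i) x * k (w ord0) x (tnth t (s i)))%:E))%E.
  apply: eq_integral => x _; rewrite /perm_kernel.
  pose a i j := k (w i) (tnth [tuple of x :: t] i) (tnth [tuple of x :: t] j).
  rewrite (sum_perm_insert (fun s => \prod_i a i (s i))) -sumEFin.
  apply: eq_bigr => s _; rewrite prod_perm_insert0 EFinD -sumEFin -EFinM.
  congr (_%:E + _)%E.
    rewrite /a tnth0 mulrC; congr (_ * _).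
    by apply: eq_bigr => i _; rewrite !tnthS.
  apply: eq_bigr => i _; rewrite prod_perm_insert_lift /a !tnthS !tnth0 -EFinM.
  congr EFin; rewrite [RHS]mulrC [X in X * _ = _]mulrC; congr (_ * _).
  by apply: eq_bigr => j _; rewrite !tnthS.
have kk_ge0 s i x : (0 <= (k (w (lift ord0 i)) (tnth t i) x *
    k (w ord0) x (tnth t (s i)))%:E)%E by rewrite lee_fin mulr_ge0.
have mkk (s : 'S_n) i : measurable_fun setT (fun x =>
    (k (w (lift ord0 i)) (tnth t i) x * k (w ord0) x (tnth t (s i)))%:E).
  by apply/measurable_EFinP/measurable_funM; [exact: mkr|exact: mkl].
have mS (s : 'S_n) : measurable_fun setT (fun x => \sum_(i < n) (p' s i)%:E *
      (k (w (lift ord0 i)) (tnth t i) x * k (w ord0) x (tnth t (s i)))%:E)%E.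
  by apply: emeasurable_sum => i; exact: measurable_funeM.
have mD (s : 'S_n) : measurable_fun setT (fun x => (p s)%:E * (k (w ord0) x x)%:E)%E.
  by apply: measurable_funeM; apply/measurable_EFinP; exact: mkd.
rewrite ge0_integral_sum//; last 2 first.
- by move=> s; exact: emeasurable_funD.
- move=> s x _; apply: adde_ge0; first by rewrite mule_ge0 ?lee_fin.
  by apply: sume_ge0 => i _; rewrite mule_ge0// lee_fin.
transitivity (\sum_(s : 'S_n) ((p s)%:E * kernel_trace (w ord0) +
    \sum_(i < n) (p' s i * k (w (lift ord0 i) + w ord0) (tnth t i) (tnth t (s i)))%:E))%E.
  apply: eq_bigr => s _; rewrite ge0_integralD//; last 2 first.
  - by move=> x _; rewrite mule_ge0 ?lee_fin.
  - by move=> x _; apply: sume_ge0 => i _; rewrite mule_ge0// lee_fin.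
  rewrite ge0_integralZl//; last 3 first.
  - exact/measurable_EFinP/mkd.
  - by move=> x _; rewrite lee_fin.
  - by rewrite lee_fin.
  congr (_ + _)%E; rewrite ge0_integral_sum//; last 2 first.
  - by move=> i; exact: measurable_funeM.
  - by move=> i x _; rewrite mule_ge0// lee_fin.
  apply: eq_bigr => i _; rewrite ge0_integralZl//; last by rewrite lee_fin.
  by rewrite k_semigroup// EFinM.
rewrite big_split /=; congr (_ + _)%E.
  rewrite muleC -sumEFin ge0_sume_distrl// => s _; rewrite lee_fin.
  exact: p_ge0.
rewrite exchange_big /=; apply: eq_bigr => i _; rewrite /perm_kernel -sumEFin.
apply: eq_bigr => s _; rewrite (bigD1 i)//= /merge_weight eqxx mulrC.
congr (_ * _)%:E; apply: eq_bigr => j /negbTE ji.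
by rewrite ji addn0.
Qed.

Definition perm_kernel_integral n (w : 'I_n -> nat) :=
  (\int[tuple_prob n P]_t (perm_kernel w t)%:E)%E.

Lemma perm_kernel_integralS n (w : 'I_n.+1 -> nat) :
  (forall i, (0 < w i)%N) ->
  (perm_kernel_integral w =
   kernel_trace (w ord0) * perm_kernel_integral (fun i => w (lift ord0 i)) +
   \sum_(i < n) perm_kernel_integral (merge_weight w i))%E.
Proof.
move=> w0; rewrite /perm_kernel_integral ge0_integral_tuple_probS2; last 2 first.
- by apply/measurable_EFinP; exact: measurable_perm_kernel.
- by move=> t; rewrite lee_fin perm_kernel_ge0.
have mpk m (v : 'I_m -> nat) : measurable_fun setT (fun t => (perm_kernel v t)%:E).
  by apply/measurable_EFinP; exact: measurable_perm_kernel.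
have tr0 : (0 <= kernel_trace (w ord0))%E.
  by apply: integral_ge0 => x _; rewrite lee_fin.
under eq_integral do rewrite integral_perm_kernel_cons//.
rewrite ge0_integralD//; last 4 first.
- by move=> t _; rewrite mule_ge0// lee_fin perm_kernel_ge0.
- by apply: measurable_funeM; exact: mpk.
- by move=> t _; apply: sume_ge0 => i _; rewrite lee_fin perm_kernel_ge0.
- by apply: emeasurable_sum => i; exact: mpk.
congr (_ + _)%E.
  rewrite ge0_integralZl//; first exact: mpk.
  by move=> t _; rewrite lee_fin perm_kernel_ge0.
rewrite ge0_integral_sum//; first by move=> i; exact: mpk.
by move=> i t _; rewrite lee_fin perm_kernel_ge0.
Qed.

End cyclic_integrals.

(** * Bounding permanents through the traces of the kernel *)

Section trace_bound.
Variables (R : realType) (q : R) (B : nat).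
Hypothesis q01 : 0 <= q < 1.

Definition rising (b a : nat) : nat := \prod_(j < a) (b + j).

Definition trace_coef (n a : nat) : R := ((n - a)`! * rising B a)%:R.

Definition ntrue n (c : n.-tuple bool) : nat := \sum_(i < n) tnth c i.

(** The solution of the recursion [perm_kernel_integralS] when the traces are
    [1 + B * q ^+ a]. Expanding the product of the traces over the cycles
    of a permutation marks each cycle with [true], for the term
    [B * q ^+ a], or with [false], for the term 1. Here [c] marks the
    points accordingly: [(n - a)`!] counts the permutations of the [n - a]
    points marked [false], and [rising B a = B (B + 1) .. (B + a - 1)] is
    the sum of [B] to the number of cycles over the permutations of the
    [a] points marked [true]. *)
Definition trace_poly n (w : 'I_n -> nat) : R :=
  \sum_(c : n.-tuple bool) trace_coef n (ntrue c) *
    \prod_(i < n) (if tnth c i then q ^+ w i else 1).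

Lemma sum_bool_tupleS n (F : n.+1.-tuple bool -> R) :
  \sum_(c : n.+1.-tuple bool) F c =
  \sum_(c : n.-tuple bool) (F [tuple of true :: c] + F [tuple of false :: c]).
Proof.
rewrite (reindex (fun p : bool * n.-tuple bool => [tuple of p.1 :: p.2])) /=; last first.
  exists (fun c => (thead c, [tuple of behead c])) => [[b c] _|c _] /=.
    by rewrite theadE; congr (_, _); apply/val_inj.
  by rewrite -tuple_eta.
rewrite -(pair_big predT predT (fun b (c : n.-tuple bool) => F [tuple of b :: c])) /=.
by rewrite big_bool big_split.
Qed.

Lemma ntrue_cons n b (c : n.-tuple bool) : ntrue [tuple of b :: c] = (b + ntrue c)%N.
Proof.
rewrite /ntrue big_ord_recl tnth0; congr (_ + _)%N.
by apply: eq_bigr => i _; rewrite tnthS.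
Qed.

Lemma ntrue_le n (c : n.-tuple bool) : (ntrue c <= n)%N.
Proof.
rewrite -[leqRHS]card_ord -sum1_card; apply: leq_sum => i _; exact: leq_b1.
Qed.

Lemma sum_if_tnth n (c : n.-tuple bool) (x : R) :
  \sum_(i < n) (if tnth c i then x else 1) = (ntrue c)%:R * x + (n - ntrue c)%:R.
Proof.
rewrite natrB ?ntrue_le// /ntrue natr_sum mulr_suml -[X in _ + (X%:R - _)]card_ord.
rewrite -sum1_card natr_sum -sumrB -big_split /=; apply: eq_bigr => i _.
by case: (tnth c i); rewrite ?mul1r ?mul0r ?subrr ?addr0 ?add0r ?subr0.
Qed.

(** For a fixed marking [c] of the last [n] points, the first point is either
    marked [true], which raises the rising factorial by the factor
    [B + a], or marked [false], which raises the factorial by [n - a + 1].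
    On the right these numbers are the contribution [B] or [1] of a fixed
    point plus the number of points with the same mark. *)
Lemma trace_polyS n (w : 'I_n.+1 -> nat) :
  trace_poly w = (1 + B%:R * q ^+ w ord0) * trace_poly (fun i => w (lift ord0 i)) +
                 \sum_(i < n) trace_poly (merge_weight w i).
Proof.
rewrite /trace_poly sum_bool_tupleS mulr_sumr exchange_big -big_split /=.
apply: eq_bigr => c _.
pose p := \prod_(i < n) (if tnth c i then q ^+ w (lift ord0 i) else 1).
have E b : \prod_(i < n.+1) (if tnth [tuple of b :: c] i then q ^+ w i else 1) =
    (if b then q ^+ w ord0 else 1) * p.
  rewrite big_ord_recl tnth0; congr (_ * _).
  by apply: eq_bigr => i _; rewrite tnthS.
rewrite !E !ntrue_cons add0n add1n -/p.
have Ei i : \prod_(j < n) (if tnth c j then q ^+ merge_weight w i j else 1) =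
    (if tnth c i then q ^+ w ord0 else 1) * p.
  rewrite /p (bigD1 i)//= [in RHS](bigD1 i)//= /merge_weight eqxx mulrA.
  congr (_ * _); first by case: ifP => _; rewrite ?mulr1// exprD mulrC.
  by apply: eq_bigr => j /negbTE ->; rewrite addn0.
under eq_bigr do rewrite Ei.
rewrite -mulr_sumr -mulr_suml sum_if_tnth /trace_coef.
have cn := ntrue_le c; rewrite subSS.
have -> : (n.+1 - ntrue c)%N = (n - ntrue c).+1 by rewrite subSn.
rewrite factS /rising big_ord_recr /= !natrM natrD -[(n - _).+1%:R]natr1.
ring.
Qed.

Lemma sum_ntrue n (f : nat -> R) :
  \sum_(c : n.-tuple bool) f (ntrue c) = \sum_(a < n.+1) 'C(n, a)%:R * f a.
Proof.
elim: n f => [|n IH] f.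
  rewrite big_ord1 bin0 mul1r (big_pred1 [tuple]) /=.
    by rewrite /ntrue big_ord0.
  by move=> c; apply/esym/eqP; exact: tuple0.
rewrite sum_bool_tupleS.
under eq_bigr do rewrite !ntrue_cons add0n add1n.
rewrite big_split /= (IH (fun a => f a.+1)) (IH f).
rewrite [RHS]big_ord_recl bin0 mul1r.
under [X in _ = _ + X]eq_bigr => i _ do rewrite lift0 binS natrD mulrDl.
rewrite big_split /= addrC [X in X + _ = _]big_ord_recl bin0 mul1r -addrA.
congr (_ + (_ + _)); rewrite big_ord_recr /= bin_small// mul0r addr0.
by apply: eq_bigr => i _.
Qed.

(** A truncated negative binomial series. The induction on [b] uses the Pascal
    rule for its coefficients, so that all sums stay finite. *)
Lemma rising_series b n :
  \sum_(a < n.+1) (rising b a)%:R / a`!%:R * q ^+ a <= (1 - q) ^- b.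
Proof.
case/andP: q01 => q0 q1; elim: b n => [|b IHb].
  move=> n; rewrite expr0 invr1 big_ord_recl /rising big_ord0 /= big1.
    by rewrite fact0 divr1 mul1r expr0 addr0.
  by move=> i _; rewrite big_ord_recl /= add0n mul0n !mul0r.
have fact_neq0 a : a`!%:R != 0 :> R by rewrite pnatr_eq0 -lt0n fact_gt0.
have Pascal a : (rising b.+1 a.+1)%:R / a.+1`!%:R =
    (rising b a.+1)%:R / a.+1`!%:R + (rising b.+1 a)%:R / a`!%:R :> R.
  have E1 : rising b.+1 a.+1 = (rising b.+1 a * (b.+1 + a))%N.
    by rewrite /rising big_ord_recr.
  have E2 : rising b a.+1 = (b * rising b.+1 a)%N.
    rewrite /rising big_ord_recl /= addn0; congr (_ * _)%N.
    by apply: eq_bigr => i _; rewrite /bump leq0n addnA addn1.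
  rewrite E1 E2 factS !natrM !natrD.
  have := fact_neq0 a; have : a.+1%:R != 0 :> R by rewrite pnatr_eq0.
  rewrite -!natr1 => ? ?; field.
  by apply/andP.
move=> n; pose S := \sum_(a < n.+1) (rising b.+1 a)%:R / a`!%:R * q ^+ a.
suff : S <= (1 - q) ^- b + q * S.
  move=> H; rewrite -/S exprS invfM mulrC ler_pdivlMr ?subr_gt0//.
  by rewrite mulrBr mulr1 lerBlDr [S * q]mulrC.
apply: (@le_trans _ _ (\sum_(a < n.+1) (rising b a)%:R / a`!%:R * q ^+ a +
    q * \sum_(a < n) (rising b.+1 a)%:R / a`!%:R * q ^+ a)); last first.
  rewrite lerD ?IHb// ler_wpM2l// /S big_ord_recr /= lerDl.
  by rewrite mulr_ge0 ?exprn_ge0// divr_ge0 ?ler0n.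
rewrite /S big_ord_recl [in X in _ <= X + _]big_ord_recl -addrA.
rewrite /rising !big_ord0 lerD2l mulr_sumr -big_split /=.
rewrite le_eqVlt; apply/orP; left; apply/eqP; apply: eq_bigr => a _.
rewrite /bump leq0n add1n Pascal mulrDl; congr (_ + _).
by rewrite exprS; ring.
Qed.

Lemma trace_poly1_le n : trace_poly (fun _ : 'I_n => 1%N) <= n`!%:R * (1 - q) ^- B.
Proof.
rewrite /trace_poly.
have E (c : n.-tuple bool) :
    \prod_(i < n) (if tnth c i then q ^+ 1 else 1) = q ^+ ntrue c.
  by rewrite /ntrue -prodrXr; apply: eq_bigr => i _; case: (tnth c i).
under eq_bigr do rewrite E.
rewrite (sum_ntrue n (fun a => trace_coef n a * q ^+ a)).
apply: le_trans (ler_wpM2l (ler0n _ _) (rising_series B n)).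
rewrite mulr_sumr le_eqVlt; apply/orP; left; apply/eqP; apply: eq_bigr => a _.
rewrite mulrA mulrA; congr (_ * _); rewrite /trace_coef.
have an : (a <= n)%N by rewrite -ltnS.
have fact_neq0 : (a : nat)`!%:R != 0 :> R by rewrite pnatr_eq0 -lt0n fact_gt0.
apply: (mulIf fact_neq0); rewrite -[RHS]mulrA mulrVK ?unitfE//.
by rewrite -(bin_fact an) !natrM; ring.
Qed.

End trace_bound.

Section perm_kernel_bound.
Context d (T : measurableType d) (R : realType) (P : probability T R).
Variable k : nat -> T -> T -> R.
Hypothesis mk : forall a, measurable_fun setT (fun p : T * T => k a p.1 p.2).
Hypothesis k_ge0 : forall a x y, 0 <= k a x y.
Hypothesis k_semigroup : forall a b x z, (0 < a)%N -> (0 < b)%N ->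
  (\int[P]_y (k a x y * k b y z)%:E = (k (a + b) x z)%:E)%E.
Variables (q : R) (B : nat).
Hypothesis q01 : 0 <= q < 1.
Hypothesis traceE : forall a, (0 < a)%N ->
  (kernel_trace P k a <= (1 + B%:R * q ^+ a)%:E)%E.

Lemma perm_kernel_integral_le_trace_poly n (w : 'I_n -> nat) :
  (forall i, (0 < w i)%N) ->
  (perm_kernel_integral P k w <= (trace_poly q B w)%:E)%E.
Proof.
elim: n w => [|n IH] w w0.
  rewrite /perm_kernel_integral ge0_integral_tuple_prob0; last first.
    by apply/measurable_EFinP; exact: measurable_perm_kernel.
  rewrite /perm_kernel /trace_poly lee_fin.
  under eq_bigr do rewrite big_ord0.
  rewrite sumr_const card_Sn fact0 (big_pred1 [tuple]) /=; last first.
    by move=> c; apply/esym/eqP; exact: tuple0.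
  by rewrite /ntrue /trace_coef /rising !big_ord0 mulr1.
rewrite perm_kernel_integralS// trace_polyS EFinD EFinM
  -(sumEFin _ _ (fun i => trace_poly q B (merge_weight w i))).
apply: leeD.
  apply: lee_pmul.
  - by apply: integral_ge0 => x _; rewrite lee_fin.
  - by apply: integral_ge0 => t _; rewrite lee_fin perm_kernel_ge0.
  - exact: traceE.
  - by apply: IH => i; exact: w0.
by apply: lee_sum => i _; apply: IH => j; rewrite addn_gt0 w0.
Qed.

Lemma perm_kernel_integral_le n :
  (perm_kernel_integral P k (fun _ : 'I_n => 1%N) <=
   (n`!%:R * (1 - q) ^- B)%:E)%E.
Proof.
apply: le_trans (perm_kernel_integral_le_trace_poly _) _ => //.
by rewrite lee_fin trace_poly1_le.
Qed.

End perm_kernel_bound.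

(** * Contiguity from the second moment of the likelihood ratio *)

Lemma ge0_integral_ext d d' (T : measurableType d) (T' : measurableType d')
    (R : realType) (P : probability T R) (Q : probability T' R)
    (g : {mfun T >-> T'}) (f : T' -> \bar R) :
  (forall A, measurable A -> Q A = P (g @^-1` A)) ->
  measurable_fun setT f -> (forall x, 0 <= f x)%E ->
  (\int[Q]_y f y = \int[P]_x f (g x))%E.
Proof.
move=> QP mf f0; rewrite -[RHS](ge0_integral_distribution (P := P) g)//.
by apply: eq_measure_integral => A mA _; exact: QP.
Qed.

Section contiguity.
Context d (T : measurableType d) (R : realType).
Variables (P : probability T R) (PXY : probability (T * T)%type R).
Variables (l : T -> T -> R) (k : nat -> T -> T -> R).
Hypothesis ml : measurable_fun setT (fun p : T * T => l p.1 p.2).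
Hypothesis l_ge0 : forall x y, 0 <= l x y.
Hypothesis PXYE : forall A, measurable A ->
  PXY A = (\int[(P \x P)%E]_(z in A) (l z.1 z.2)%:E)%E.
Hypothesis PX : forall A, measurable A -> marginalX PXY A = P A.
Hypothesis PY : forall A, measurable A -> marginalY PXY A = P A.
Hypothesis mk : forall a, measurable_fun setT (fun p : T * T => k a p.1 p.2).
Hypothesis k_ge0 : forall a x y, 0 <= k a x y.
Hypothesis k1E : forall y y',
  (\int[P]_x (l x y * l x y')%:E = (k 1 y y')%:E)%E.

Section fixed_sizes.
Variables (n m : nat).
Local Notation Pn := (tuple_prob n P).

(** The likelihood ratio of the planted law for [m = n]. For [m < n] it still
    bounds the planted law, averaged over the relabellings of a fixed
    injection. *)
Definition likelihood (p : n.-tuple T * n.-tuple T) : R :=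
  (n`!%:R)^-1 * \sum_(s : 'S_n) \prod_(j < n) l (tnth p.1 j) (tnth p.2 (s j)).

Let perm_ratio (s : 'S_n) (p : n.-tuple T * n.-tuple T) : R :=
  \prod_(j < n) l (tnth p.1 j) (tnth p.2 (s j)).

Let mtnth1 (i : 'I_n) :
  measurable_fun setT (fun p : n.-tuple T * n.-tuple T => tnth p.1 i).
Proof. exact: (measurableT_comp (measurable_tnth i)). Qed.

Let mtnth2 (i : 'I_n) :
  measurable_fun setT (fun p : n.-tuple T * n.-tuple T => tnth p.2 i).
Proof. exact: (measurableT_comp (measurable_tnth i)). Qed.

Let ml_tnth (i j : 'I_n) : measurable_fun setT
  (fun p : n.-tuple T * n.-tuple T => l (tnth p.1 i) (tnth p.2 j)).
Proof.
exact: (measurableT_comp ml (measurable_fun_pair (mtnth1 i) (mtnth2 j))).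
Qed.

Let mperm_ratio s : measurable_fun setT (perm_ratio s).
Proof. by apply: measurable_prod => j _; exact: ml_tnth. Qed.

Let perm_ratio_ge0 s p : 0 <= perm_ratio s p.
Proof. exact: prodr_ge0. Qed.

Lemma likelihood_ge0 p : 0 <= likelihood p.
Proof. by rewrite mulr_ge0 ?invr_ge0// sumr_ge0// => s _; exact: prodr_ge0. Qed.

Lemma measurable_likelihood : measurable_fun setT likelihood.
Proof.
by apply: measurable_funM => //; apply: measurable_sum => s; exact: mperm_ratio.
Qed.

Let mlx y : measurable_fun setT (fun x => l x y).
Proof. exact: (measurableT_comp ml (pair2_measurable y)). Qed.

(** The entry [x_j] couples [y_(s j)] with [y_(s' j)], so that integrating out
    [x] leaves a product along the permutation [s^-1 * s']. *)
Lemma integral_perm_ratioM s s' (y : n.-tuple T) :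
  (\int[Pn]_x (perm_ratio s (x, y) * perm_ratio s' (x, y))%:E =
   (\prod_(j < n) k 1 (tnth y j) (tnth y ((s^-1 * s')%g j)))%:E)%E.
Proof.
transitivity (\int[Pn]_x (\prod_(j < n)
    (l (tnth x j) (tnth y (s j)) * l (tnth x j) (tnth y (s' j))))%:E)%E.
  by apply: eq_integral => x _; rewrite big_split.
rewrite (integral_tuple_prob_prod P
  (g := fun j x => l x (tnth y (s j)) * l x (tnth y (s' j)))); last 2 first.
- by move=> j; exact: measurable_funM.
- by move=> j x; rewrite mulr_ge0.
under eq_bigr do rewrite k1E.
rewrite prodEFin (reindex_inj (@perm_inj _ (s^-1)%g)) /=.
by congr EFin; apply: eq_bigr => j _; rewrite permKV permM.
Qed.

(** The double sum over permutations [s] and [s'] depends only on [s^-1 * s']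
    after the integration over [x]; hence one of the two sums cancels a
    factor [n`!]. *)
Lemma integral_likelihood_sqr :
  (\int[(Pn \x Pn)%E]_p (likelihood p ^+ 2)%:E =
   (n`!%:R)^-1%:E * perm_kernel_integral P k (fun _ : 'I_n => 1%N))%E.
Proof.
rewrite fubini_tonelli2//; last 2 first.
- by apply/measurable_EFinP/measurable_funX; exact: measurable_likelihood.
- by move=> p; rewrite lee_fin sqr_ge0.
rewrite /perm_kernel_integral -ge0_integralZl//; last 2 first.
- by apply/measurable_EFinP; exact: measurable_perm_kernel.
- by move=> t _; rewrite lee_fin perm_kernel_ge0.
apply: eq_integral => y _; rewrite /fubini_G.
transitivity (\int[Pn]_x (((n`!%:R)^-1 ^+ 2)%:E * \sum_(s : 'S_n) \sum_(s' : 'S_n)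
    (perm_ratio s (x, y) * perm_ratio s' (x, y))%:E))%E.
  apply: eq_integral => x _; rewrite /likelihood exprMn EFinM; congr (_ * _)%E.
  rewrite expr2 mulr_suml -sumEFin; apply: eq_bigr => s _.
  by rewrite mulr_sumr sumEFin.
have mM s s' : measurable_fun setT (fun x : n.-tuple T =>
    (perm_ratio s (x, y) * perm_ratio s' (x, y))%:E).
  apply/measurable_EFinP/measurable_funM;
  exact: (measurableT_comp (mperm_ratio _) (pair2_measurable y)).
have M0 s s' (x : n.-tuple T) :
    (0 <= (perm_ratio s (x, y) * perm_ratio s' (x, y))%:E)%E.
  by rewrite lee_fin mulr_ge0.
rewrite ge0_integralZl//; last 2 first.
- by apply: emeasurable_sum => s; apply: emeasurable_sum => s'; exact: mM.
- by move=> x _; apply: sume_ge0 => s _; apply: sume_ge0 => s' _; exact: M0.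
rewrite ge0_integral_sum//; last 2 first.
- by move=> s; apply: emeasurable_sum => s'; exact: mM.
- by move=> s x _; apply: sume_ge0 => s' _; exact: M0.
have E (s : 'S_n) : (\int[Pn]_x \sum_(s' : 'S_n)
    (perm_ratio s (x, y) * perm_ratio s' (x, y))%:E =
    (perm_kernel k (fun _ : 'I_n => 1%N) y)%:E)%E.
  rewrite ge0_integral_sum//.
  under eq_bigr do rewrite integral_perm_ratioM.
  rewrite sumEFin /perm_kernel (reindex_inj (mulgI s)) /=; congr EFin.
  by apply: eq_bigr => t _; rewrite mulKg.
under eq_bigr do rewrite E.
rewrite sumEFin -EFinM sumr_const card_Sn -mulr_natr -EFinM; congr EFin.
by field.
Qed.

Variable A : set (n.-tuple T * m.-tuple T).
Hypothesis mA : measurable A.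
Variable tau : {ffun 'I_m -> 'I_n}.
Hypothesis tau_inj : injective tau.

(* the event [A] read off the samples relabelled by [tau] *)
Let A' : set (n.-tuple T * n.-tuple T) :=
  [set p | A (p.1, tuple_select id tau p.2)].

Let mA' : measurable A'.
Proof.
have mf : measurable_fun setT (fun p : n.-tuple T * n.-tuple T =>
    (p.1, tuple_select id tau p.2)).
  apply: measurable_fun_pair; first exact: measurable_fst.
  have mt := measurable_tuple_select tau (@measurable_id _ T setT).
  exact: (measurableT_comp mt measurable_snd).
rewrite /A' -[X in measurable X]setTI; exact: (mf measurableT A mA).
Qed.

(** Relabelling the second halves of all [n] pairs by [s] turns their joint
    density into the product along [s^-1], and the event [A] then reads
    the same entries, those at [tau], for every [s]. *)
Lemma planted_law_given_relabel (s : 'S_n) :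
  planted_law_given PXY [ffun i => s (tau i)] A =
  (\int[(Pn \x Pn)%E]_p ((\1_A' p)%:E * (perm_ratio (s^-1)%g p)%:E))%E.
Proof.
have sinj : injective [ffun i => s (tau i)].
  by move=> i j; rewrite !ffunE => /perm_inj/tau_inj.
pose sA := sample_pair [ffun i => s (tau i)] @^-1` A.
have msA : measurable sA.
  by rewrite -[X in measurable X]setTI; exact: measurable_funP.
transitivity (\int[tuple_prob n PXY]_z (\1_sA z)%:E)%E.
  by rewrite planted_law_givenE// integral_indic// setIT.
rewrite (ge0_integral_tuple_density ml (fun z => l_ge0 z.1 z.2) PXYE); last 2 first.
- by apply/measurable_EFinP; exact: measurable_indic.
- by move=> z; rewrite lee_fin.
rewrite (@ge0_integral_ext _ _ _ _ _ (tuple_prob n (P \x P)%E) _ (sample_pair s))//.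
- apply: eq_integral => z _; congr (_ * _)%E.
    rewrite !indicE; congr (nat_of_bool _)%:R%:E.
    have E : sample_pair [ffun i => s (tau i)] z =
        ((sample_pair s z).1, tuple_select id tau (sample_pair s z).2).
      congr (_, _); apply: eq_from_tnth => i.
      by rewrite !tnth_mktuple ffunE.
    by apply/idP/idP; rewrite !inE /sA /A' /= E.
  congr EFin; apply: eq_bigr => j _; rewrite /= !tnth_mktuple.
  by rewrite permKV.
- by move=> B mB; apply: product_tuple_probE => //; exact: perm_inj.
- by apply: emeasurable_funM; apply/measurable_EFinP => //; exact: measurable_indic.
- by move=> p; rewrite mule_ge0 ?lee_fin.
Qed.

Lemma null_law_relabel : (Pn \x Pn)%E A' = null_law PXY n m A.
Proof.
rewrite (null_lawE PX PY)// (product_tuple_probE P P (@inj_id 'I_n) mA').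
rewrite (product_tuple_probE P P tau_inj mA); congr (tuple_prob _ _ _).
apply/seteqP; split => z; rewrite /A' /=;
rewrite (_ : tuple_select id tau _ = [tuple (tnth z (tau i)).2 | i < m])//;
by apply: eq_from_tnth => i; rewrite !tnth_mktuple.
Qed.

(** The inequality [1_A L <= (C/2) 1_A + L^2/(2C)] trades the likelihood ratio
    for its second moment. *)
Lemma sum_planted_law_given_relabel_le (C : R) : 0 < C ->
  (perm_kernel_integral P k (fun _ : 'I_n => 1%N) <= (n`!%:R * C)%:E)%E ->
  (\sum_(s : 'S_n) planted_law_given PXY [ffun i => s (tau i)] A <=
   n`!%:R%:E * ((C / 2)%:E * null_law PXY n m A + (1 / 2)%:E))%E.
Proof.
move=> C0 HC; have n0 : 0 < n`!%:R :> R by rewrite ltr0n fact_gt0.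
have c1 : 0 < n`!%:R * (C / 2) by rewrite mulr_gt0// divr_gt0.
have c2 : 0 < n`!%:R / (2 * C) by rewrite divr_gt0// mulr_gt0.
have m1A : measurable_fun setT (fun p => (\1_A' p)%:E : \bar R).
  by apply/measurable_EFinP; exact: measurable_indic.
have mL2 : measurable_fun setT (fun p => (likelihood p ^+ 2)%:E).
  by apply/measurable_EFinP/measurable_funX; exact: measurable_likelihood.
under eq_bigr do rewrite planted_law_given_relabel.
rewrite -ge0_integral_sum//; last 2 first.
- by move=> s; apply: emeasurable_funM => //; apply/measurable_EFinP.
- by move=> s p _; rewrite mule_ge0 ?lee_fin.
apply: (@le_trans _ _ (\int[(Pn \x Pn)%E]_p ((n`!%:R * (C / 2))%:E * (\1_A' p)%:E +
    (n`!%:R / (2 * C))%:E * (likelihood p ^+ 2)%:E))%E).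
  apply: ge0_le_integral => //.
  - move=> p _; apply: sume_ge0 => s _; rewrite mule_ge0 ?lee_fin//.
  - apply: emeasurable_sum => s; apply: emeasurable_funM => //.
    by apply/measurable_EFinP.
  - by apply: emeasurable_funD; exact: measurable_funeM.
  move=> p _.
  have -> : (\sum_(s : 'S_n) ((\1_A' p)%:E * (perm_ratio s^-1 p)%:E) =
      (\1_A' p * (n`!%:R * likelihood p))%:E)%E.
    rewrite /likelihood mulVKf ?gt_eqF// mulr_sumr -sumEFin.
    by rewrite (reindex_inj invg_inj) /=; apply: eq_bigr => s _; rewrite invgK.
  rewrite lee_fin.
  have L0 := likelihood_ge0 p; set L := likelihood p in L0 *.
  have [->|->] : \1_A' p = 1 :> R \/ \1_A' p = 0 :> R.
    by rewrite indicE; case: (_ \in _); [left|right].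
  - rewrite mul1r mulr1 -mulrA -mulrDr ler_pM2l//.
    rewrite -(ler_pM2l (_ : 0 < 2 * C)) ?mulr_gt0//.
    have -> : 2 * C * (C / 2 + (2 * C)^-1 * L ^+ 2) = C ^+ 2 + L ^+ 2.
      by field; rewrite gt_eqF.
    rewrite -subr_ge0 (_ : _ - _ = (C - L) ^+ 2) ?sqr_ge0//; ring.
  - by rewrite mul0r mulr0 add0r mulr_ge0 ?sqr_ge0// divr_ge0 ?ltW// mulr_gt0.
rewrite ge0_integralD//; last 4 first.
- by move=> p _; apply: mule_ge0; rewrite lee_fin// ltW.
- exact: measurable_funeM.
- by move=> p _; apply: mule_ge0; rewrite lee_fin ?sqr_ge0// ltW.
- exact: measurable_funeM.
rewrite ge0_integralZl//; last by rewrite lee_fin ltW.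
rewrite ge0_integralZl//; last 2 first.
- by move=> p _; rewrite lee_fin sqr_ge0.
- by rewrite lee_fin ltW.
have -> : (\int[(Pn \x Pn)%E]_p (\1_A' p)%:E = null_law PXY n m A)%E.
  by rewrite integral_indic// setIT; exact: null_law_relabel.
have N0 : (0 <= null_law PXY n m A)%E by exact: measure_ge0.
move: (null_law PXY n m A) N0 => N N0.
rewrite [leRHS]ge0_muleDr; last 2 first.
- by apply: mule_ge0 => //; rewrite lee_fin ltW// divr_gt0.
- by rewrite lee_fin divr_ge0.
rewrite muleA -EFinM; apply: leeD => //.
rewrite integral_likelihood_sqr muleA -EFinM.
apply: le_trans (lee_wpmul2l _ HC) _.
  by rewrite lee_fin mulr_ge0 ?invr_ge0// ltW.
rewrite -EFinM lee_fin le_eqVlt; apply/orP; left; apply/eqP.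
by field; rewrite ?gt_eqF.
Qed.

End fixed_sizes.

(** The uniform law on injections is invariant under composition with a
    permutation. Averaging over permutations first gives, for each
    injection [tau], the bound of [sum_planted_law_given_relabel_le],
    which does not depend on [tau]. *)
Lemma planted_law_le n m A (C : R) : 0 < C ->
  (perm_kernel_integral P k (fun _ : 'I_n => 1%N) <= (n`!%:R * C)%:E)%E ->
  measurable A ->
  (planted_law PXY (n := n) (m := m) A <=
   (C / 2)%:E * null_law PXY n m A + (1 / 2)%:E)%E.
Proof.
move=> C0 HC mA; rewrite /planted_law.
have n0 : 0 < n`!%:R :> R by rewrite ltr0n fact_gt0.
pose p pi := fine (planted_law_given PXY pi A).
have pE pi : planted_law_given PXY pi A = (p pi)%:E.
  by apply/esym/fineK; exact: fin_num_measure.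
pose b := C / 2 * fine (null_law PXY n m A) + 1 / 2.
have bE : ((C / 2)%:E * null_law PXY n m A + (1 / 2)%:E = b%:E)%E.
  rewrite /b EFinD [in RHS]EFinM; congr (_ * _ + _)%E.
  by apply/esym/fineK; exact: fin_num_measure.
have b0 : 0 <= b.
  apply: addr_ge0; last exact: divr_ge0.
  apply: mulr_ge0; first by rewrite divr_ge0// ltW.
  exact/fine_ge0/measure_ge0.
have step (tau : {ffun 'I_m -> 'I_n}) : tau \in injections n m ->
    \sum_(s : 'S_n) p [ffun i => s (tau i)] <= n`!%:R * b.
  rewrite finset.inE => /injectiveP tau_inj.
  have := sum_planted_law_given_relabel_le mA tau_inj C0 HC.
  by rewrite bE; under eq_bigr do rewrite pE; rewrite sumEFin -EFinM lee_fin.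
rewrite bE; under eq_bigr do rewrite pE.
rewrite sumEFin -EFinM lee_fin.
have [->|inj0] := eqVneq #|injections n m| 0%N; first by rewrite invr0 mul0r.
rewrite mulrC ler_pdivrMr ?ltr0n ?lt0n//.
rewrite -(ler_pM2l n0).
have -> : n`!%:R * \sum_(pi in injections n m) p pi =
    \sum_(tau in injections n m) \sum_(s : 'S_n) p [ffun i => s (tau i)].
  rewrite exchange_big /= -card_Sn mulr_natl -sumr_const; apply: eq_bigr => s _.
  pose h (s : 'S_n) (tau : {ffun 'I_m -> 'I_n}) := [ffun i => s (tau i)].
  have hK s' : cancel (h s') (h (s'^-1)%g).
    by move=> tau; apply/ffunP => i; rewrite !ffunE permK.
  rewrite (reindex_inj (can_inj (hK s))) /=; apply: eq_bigl => tau.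
  rewrite !finset.inE; apply/injectiveP/injectiveP => H i j.
    by move=> tij; apply: H; rewrite !ffunE tij.
  by rewrite !ffunE => /perm_inj/H.
apply: le_trans (ler_sum _ step) _.
by rewrite sumr_const -[leLHS]mulr_natr mulrA.
Qed.

End contiguity.

(** * The Gaussian kernel *)

Lemma integral_setE_indic d (T : measurableType d) (R : realType)
    (P : {measure set T -> \bar R}) (A : set T) (f : T -> \bar R) :
  (\int[P]_(z in A) f z = \int[P]_z ((\1_A z)%:E * f z))%E.
Proof.
rewrite integral_mkcond; apply: eq_integral => z _.
by rewrite patchE indicE; case: ifP; rewrite ?mul1e ?mul0e.
Qed.

Section lebesgue_affine.
Variable R : realType.
Local Notation mu := (@lebesgue_measure R).

Lemma ge0_integral_affine (m s : R) (g : R -> \bar R) : 0 < s ->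
  measurable_fun setT g -> (forall x, 0 <= g x)%E ->
  (\int[mu]_y g y = s%:E * \int[mu]_z g (m + s * z)%R)%E.
Proof.
move=> s0 mg g0.
pose F : measurableTypeR R -> measurableTypeR R := fun z => m + s * z.
have mF : measurable_fun setT F.
  by apply: measurable_funD => //; exact: measurable_funM.
pose nu := mscale (NngNum (ltW s0)) (pushforward mu F).
transitivity (\int[nu mF]_y g y)%E.
  apply: eq_measure_integral => A mA _.
  apply: lebesgue_measure_unique => // X [[a b] _ <-] /=.
  rewrite /mscale /= /pushforward.
  have -> : F @^-1` `]a, b] = `](a - m) / s, (b - m) / s]%classic.
    apply/seteqP; split => z /=; rewrite !in_itv /= /F;
    by rewrite ltr_pdivrMr// ler_pdivlMr// [z * s]mulrC ltrBlDl lerBrDl.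
  rewrite !lebesgue_measure_itv /= !lte_fin ltr_pM2r ?invr_gt0// ltrD2r.
  case: ifP => _; last by rewrite mule0.
  rewrite -!EFinB -EFinM; congr EFin; field; exact: lt0r_neq0.
rewrite ge0_integral_mscale//= ge0_integral_pushforward//.
Qed.

End lebesgue_affine.

Section std_normal.
Variable R : realType.

Definition measurableTypeR_id : measurableTypeR R -> R := id.

Lemma measurable_measurableTypeR_id : measurable_fun setT measurableTypeR_id.
Proof. by move=> _ A mA; rewrite setTI preimage_id. Qed.

HB.instance Definition _ := isMeasurableFun.Build _ _ (measurableTypeR R) R
  measurableTypeR_id measurable_measurableTypeR_id.

(** The standard normal law, transported from [measurableTypeR R] to the default
    measurable structure of [R]; both have the Borel sets as measurable sets. *)
Definition std_normal : probability R R :=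
  distribution (normal_prob 0 1) measurableTypeR_id.

End std_normal.

Section mehler.
Variable R : realType.
Local Notation mu := (@lebesgue_measure R).
Local Notation N01 := (std_normal R).
Implicit Types r x y z : R.

(** The density of the centred normal law on the plane with unit variances and
    correlation [r] with respect to the product of its marginals (the
    Mehler kernel). *)
Definition mehler r x y : R := (Num.sqrt (1 - r ^+ 2))^-1 *
  expR (- (r ^+ 2 * x ^+ 2 + r ^+ 2 * y ^+ 2 - 2 * r * x * y) / (2 * (1 - r ^+ 2))).

Lemma mehler_ge0 r x y : 0 <= mehler r x y.
Proof. by rewrite mulr_ge0 ?expR_ge0// invr_ge0 sqrtr_ge0. Qed.

Lemma mehlerC r x y : mehler r x y = mehler r y x.
Proof. by rewrite /mehler; congr (_ * expR _); congr (- _ / _); ring. Qed.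

Lemma measurable_mehler r : measurable_fun setT (fun p : R * R => mehler r p.1 p.2).
Proof.
apply: measurable_funM => //; apply: measurableT_comp => //.
apply: measurable_funM => //; apply: measurableT_comp => //.
apply: measurable_funB; last first.
  by apply: measurable_funM => //; exact: measurable_funM.
by apply: measurable_funD; apply: measurable_funM => //; exact: measurable_funX.
Qed.

Lemma onemX2_gt0 r : `|r| < 1 -> 0 < 1 - r ^+ 2.
Proof. by move=> r1; rewrite subr_gt0 -real_normK ?num_real// expr_lt1. Qed.

Lemma normal_pdf01E x : normal_pdf 0 1 x = (Num.sqrt (pi *+ 2))^-1 * expR (- x ^+ 2 / 2) :> R.
Proof.
rewrite normal_pdfE ?oner_neq0// /normal_peak /normal_fun.
by rewrite expr1n mul1r subr0.
Qed.

Lemma normal_pdf_mehler r x y : `|r| < 1 ->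
  normal_pdf 0 1 y * mehler r x y =
  normal_pdf (r * x) (Num.sqrt (1 - r ^+ 2)) y.
Proof.
move=> /onemX2_gt0 r2; have s0 : Num.sqrt (1 - r ^+ 2) != 0 by rewrite gt_eqF ?sqrtr_gt0.
rewrite normal_pdf01E normal_pdfE// /normal_peak /normal_fun /mehler.
rewrite sqr_sqrtr ?ltW// mulrACA -expRD -mulrnAr sqrtrM ?ltW//.
rewrite -invfM; congr (_ * expR _).
  by rewrite [X in X^-1]mulrC.
by field; rewrite gt_eqF.
Qed.

Lemma ge0_integral_normal (f : R -> \bar R) : measurable_fun setT f ->
  (forall x, 0 <= f x)%E ->
  (\int[N01]_x f x = \int[mu]_x (f x * (normal_pdf 0 1 x)%:E))%E.
Proof.
move=> mf f0; rewrite /std_normal ge0_integral_distribution//.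
apply: ge0_integral_density => //.
- exact: measurable_normal_pdf.
- by move=> x; exact: normal_pdf_ge0.
Qed.

Lemma ge0_integral_normal_affine (m s : R) (g : R -> \bar R) : 0 < s ->
  measurable_fun setT g -> (forall x, 0 <= g x)%E ->
  (\int[mu]_y (g y * (normal_pdf m s y)%:E) = \int[N01]_z g (m + s * z)%R)%E.
Proof.
move=> s0 mg g0.
have mF : measurable_fun setT (fun z : R => m + s * z).
  by apply: measurable_funD => //; exact: measurable_funM.
have mgF : measurable_fun setT (fun z : R => g (m + s * z)).
  exact: (measurableT_comp mg mF).
rewrite (ge0_integral_affine m s0); last 2 first.
- apply: emeasurable_funM => //; apply/measurable_EFinP.
  exact: measurable_normal_pdf.
- by move=> y; rewrite mule_ge0// lee_fin normal_pdf_ge0.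
rewrite ge0_integral_normal// -ge0_integralZl//; last 3 first.
- apply: emeasurable_funM => //; apply/measurable_EFinP.
  exact: (measurableT_comp (measurable_normal_pdf m s) mF).
- by move=> y _; rewrite mule_ge0// lee_fin normal_pdf_ge0.
- by rewrite lee_fin ltW.
apply: eq_integral => z _; rewrite muleCA -EFinM; congr (_ * _%:E)%E.
rewrite normal_pdf01E normal_pdfE ?gt_eqF// /normal_peak /normal_fun.
rewrite -mulrnAr sqrtrM ?sqr_ge0// sqrtr_sqr gtr0_norm// invfM mulrA mulrA.
rewrite divff ?gt_eqF// mul1r; congr (_ * expR _).
by field; rewrite gt_eqF.
Qed.

(** Given a first coordinate equal to [x], the second coordinate is normal
    with mean [r * x] and variance [1 - r ^+ 2]. *)
Lemma ge0_integral_mehler r x (g : R -> \bar R) : `|r| < 1 ->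
  measurable_fun setT g -> (forall y, 0 <= g y)%E ->
  (\int[N01]_y (g y * (mehler r x y)%:E) =
   \int[N01]_z g (r * x + Num.sqrt (1 - r ^+ 2) * z)%R)%E.
Proof.
move=> r1 mg g0; have r2 := onemX2_gt0 r1.
have mm : measurable_fun setT (mehler r x).
  exact: (measurableT_comp (measurable_mehler r) (pair1_measurable x)).
rewrite ge0_integral_normal; last 2 first.
- by apply: emeasurable_funM => //; exact/measurable_EFinP.
- by move=> y; rewrite mule_ge0// lee_fin mehler_ge0.
rewrite -(ge0_integral_normal_affine (r * x) (s := Num.sqrt (1 - r ^+ 2)))//;
  last by rewrite sqrtr_gt0.
apply: eq_integral => y _; rewrite -muleA -EFinM; congr (_ * _%:E)%E.
by rewrite mulrC normal_pdf_mehler.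
Qed.

Lemma integral_mehler r x : `|r| < 1 ->
  (\int[N01]_y (mehler r x y)%:E = 1)%E.
Proof.
move=> r1; transitivity (\int[N01]_y (1 * (mehler r x y)%:E))%E.
  by apply: eq_integral => y _; rewrite mul1e.
rewrite (ge0_integral_mehler x r1 (g := cst 1%E))// integral_cst// mul1e.
exact: probability_setT.
Qed.

Lemma bigauss_pdfE r x y : `|r| < 1 ->
  bigauss_pdf r (x, y) = normal_pdf 0 1 x * normal_pdf 0 1 y * mehler r x y.
Proof.
by move=> r1; rewrite /bigauss_pdf r1 gauss2_pdfE// -normal_pdf_mehler// mulrA.
Qed.

Lemma bigauss_prob_density r A : `|r| < 1 -> measurable A ->
  bigauss_prob r A = (\int[(N01 \x N01)%E]_(z in A) (mehler r z.1 z.2)%:E)%E.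
Proof.
move=> r1 mA.
have m1A : measurable_fun setT (fun z : R * R => (\1_A z)%:E : \bar R).
  by apply/measurable_EFinP; exact: measurable_indic.
have mmeh : measurable_fun setT (fun z : R * R => (mehler r z.1 z.2)%:E).
  by apply/measurable_EFinP; exact: measurable_mehler.
have mpdf : measurable_fun setT (fun z : R * R => (bigauss_pdf r z)%:E).
  by apply/measurable_EFinP; exact: measurable_bigauss_pdf.
rewrite /bigauss_prob [LHS]integral_setE_indic [RHS]integral_setE_indic.
have F0 (z : R * R) : (0 <= (\1_A z)%:E * (mehler r z.1 z.2)%:E)%E.
  by rewrite mule_ge0 ?lee_fin ?mehler_ge0.
have mF : measurable_fun setT (fun z : R * R => (\1_A z)%:E * (mehler r z.1 z.2)%:E)%E.
  exact: emeasurable_funM.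
pose F x := (\int[N01]_y ((\1_A (x, y))%:E * (mehler r x y)%:E))%E.
have -> : (\int[(N01 \x N01)%E]_z ((\1_A z)%:E * (mehler r z.1 z.2)%:E) =
    \int[N01]_x F x)%E by rewrite fubini_tonelli1.
rewrite ge0_integral_normal; last 2 first.
- exact: (@measurable_fun_fubini_tonelli_F _ _ _ _ _ N01 _ mF F0).
- by move=> x; apply: integral_ge0 => y _; exact: (F0 (x, y)).
rewrite fubini_tonelli1//; last 2 first.
- exact: emeasurable_funM.
- by move=> z; rewrite mule_ge0 ?lee_fin ?bigauss_pdf_ge0.
apply: eq_integral => x _; rewrite /fubini_F /F.
have mFx : measurable_fun setT (fun y => (\1_A (x, y))%:E * (mehler r x y)%:E)%E.
  exact: (measurableT_comp mF (pair1_measurable x)).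
rewrite ge0_integral_normal//.
rewrite -ge0_integralZr//; last 3 first.
- apply: emeasurable_funM => //; apply/measurable_EFinP.
  exact: measurable_normal_pdf.
- by move=> y _; rewrite mule_ge0 ?(F0 (x, y))// lee_fin normal_pdf_ge0.
- by rewrite lee_fin normal_pdf_ge0.
apply: eq_integral => y _; rewrite bigauss_pdfE// -!EFinM.
by congr EFin; ring.
Qed.

(** Correlations multiply along a Markov chain. The proof completes the square
    in [y]: up to the factor on the right, the integrand is the normal
    density with mean [m] and variance [s2]. *)
Lemma mehler_semigroup p q x z : `|p| < 1 -> `|q| < 1 ->
  (\int[N01]_y (mehler p x y * mehler q y z)%:E = (mehler (p * q) x z)%:E)%E.
Proof.
move=> p1 q1.
have pq1 : `|p * q| < 1 by rewrite normrM mulr_ilt1.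
have p2 := onemX2_gt0 p1; have q2 := onemX2_gt0 q1; have pq2 := onemX2_gt0 pq1.
pose s2 := (1 - p ^+ 2) * (1 - q ^+ 2) / (1 - (p * q) ^+ 2).
have s20 : 0 < s2 by rewrite divr_gt0// mulr_gt0.
pose s := Num.sqrt s2.
pose m := (p * x * (1 - q ^+ 2) + q * z * (1 - p ^+ 2)) / (1 - (p * q) ^+ 2).
have s0 : s != 0 by rewrite gt_eqF// sqrtr_gt0.
have ss : s ^+ 2 = s2 by rewrite sqr_sqrtr ?ltW.
have mm r u : measurable_fun setT (mehler r u).
  exact: (measurableT_comp (measurable_mehler r) (pair1_measurable u)).
rewrite ge0_integral_normal; last 2 first.
- apply/measurable_EFinP/measurable_funM => //.
  under eq_fun do rewrite mehlerC; exact: mm.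
- by move=> y; rewrite lee_fin mulr_ge0 ?mehler_ge0.
transitivity (\int[mu]_y ((mehler (p * q) x z)%:E * (normal_pdf m s y)%:E))%E.
  apply: eq_integral => y _; rewrite -!EFinM; congr EFin.
  rewrite normal_pdf01E normal_pdfE// /normal_peak /normal_fun /mehler ss /s2.
  set S := Num.sqrt (1 - p ^+ 2); set S' := Num.sqrt (1 - q ^+ 2).
  set S'' := Num.sqrt (1 - (p * q) ^+ 2).
  have -> : Num.sqrt ((1 - p ^+ 2) * (1 - q ^+ 2) / (1 - (p * q) ^+ 2) * pi *+ 2) =
      S * S' / S'' * Num.sqrt (pi *+ 2).
    rewrite -mulrnAr sqrtrM ?ltW// sqrtrM ?mulr_ge0 ?ltW// sqrtrV ?ltW//.
    by rewrite sqrtrM ?ltW.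
  have S0 : S != 0 by rewrite gt_eqF ?sqrtr_gt0.
  have S'0 : S' != 0 by rewrite gt_eqF ?sqrtr_gt0.
  have S''0 : S'' != 0 by rewrite gt_eqF ?sqrtr_gt0.
  transitivity ((S^-1 * S'^-1 * (Num.sqrt (pi *+ 2))^-1) * expR
    (- (p ^+ 2 * x ^+ 2 + p ^+ 2 * y ^+ 2 - 2 * p * x * y) / (2 * (1 - p ^+ 2)) +
     - (q ^+ 2 * y ^+ 2 + q ^+ 2 * z ^+ 2 - 2 * q * y * z) / (2 * (1 - q ^+ 2)) +
     - y ^+ 2 / 2)).
    by rewrite !expRD; ring.
  transitivity ((S''^-1 * (S * S' / S'' * Num.sqrt (pi *+ 2))^-1) * expR
    (- ((p * q) ^+ 2 * x ^+ 2 + (p * q) ^+ 2 * z ^+ 2 - 2 * (p * q) * x * z) /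
        (2 * (1 - (p * q) ^+ 2)) +
     - (y - m) ^+ 2 / ((1 - p ^+ 2) * (1 - q ^+ 2) / (1 - (p * q) ^+ 2) *+ 2))); last first.
    by rewrite !expRD; ring.
  congr (_ * expR _).
    have : Num.sqrt (pi *+ 2) != 0 :> R.
      by rewrite gt_eqF// sqrtr_gt0 mulrn_wgt0// pi_gt0.
    by move: (Num.sqrt (pi *+ 2)) => c c0; field; rewrite ?S0 ?S'0 ?S''0 ?c0.
  rewrite /m; field; rewrite !gt_eqF//.
rewrite ge0_integralZl//; last 3 first.
- by apply/measurable_EFinP; exact: measurable_normal_pdf.
- by move=> y _; rewrite lee_fin normal_pdf_ge0.
- by rewrite lee_fin mehler_ge0.
by rewrite integral_normal_pdf mule1.
Qed.

(** On the diagonal the integrand is [(1 - r)^-1] times the normal density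
    with variance [(1 + r) / (1 - r)]. *)
Lemma integral_mehler_diag r : 0 <= r < 1 ->
  (\int[N01]_x (mehler r x x)%:E = ((1 - r)^-1)%:E)%E.
Proof.
case/andP=> r0 r1.
have r2 : 0 < 1 - r ^+ 2 by rewrite onemX2_gt0// ger0_norm.
pose s := Num.sqrt ((1 + r) / (1 - r)).
have rm : 0 < 1 - r by rewrite subr_gt0.
have rp : 0 < 1 + r by rewrite ltr_wpDr.
have s0 : s != 0 by rewrite gt_eqF// sqrtr_gt0 divr_gt0.
have ss : s ^+ 2 = (1 + r) / (1 - r) by rewrite sqr_sqrtr// ltW// divr_gt0.
have mxx : measurable_fun setT (fun x : R => (x, x)).
  by apply: measurable_fun_pair; exact: measurable_id.
rewrite ge0_integral_normal; last 2 first.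
- by apply/measurable_EFinP; exact: (measurableT_comp (measurable_mehler r) mxx).
- by move=> y; rewrite lee_fin mehler_ge0.
transitivity (\int[mu]_x (((1 - r)^-1)%:E * (normal_pdf 0 s x)%:E))%E.
  apply: eq_integral => x _; rewrite -!EFinM; congr EFin.
  rewrite normal_pdf01E normal_pdfE// /normal_peak /normal_fun /mehler ss.
  set S := Num.sqrt (1 - r ^+ 2).
  have S0 : S != 0 by rewrite gt_eqF ?sqrtr_gt0.
  have -> : Num.sqrt ((1 + r) / (1 - r) * pi *+ 2) =
      S / (1 - r) * Num.sqrt (pi *+ 2).
    rewrite -mulrnAr sqrtrM ?ltW ?divr_gt0//; congr (_ * _).
    have -> : (1 + r) / (1 - r) = (1 - r ^+ 2) / (1 - r) ^+ 2.
      by field; rewrite gt_eqF.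
    by rewrite sqrtrM ?ltW// sqrtrV ?sqr_ge0// sqrtr_sqr gtr0_norm.
  transitivity ((S^-1 * (Num.sqrt (pi *+ 2))^-1) * expR
    (- (r ^+ 2 * x ^+ 2 + r ^+ 2 * x ^+ 2 - 2 * r * x * x) / (2 * (1 - r ^+ 2)) +
     - x ^+ 2 / 2)).
    by rewrite !expRD; ring.
  transitivity (((1 - r)^-1 * (S / (1 - r) * Num.sqrt (pi *+ 2))^-1) * expR
    (- (x - 0) ^+ 2 / ((1 + r) / (1 - r) *+ 2))); last by ring.
  congr (_ * expR _).
    have : Num.sqrt (pi *+ 2) != 0 :> R.
      by rewrite gt_eqF// sqrtr_gt0 mulrn_wgt0// pi_gt0.
    by move: (Num.sqrt (pi *+ 2)) => c c0; field; rewrite ?S0 ?c0 gt_eqF.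
  by rewrite subr0; field; rewrite !gt_eqF.
rewrite ge0_integralZl//; last 3 first.
- by apply/measurable_EFinP; exact: measurable_normal_pdf.
- by move=> y _; rewrite lee_fin normal_pdf_ge0.
- by rewrite lee_fin invr_ge0 ltW.
by rewrite integral_normal_pdf mule1.
Qed.

End mehler.

Section density_marginals.
Context d (T : measurableType d) (R : realType).
Variables (P : probability T R) (PXY : probability (T * T)%type R) (l : T -> T -> R).
Hypothesis ml : measurable_fun setT (fun p : T * T => l p.1 p.2).
Hypothesis l_ge0 : forall x y, 0 <= l x y.
Hypothesis PXYE : forall A, measurable A ->
  PXY A = (\int[(P \x P)%E]_(z in A) (l z.1 z.2)%:E)%E.

Let mlP : measurable_fun setT (fun p : T * T => (l p.1 p.2)%:E).
Proof. exact/measurable_EFinP. Qed.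

Lemma density_marginalX : (forall x, (\int[P]_y (l x y)%:E = 1)%E) ->
  forall A, measurable A -> marginalX PXY A = P A.
Proof.
move=> l1 A mA.
have mA1 : measurable_fun setT (fun x => (\1_A x)%:E : \bar R).
  exact/measurable_EFinP/measurable_indic.
transitivity (PXY (fst @^-1` A)); first by [].
rewrite PXYE; last by rewrite -[X in measurable X]setTI; exact: measurable_fst.
rewrite integral_setE_indic fubini_tonelli1//; last 2 first.
- apply: emeasurable_funM => //.
  exact: (measurableT_comp mA1 measurable_fst).
- by move=> z; rewrite mule_ge0 ?lee_fin.
transitivity (\int[P]_x (\1_A x)%:E)%E; last by rewrite integral_indic// setIT.
apply: eq_integral => x _; rewrite /fubini_F /=.
rewrite -[RHS]mule1 -(l1 x) -ge0_integralZl//.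
- exact: (measurableT_comp mlP (pair1_measurable x)).
- by move=> y _; rewrite lee_fin.
Qed.

Lemma density_marginalY : (forall y, (\int[P]_x (l x y)%:E = 1)%E) ->
  forall A, measurable A -> marginalY PXY A = P A.
Proof.
move=> l1 A mA.
have mA1 : measurable_fun setT (fun x => (\1_A x)%:E : \bar R).
  exact/measurable_EFinP/measurable_indic.
transitivity (PXY (snd @^-1` A)); first by [].
rewrite PXYE; last by rewrite -[X in measurable X]setTI; exact: measurable_snd.
rewrite integral_setE_indic fubini_tonelli2//; last 2 first.
- apply: emeasurable_funM => //.
  exact: (measurableT_comp mA1 measurable_snd).
- by move=> z; rewrite mule_ge0 ?lee_fin.
transitivity (\int[P]_x (\1_A x)%:E)%E; last by rewrite integral_indic// setIT.
apply: eq_integral => y _; rewrite /fubini_G /=.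
rewrite -[RHS]mule1 -(l1 y) -ge0_integralZl//.
- exact: (measurableT_comp mlP (pair2_measurable y)).
- by move=> x _; rewrite lee_fin.
Qed.

End density_marginals.

Section mehler_tuple.
Variables (R : realType) (d : nat).
Local Notation N01 := (std_normal R).
Local Notation Nd := (tuple_prob d N01).
Local Notation V := (d.-tuple R).
Implicit Types (r : R) (x y z : V).

Definition mehler_tuple r x y : R := \prod_(a < d) mehler r (tnth x a) (tnth y a).

Lemma mehler_tuple_ge0 r x y : 0 <= mehler_tuple r x y.
Proof. by apply: prodr_ge0 => a _; exact: mehler_ge0. Qed.

Lemma mehler_tupleC r x y : mehler_tuple r x y = mehler_tuple r y x.
Proof. by apply: eq_bigr => a _; exact: mehlerC. Qed.

Lemma measurable_mehler_tuple r :
  measurable_fun setT (fun p : V * V => mehler_tuple r p.1 p.2).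
Proof.
apply: measurable_prod => a _.
have m1 : measurable_fun setT (fun p : V * V => tnth p.1 a).
  exact: (measurableT_comp (measurable_tnth a) measurable_fst).
have m2 : measurable_fun setT (fun p : V * V => tnth p.2 a).
  exact: (measurableT_comp (measurable_tnth a) measurable_snd).
exact: (measurableT_comp (measurable_mehler r) (measurable_fun_pair m1 m2)).
Qed.

Let mm r (u : R) : measurable_fun setT (mehler r u).
Proof. exact: (measurableT_comp (measurable_mehler r) (pair1_measurable u)). Qed.

Let mm' r (u : R) : measurable_fun setT (fun v => mehler r v u).
Proof. exact: (measurableT_comp (measurable_mehler r) (pair2_measurable u)). Qed.

Lemma integral_mehler_tuple r x : `|r| < 1 ->
  (\int[Nd]_y (mehler_tuple r x y)%:E = 1)%E.
Proof.
move=> r1; rewrite (integral_tuple_prob_prod N01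
  (g := fun a => mehler r (tnth x a))); last 2 first.
- by move=> a; exact: mm.
- by move=> *; exact: mehler_ge0.
by rewrite big1// => a _; exact: integral_mehler.
Qed.

Lemma mehler_tuple_semigroup p q x z : `|p| < 1 -> `|q| < 1 ->
  (\int[Nd]_y (mehler_tuple p x y * mehler_tuple q y z)%:E =
   (mehler_tuple (p * q) x z)%:E)%E.
Proof.
move=> p1 q1.
transitivity (\int[Nd]_y (\prod_(a < d)
    (mehler p (tnth x a) (tnth y a) * mehler q (tnth y a) (tnth z a)))%:E)%E.
  by apply: eq_integral => y _; rewrite big_split.
rewrite (integral_tuple_prob_prod N01
  (g := fun a u => mehler p (tnth x a) u * mehler q u (tnth z a))); last 2 first.
- by move=> a; apply: measurable_funM; [exact: mm|exact: mm'].
- by move=> a u; rewrite mulr_ge0 ?mehler_ge0.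
rewrite -prodEFin; apply: eq_bigr => a _.
exact: mehler_semigroup.
Qed.

Lemma integral_mehler_tuple_diag r : 0 <= r < 1 ->
  (\int[Nd]_x (mehler_tuple r x x)%:E = ((1 - r) ^- d)%:E)%E.
Proof.
move=> r01.
have mxx : measurable_fun setT (fun u : R => (u, u)).
  by apply: measurable_fun_pair; exact: measurable_id.
rewrite (integral_tuple_prob_prod N01 (g := fun a u => mehler r u u)); last 2 first.
- by move=> _; exact: (measurableT_comp (measurable_mehler r) mxx).
- by move=> a u; exact: mehler_ge0.
under eq_bigr do rewrite integral_mehler_diag//.
by rewrite prodEFin prodr_const card_ord exprVn.
Qed.

Lemma gaussian_pair_law_density r A : `|r| < 1 -> measurable A ->
  gaussian_pair_law d r A =
  (\int[(Nd \x Nd)%E]_(w in A) (mehler_tuple r w.1 w.2)%:E)%E.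
Proof.
move=> r1 mA; pose uA := @unzip_tuple _ _ R R d @^-1` A.
have muA : measurable uA.
  by rewrite -[X in measurable X]setTI; exact: measurable_unzip_tuple.
transitivity (\int[tuple_prob d (bigauss_prob r)]_w (\1_uA w)%:E)%E.
  by rewrite integral_indic// setIT.
rewrite (ge0_integral_tuple_density (P := (N01 \x N01)%E) (Q := bigauss_prob r)
  (measurable_mehler r)
  (fun w => mehler_ge0 r w.1 w.2)
  (fun B mB => bigauss_prob_density r1 mB)); last 2 first.
- exact/measurable_EFinP/measurable_indic.
- by move=> w; rewrite lee_fin.
rewrite [RHS]integral_setE_indic.
transitivity (\int[tuple_prob d (N01 \x N01)%E]_w
    ((\1_A (sample_pair (@id 'I_d) w))%:E *
     (mehler_tuple r (sample_pair (@id 'I_d) w).1 (sample_pair (@id 'I_d) w).2)%:E))%E.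
  apply: eq_integral => w _; congr (_ * _%:E)%E.
  by apply: eq_bigr => a _; rewrite !tnth_mktuple.
apply/esym; apply: (@ge0_integral_ext _ _ _ _ _ (tuple_prob d (N01 \x N01)%E)
  (Nd \x Nd)%E (sample_pair (@id 'I_d))
  (fun p => (\1_A p)%:E * (mehler_tuple r p.1 p.2)%:E)%E).
- by move=> B mB; apply: product_tuple_probE.
- apply: emeasurable_funM; first exact/measurable_EFinP/measurable_indic.
  by apply/measurable_EFinP; exact: measurable_mehler_tuple.
- by move=> p; rewrite mule_ge0 ?lee_fin ?mehler_tuple_ge0.
Qed.

End mehler_tuple.

(** * Impossibility of strong detection *)

Section trace_inequality.
Variable R : realFieldType.

Lemma bernoulli_onem (v : R) n : 0 <= v <= 1 -> 1 - v ^+ n <= n%:R * (1 - v).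
Proof.
case/andP=> v0 v1; elim: n => [|n IH]; first by rewrite expr0 subrr mul0r.
have -> : 1 - v ^+ n.+1 = (1 - v) + v * (1 - v ^+ n) by rewrite exprS; ring.
have -> : n.+1%:R * (1 - v) = (1 - v) + 1 * (n%:R * (1 - v)).
  by rewrite -natr1; ring.
rewrite lerD2l ler_pM//; first by rewrite subr_ge0 exprn_ile1.
Qed.

(** With [u = q ^+ a] this brings the traces of the Gaussian kernels to the
    form [1 + B * q ^+ a]. Write [(1 - u) ^- d - 1] as
    [(1 - u) ^- d * (1 - (1 - u) ^+ d)], where the first factor is at most
    [N] and the second at most [d * u] by the Bernoulli inequality. *)
Lemma onem_invX_le (q u N : R) d : 0 <= u <= q -> q < 1 -> (1 - q) ^- d <= N ->
  (1 - u) ^- d <= 1 + d%:R * N * u.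
Proof.
case/andP=> u0 uq q1 HN.
have u1 : 0 < 1 - u by rewrite subr_gt0 (le_lt_trans uq).
have v0 : 0 < (1 - u) ^+ d by rewrite exprn_gt0.
have H : (1 - u) ^- d <= N.
  have u_lt1 : u < 1 by exact: le_lt_trans q1.
  apply: le_trans HN; rewrite lef_pV2 ?posrE ?exprn_gt0 ?subr_gt0//.
  by rewrite lerXn2r ?nnegrE ?subr_ge0 ?lerD2l ?lerN2// ltW.
have B : 1 - (1 - u) ^+ d <= d%:R * u.
  have := @bernoulli_onem (1 - u) d; rewrite subKr; apply.
  by rewrite ltW//= lerBlDr lerDl.
have -> : (1 - u) ^- d = 1 + (1 - u) ^- d * (1 - (1 - u) ^+ d).
  by rewrite mulrBr mulr1 mulVf ?gt_eqF//; ring.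
rewrite lerD2l mulrAC; apply: le_trans (ler_wpM2l _ B) _.
  by rewrite invr_ge0 ltW.
by rewrite mulrC ler_wpM2l// mulr_ge0.
Qed.

End trace_inequality.

(** The likelihood ratio has second moment at most [(1 - r ^+ 2) ^- (d * N)],
    which the hypothesis bounds by [N ^ N]. *)
Lemma gaussian_planted_law_le (R : realType) d (r : R) (N n m : nat) A :
  0 <= r < 1 -> (1 - r ^+ 2) ^- d <= N%:R -> measurable A ->
  (planted_law (gaussian_pair_law d r) (n := n) (m := m) A <=
   ((N ^ N)%:R / 2)%:E * null_law (gaussian_pair_law d r) n m A + (1 / 2)%:E)%E.
Proof.
case/andP=> r0 r1 HN mA.
have rn1 : `|r| < 1 by rewrite ger0_norm.
have q2 : 0 < 1 - r ^+ 2 by rewrite onemX2_gt0.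
have q01 : 0 <= r ^+ 2 < 1 by rewrite sqr_ge0 -subr_gt0.
have N0 : (0 < N)%N.
  by rewrite -(ltr0n R) (lt_le_trans _ HN)// invr_gt0 exprn_gt0.
have rX a : (0 < a)%N -> 0 <= r ^+ (2 * a) < 1.
  by move=> a0; rewrite exprn_ge0//= exprn_ilt1// muln_eq0 /= -lt0n.
have rXn a : (0 < a)%N -> `|r ^+ (2 * a)| < 1.
  by move=> /rX/andP[? ?]; rewrite ger0_norm.
(* the square in the likelihood ratio merges two factors of correlation [r] *)
pose k a := @mehler_tuple R d (r ^+ (2 * a)).
have m1 (x : d.-tuple R) := integral_mehler_tuple x rn1.
have dens := fun A mA => @gaussian_pair_law_density R d r A rn1 mA.
have mehl0 := @mehler_tuple_ge0 R d.
apply: (planted_law_le (P := tuple_prob d (std_normal R))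
  (l := @mehler_tuple R d r) (k := k)) => //.
- exact: measurable_mehler_tuple.
- apply: (density_marginalX (l := @mehler_tuple R d r)) => //.
  exact: measurable_mehler_tuple.
- apply: (density_marginalY (l := @mehler_tuple R d r)) => //.
    exact: measurable_mehler_tuple.
  by move=> y; under eq_integral do rewrite mehler_tupleC.
- by move=> a; exact: measurable_mehler_tuple.
- by move=> a x y; exact: mehl0.
- move=> y y'; under eq_integral do rewrite mehler_tupleC.
  by rewrite mehler_tuple_semigroup// /k muln1 expr2.
- by rewrite ltr0n expn_gt0 N0.
apply: le_trans (perm_kernel_integral_le (q := r ^+ 2) (B := d * N) _ _ _ q01 _ n) _.
- by move=> a; exact: measurable_mehler_tuple.
- by move=> a x y; exact: mehl0.
- move=> a b x z a0 b0; rewrite mehler_tuple_semigroup; [|exact: rXn..].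
  by rewrite -exprD -mulnDr.
- move=> a a0; rewrite /kernel_trace integral_mehler_tuple_diag ?rX//.
  rewrite lee_fin exprM natrM; apply: onem_invX_le HN; last by case/andP: q01.
  rewrite exprn_ge0 ?sqr_ge0//= -[leRHS]expr1.
  by case/andP: q01 => q0 q1; apply: ler_wiXn2l => //; exact: ltW.
rewrite lee_fin ler_wpM2l// natrX exprM -exprVn lerXn2r ?nnegrE//.
by rewrite invr_ge0 exprn_ge0// ltW.
Qed.

Section planted_probability.
Context d1 d2 (T1 : measurableType d1) (T2 : measurableType d2) (R : realType).
Variable PXY : probability (T1 * T2)%type R.

Lemma card_injections_gt0 n m : (m <= n)%N -> (0 < #|injections n m|)%N.
Proof.
move=> mn; apply/card_gt0P; exists [ffun i => widen_ord mn i].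
rewrite finset.inE; apply/injectiveP => i j; rewrite !ffunE => /(congr1 val) /= ij.
exact: val_inj.
Qed.

Lemma planted_law_setC n m A : (m <= n)%N -> measurable A ->
  (planted_law PXY (n := n) (m := m) A + planted_law PXY (n := n) (m := m) (~` A) = 1)%E.
Proof.
move=> mn mA; have := card_injections_gt0 mn => c0.
have cR : #|injections n m|%:R != 0 :> R by rewrite pnatr_eq0 -lt0n.
rewrite /planted_law -muleDr//; last first.
  by apply: ge0_adde_def; rewrite inE; apply: sume_ge0.
rewrite -big_split /=.
rewrite (eq_bigr (fun=> 1%:E)) => [|pi _].
  by rewrite sumEFin sumr_const -EFinM mulVf.
apply: (@eq_trans _ _ (planted_law_given PXY pi A + planted_law_given PXY pi (~` A))%E) => //.
by rewrite probability_setC// addeC subeK// fin_num_measure.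
Qed.

End planted_probability.

Lemma ereal_cvg0 (R : realType) (u : nat -> \bar R) : (forall n, 0 <= u n)%E ->
  (forall e : R, 0 < e -> \forall n \near \oo, (u n < e%:E)%E) ->
  u n @[n --> \oo] --> 0%E.
Proof.
move=> u0 H; apply/fine_cvgP; split.
  have := H 1 ltr01; apply: filterS => n un1.
  by rewrite ge0_fin_numE// (lt_trans un1)// ltry.
apply/cvgrPdist_lt => e e0; have := H e e0; apply: filterS => n un.
have uf : u n \is a fin_num by rewrite ge0_fin_numE// (lt_trans un)// ltry.
by rewrite /= sub0r normrN ger0_norm ?fine_ge0// -lte_fin fineK.
Qed.

(** From right to left, tests whose errors are small for each fixed accuracy
    have to be combined into one sequence: for the [n]-th problem choose a
    test that attains the best accuracy [1 / (k + 1)] with [k <= n]. *)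
Lemma strong_detectionP (R : realType) (dd : measure_display)
    (T : nat -> measurableType dd) (P0 P1 : forall n, set (T n) -> \bar R) :
  (forall n A, 0 <= P0 n A)%E -> (forall n A, 0 <= P1 n A)%E ->
  strong_detection P0 P1 <->
  forall e : R, 0 < e -> \forall n \near \oo, exists A,
    [/\ measurable A, (P0 n A < e%:E)%E & (P1 n (~` A) < e%:E)%E].
Proof.
move=> P0_ge0 P1_ge0; split=> [[phi [mphi phi0 phi1]] e e0|H].
  have e0' : (0 < e%:E)%E by rewrite lte_fin.
  have H0 := phi0 _ (open_ereal_lt' e0'); have H1 := phi1 _ (open_ereal_lt' e0').
  near=> n; exists (phi n @^-1` [set true]); split.
  - by rewrite -[X in measurable X]setTI; exact: mphi.
  - by near: n.
  - have -> : ~` (phi n @^-1` [set true]) = phi n @^-1` [set false].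
      by apply/seteqP; split => z /=; case: (phi n z).
    by near: n.
pose p n k (A : set (T n)) := [/\ measurable A, (P0 n A < k.+1%:R^-1%:E)%E &
  (P1 n (~` A) < k.+1%:R^-1%:E)%E].
pose pb n k := `[< exists A, p n k A >].
(* the best accuracy attained by a test for the n-th problem, capped by n *)
pose K n := (\max_(k < n.+1 | pb n k) k)%N.
pose A n := if pselect (exists A, p n (K n) A) is left ex then projT1 (cid ex) else set0.
have pA e : 0 < e -> \forall n \near \oo, (P0 n (A n) < e%:E)%E /\
    (P1 n (~` A n) < e%:E)%E.
  move=> e0; pose k := Num.truncn e^-1.
  have ke : k.+1%:R^-1 < e.
    by rewrite invf_plt ?posrE// real_truncnS_gt// num_real.
  have k0 : 0 < k.+1%:R^-1 :> R by rewrite invr_gt0.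
  have := H _ k0; move=> Hk; near=> n.
  have pbk : pb n k by apply/asboolP; near: n.
  have nk : (k < n.+1)%N by rewrite ltnS; near: n; exact: nbhs_infty_ge.
  have [i pbi Ki] : exists2 i : 'I_n.+1, pb n i & K n = i.
    have [|i] := @eq_bigmax_cond _ [pred i : 'I_n.+1 | pb n i] (fun i => i : nat).
      by apply/card_gt0P; exists (Ordinal nk).
    by exists i.
  have kK : (k <= K n)%N.
    exact: (leq_bigmax_cond (F := fun i : 'I_n.+1 => i : nat) (Ordinal nk) pbk).
  have Ke : (K n).+1%:R^-1 < e.
    by apply: le_lt_trans ke; rewrite lef_pV2 ?posrE// ler_nat ltnS.
  rewrite /A; case: pselect => [ex|]; last by rewrite Ki; move/asboolP: pbi.
  case: cid => B /= [mB B0 B1]; split.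
  - by apply: lt_trans B0 _; rewrite lte_fin.
  - by apply: lt_trans B1 _; rewrite lte_fin.
have mA n : measurable (A n).
  by rewrite /A; case: pselect => // ex; case: cid => B [].
exists (fun n z => `[< A n z >]); split.
- move=> n; apply: (@measurable_fun_bool _ _ _ _ true) => //.
  rewrite setTI (_ : _ @^-1` _ = A n)//.
  by apply/seteqP; split => z /=; [move/asboolP|move=> ?; apply/asboolP].
- have E n : (fun z => `[< A n z >]) @^-1` [set true] = A n.
    by apply/seteqP; split => z /=; [move/asboolP|move=> ?; apply/asboolP].
  under eq_fun do rewrite E.
  apply: ereal_cvg0 => // e /pA; apply: filterS => n [? _] //.
- have E n : (fun z => `[< A n z >]) @^-1` [set false] = ~` A n.
    apply/seteqP; split => z /=; first by move/negbT/asboolPn.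
    by move=> ?; apply/negbTE/asboolPn.
  under eq_fun do rewrite E.
  apply: ereal_cvg0 => // e /pA; apply: filterS => n [_ ?] //.
Unshelve. all: by end_near.
Qed.

Lemma planted_law_ge0 d1 d2 (T1 : measurableType d1) (T2 : measurableType d2)
    (R : realType) (PXY : probability (T1 * T2)%type R) n m A :
  (0 <= planted_law PXY (n := n) (m := m) A)%E.
Proof.
by apply: mule_ge0; [rewrite lee_fin invr_ge0|apply: sume_ge0].
Qed.

Lemma gaussian_strong_detectionP (R : realType) (alpha : R) dim (rho : nat -> R) :
  gaussian_strong_detection alpha dim rho <->
  forall e : R, 0 < e -> \forall n \near \oo, exists A,
    [/\ measurable A,
      (null_law (gaussian_pair_law (dim n) (rho n)) n
         (Num.truncn (alpha * n%:R)) A < e%:E)%E &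
      (planted_law (gaussian_pair_law (dim n) (rho n)) (n := n)
         (m := Num.truncn (alpha * n%:R)) (~` A) < e%:E)%E].
Proof.
apply: strong_detectionP => n A; first exact: measure_ge0.
exact: planted_law_ge0.
Qed.

(** Wherever [(1 - rho n ^+ 2) ^- dim n <= N], [gaussian_planted_law_le]
    bounds the power of any test by a constant times its level, plus
    [1 / 2]; the constant depends only on [N]. *)
Lemma gaussian_detection_necessary (R : realType) (alpha : R) dim (rho : nat -> R) (N : nat) :
  0 < alpha <= 1 -> (forall n, 0 < rho n < 1) ->
  gaussian_strong_detection alpha dim rho ->
  \forall n \near \oo, N%:R < (1 - rho n ^+ 2) ^- dim n.
Proof.
move=> /andP[a0 a1] hrho det.
have [N0|N0] := posnP N.
  near=> n; rewrite N0 invr_gt0 exprn_gt0// onemX2_gt0//.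
  by have /andP[r0 r1] := hrho n; rewrite gtr0_norm.
pose C : R := (N ^ N)%:R.
have C0 : 0 < C by rewrite ltr0n expn_gt0 N0.
(* chosen so that [C / 2 * e + 1 / 2 + e <= 1] *)
pose e := Num.min (2 * C)^-1 4^-1.
have e0 : 0 < e by rewrite lt_min !invr_gt0 mulr_gt0//=.
have /(_ e e0) H := (gaussian_strong_detectionP alpha dim rho).1 det.
near=> n; rewrite ltNge; apply/negP => HN.
have mn : (Num.truncn (alpha * n%:R) <= n)%N.
  by rewrite -[leqRHS](@natrK R) le_truncn// ler_piMl.
have [A [mA]] : exists A, [/\ measurable A,
   (null_law (gaussian_pair_law (dim n) (rho n)) n (Num.truncn (alpha * n%:R)) A < e%:E)%E &
   (planted_law (gaussian_pair_law (dim n) (rho n)) (n := n)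
      (m := Num.truncn (alpha * n%:R)) (~` A) < e%:E)%E] by near: n.
have := planted_law_setC (gaussian_pair_law (dim n) (rho n)) mn mA.
have r01 : 0 <= rho n < 1 by have /andP[/ltW-> ->] := hrho n.
have := gaussian_planted_law_le (m := Num.truncn (alpha * n%:R)) r01 HN mA.
rewrite -/C; set p1 := planted_law _ A; set p1' := planted_law _ (~` A).
set p0 := null_law _ _ _ _ => H1 H2 p0e p1e.
have : (p1 + p1' < 1%:E)%E; last by rewrite H2 ltxx.
apply: (@le_lt_trans _ _ ((C / 2)%:E * p0 + (1 / 2)%:E + p1')%E).
  exact: leeD.
have E : (1%:E = (C / 2)%:E * (2 * C)^-1%:E + (1 / 2)%:E + 4^-1%:E :> \bar R)%E.
  by rewrite -EFinM -!EFinD; congr EFin; field; rewrite gt_eqF.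
rewrite [ltRHS]E; apply: lee_ltD.
- by rewrite fin_numD !fin_numM// fin_num_measure.
- rewrite leeD2r// lee_wpmul2l ?lee_fin ?divr_ge0 ?(ltW C0)//; apply: ltW.
  by apply: lt_le_trans p0e _; rewrite lee_fin ge_min lexx.
- by apply: lt_le_trans p1e _; rewrite lee_fin ge_min lexx orbT.
Unshelve. all: by end_near.
Qed.

(** * Expectations of bounded measurable functions *)

Section bounded_mfun.
Context d (T : measurableType d) (R : realType).
Implicit Types f g : T -> R.

(** The statistics of the test are bounded, and this class is closed under all
    operations that are applied to them, so that the side conditions of
    integrability reduce to it. *)
Definition bounded_mfun f :=
  measurable_fun setT f /\ exists M, forall x, `|f x| <= M.

Lemma bounded_mfun_cst (c : R) : bounded_mfun (fun=> c).
Proof. by split=> //; exists `|c|. Qed.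

Lemma bounded_mfunD f g : bounded_mfun f -> bounded_mfun g ->
  bounded_mfun (fun x => f x + g x).
Proof.
move=> [mf [M fM]] [mg [N gN]]; split; first exact: measurable_funD.
by exists (M + N) => x; rewrite (le_trans (ler_normD _ _))// lerD.
Qed.

Lemma bounded_mfunB f g : bounded_mfun f -> bounded_mfun g ->
  bounded_mfun (fun x => f x - g x).
Proof.
move=> [mf [M fM]] [mg [N gN]]; split; first exact: measurable_funB.
by exists (M + N) => x; rewrite (le_trans (ler_normB _ _))// lerD.
Qed.

Lemma bounded_mfunM f g : bounded_mfun f -> bounded_mfun g ->
  bounded_mfun (fun x => f x * g x).
Proof.
move=> [mf [M fM]] [mg [N gN]]; split; first exact: measurable_funM.
by exists (M * N) => x; rewrite normrM ler_pM.
Qed.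

Lemma bounded_mfun_sum (I : Type) (r : seq I) (p : pred I) (F : I -> T -> R) :
  (forall i, bounded_mfun (F i)) ->
  bounded_mfun (fun x => \sum_(i <- r | p i) F i x).
Proof.
move=> bF; elim: r => [|i r IH].
  by under eq_fun do rewrite big_nil; exact: bounded_mfun_cst.
under eq_fun do rewrite big_cons; case: (p i) => //.
exact: bounded_mfunD.
Qed.

Lemma bounded_mfun_indic A : measurable A -> bounded_mfun (\1_A).
Proof.
move=> mA; split; first exact: measurable_indic.
by exists 1 => x; rewrite indicE; case: (_ \in _); rewrite ?normr1 ?normr0.
Qed.

End bounded_mfun.

Lemma bounded_mfun_comp d d' (T : measurableType d) (T' : measurableType d')
    (R : realType) (f : T' -> R) (g : T -> T') :
  bounded_mfun f -> measurable_fun setT g -> bounded_mfun (fun x => f (g x)).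
Proof.
by move=> [mf [M fM]] mg; split; [exact: (measurableT_comp mf mg)|exists M].
Qed.

Section expectation_bounded.
Context d (T : measurableType d) (R : realType) (P : probability T R).
Implicit Types f g : T -> R.

Lemma bounded_mfun_integrable f : bounded_mfun f -> P.-integrable setT (EFin \o f).
Proof.
move=> [mf [M fM]]; apply: measurable_bounded_integrable => //.
  by rewrite -ge0_fin_numE// fin_num_measure.
exists M; split; first exact: num_real.
by move=> N MN x _ /=; rewrite (le_trans (fM x))// ltW.
Qed.

Lemma expectE f : bounded_mfun f ->
  (\int[P]_x (f x)%:E)%E = (\int[P]_x f x)%:E.
Proof.
move=> bf; rewrite /Rintegral fineK//.
exact/integrable_fin_num/bounded_mfun_integrable.
Qed.

Lemma expect_cst (c : R) : \int[P]_x c = c.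
Proof.
transitivity (c * fine (P setT)); first exact: Rintegral_cst.
by rewrite probability_setT mulr1.
Qed.

Lemma expectD f g : bounded_mfun f -> bounded_mfun g ->
  \int[P]_x (f x + g x) = \int[P]_x f x + \int[P]_x g x.
Proof. by move=> bf bg; rewrite RintegralD//; exact: bounded_mfun_integrable. Qed.

Lemma expectB f g : bounded_mfun f -> bounded_mfun g ->
  \int[P]_x (f x - g x) = \int[P]_x f x - \int[P]_x g x.
Proof. by move=> bf bg; rewrite RintegralB//; exact: bounded_mfun_integrable. Qed.

Lemma expectZ (c : R) f : bounded_mfun f ->
  \int[P]_x (c * f x) = c * \int[P]_x f x.
Proof. by move=> bf; rewrite RintegralZl//; exact: bounded_mfun_integrable. Qed.

Lemma expect_le f g : bounded_mfun f -> bounded_mfun g ->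
  (forall x, f x <= g x) -> \int[P]_x f x <= \int[P]_x g x.
Proof. by move=> bf bg fg; apply: le_Rintegral => //; exact: bounded_mfun_integrable. Qed.

Lemma expect_sum (I : Type) (r : seq I) (p : pred I) (F : I -> T -> R) :
  (forall i, bounded_mfun (F i)) ->
  \int[P]_x (\sum_(i <- r | p i) F i x) = \sum_(i <- r | p i) \int[P]_x F i x.
Proof.
move=> bF; elim: r => [|i r IH].
  rewrite big_nil (@eq_Rintegral _ _ _ _ _ (fun=> 0)) ?expect_cst// => x _.
  by rewrite big_nil.
rewrite big_cons -IH.
case: ifP => pi.
  rewrite -expectD//; last exact: bounded_mfun_sum.
  by apply: eq_Rintegral => x _; rewrite big_cons pi.
by apply: eq_Rintegral => x _; rewrite big_cons pi.
Qed.

Lemma expect_indic A : measurable A -> (\int[P]_x \1_A x)%:E = P A.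
Proof.
by move=> mA; rewrite -expectE ?integral_indic ?setIT//; exact: bounded_mfun_indic.
Qed.

(** Chebyshev's inequality for an event included in a deviation event, which is
    how the errors of a test arise. *)
Lemma chebyshev_le (f : T -> R) (m t v : R) A : bounded_mfun f -> 0 < t ->
  measurable A -> (forall x, A x -> t <= `|f x - m|) ->
  \int[P]_x ((f x - m) ^+ 2) <= v -> (P A <= (v / t ^+ 2)%:E)%E.
Proof.
move=> bf t0 mA At Ev.
have bm := @bounded_mfun_cst _ T _ m.
have bB := bounded_mfunB bf bm.
have bB2 := bounded_mfunM bB bB.
rewrite -expect_indic// lee_fin ler_pdivlMr ?exprn_gt0//.
apply: le_trans Ev; rewrite mulrC -expectZ; last exact: bounded_mfun_indic.
apply: expect_le => // [|x].
  by apply: bounded_mfunM; [exact: bounded_mfun_cst|exact: bounded_mfun_indic].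
rewrite indicE; case: (boolP (x \in A)) => [xA|_]; rewrite ?mulr0 ?sqr_ge0// mulr1.
rewrite -(real_normK (num_real (f x - m))) lerXn2r ?nnegrE ?(ltW t0)//.
by apply: At; rewrite -inE.
Qed.

End expectation_bounded.

Lemma expect_ext d d' (T : measurableType d) (T' : measurableType d')
    (R : realType) (P : probability T R) (Q : probability T' R)
    (g : T -> T') (f : T' -> R) : measurable_fun setT g ->
  (forall A, measurable A -> Q A = P (g @^-1` A)) -> bounded_mfun f ->
  \int[Q]_y f y = \int[P]_x f (g x).
Proof.
move=> mg QP bf.
pose gm := isMeasurableFun.Build _ _ T T' g mg.
pose g' : {mfun T >-> T'} := HB.pack g gm.
rewrite /Rintegral; congr fine.
transitivity (\int[distribution P g']_y (f y)%:E)%E.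
  by apply: eq_measure_integral => A mA _; exact: QP.
rewrite integral_distribution//; first by apply/measurable_EFinP; case: bf.
exact/bounded_mfun_integrable/bounded_mfun_comp.
Qed.

Section expectation_fubini.
Context d d' (T : measurableType d) (T' : measurableType d') (R : realType).
Variables (P : probability T R) (Q : probability T' R) (f : T * T' -> R).
Hypothesis bf : bounded_mfun f.

Lemma bounded_mfun_section1 x : bounded_mfun (fun y => f (x, y)).
Proof. by apply: bounded_mfun_comp => //; exact: pair1_measurable. Qed.

Lemma bounded_mfun_section2 y : bounded_mfun (fun x => f (x, y)).
Proof. by apply: bounded_mfun_comp => //; exact: pair2_measurable. Qed.

Let intf := @bounded_mfun_integrable _ _ _ (P \x Q)%E _ bf.

Lemma expect_fubini1 : \int[(P \x Q)%E]_z f z = \int[P]_x \int[Q]_y f (x, y).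
Proof.
rewrite /Rintegral; congr fine; rewrite -(integral12_prod_meas1 intf).
by apply: eq_integral => x _; rewrite /fubini_F expectE//; exact: bounded_mfun_section1.
Qed.

Lemma bounded_mfun_expect : bounded_mfun (fun x => \int[Q]_y f (x, y)).
Proof.
split; last first.
  have [_ [M fM]] := bf; exists M => x.
  have bx := bounded_mfun_section1 x; rewrite ler_norml; apply/andP; split.
    rewrite -[leLHS](expect_cst Q); apply: expect_le => //.
      exact: bounded_mfun_cst.
    by move=> y; have := fM (x, y); rewrite ler_norml => /andP[].
  rewrite -[leRHS](expect_cst Q); apply: expect_le => //.
    exact: bounded_mfun_cst.
  by move=> y; have := fM (x, y); rewrite ler_norml => /andP[].
have mF := measurable_fubini_F intf.
have mf : measurable_fun setT (fine : \bar R -> R) by exact: fine_measurable.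
exact: (measurableT_comp mf mF).
Qed.

End expectation_fubini.

(** * Second moments of sums over i.i.d. samples *)

Section resampling.
Context d (T : measurableType d) (R : realType) (Q : probability T R) (n : nat).
Local Notation Qn := (tuple_prob n Q).

Definition tuple_upd (k : 'I_n) (p : n.-tuple T * T) : n.-tuple T :=
  [tuple if i == k then p.2 else tnth p.1 i | i < n].

Lemma tnth_upd k z w i :
  tnth (tuple_upd k (z, w)) i = if i == k then w else tnth z i.
Proof. by rewrite tnth_mktuple. Qed.

Lemma measurable_tuple_upd k : measurable_fun setT (tuple_upd k).
Proof.
apply/measurable_fun_tnthP => i.
rewrite (_ : _ \o _ = fun p : n.-tuple T * T => if i == k then p.2 else tnth p.1 i).
  case: (i == k); first exact: measurable_snd.
  exact: (measurableT_comp (measurable_tnth i) measurable_fst).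
by apply/funext => -[z w]; rewrite /= tnth_upd.
Qed.

HB.instance Definition _ k := isMeasurableFun.Build _ _ _ _ (tuple_upd k)
  (measurable_tuple_upd k).

(** An entry may be replaced by an independent copy. A function whose mean
    over that copy is zero is therefore orthogonal to all functions of the
    other entries, which is [expect_orthogonal]. *)
Lemma tuple_prob_resample k A : measurable A ->
  Qn A = (Qn \x Q)%E (tuple_upd k @^-1` A).
Proof.
move=> mA; apply: (@tuple_probability_unique _ _ _ _ _
  (distribution (Qn \x Q)%E (tuple_upd k))) A mA => A mA.
rewrite tuple_prob_box//.
transitivity ((Qn \x Q)%E
    (tuple_box (fun i => if i == k then setT else A i) `*` A k)).
  rewrite product_probabilityE//; last first.
    by apply: measurable_tuple_box => i; case: ifP.
  rewrite tuple_prob_box; last by move=> i; case: ifP.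
  rewrite (bigD1 k)//= muleC [in RHS](bigD1 k)//= eqxx probability_setT mul1e.
  by congr (_ * _)%E; apply: eq_bigr => i /negbTE ->.
apply: (congr1 (product_measure1 Qn _)); apply/seteqP; split => -[z w] /=.
  move=> [zA wA] i; rewrite tnth_upd; case: eqVneq => [->//|ik].
  by have := zA i; rewrite (negbTE ik).
move=> zwA; split => [i|].
  by have := zwA i; rewrite tnth_upd; case: ifP.
by have := zwA k; rewrite tnth_upd eqxx.
Qed.

Lemma expect_resample k (F : n.-tuple T -> R) : bounded_mfun F ->
  \int[Qn]_z F z = \int[Qn]_z \int[Q]_w F (tuple_upd k (z, w)).
Proof.
move=> bF.
rewrite (expect_ext (measurable_tuple_upd k) (@tuple_prob_resample k) bF).
apply: (expect_fubini1 Qn Q (f := F \o tuple_upd k)).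
by apply: bounded_mfun_comp => //; exact: measurable_tuple_upd.
Qed.

Lemma expect_orthogonal k (F G : n.-tuple T -> R) :
  bounded_mfun F -> bounded_mfun G ->
  (forall z w, G (tuple_upd k (z, w)) = G z) ->
  (forall z, \int[Q]_w F (tuple_upd k (z, w)) = 0) ->
  \int[Qn]_z (F z * G z) = 0.
Proof.
move=> bF bG GE F0; rewrite (expect_resample k); last exact: bounded_mfunM.
transitivity (\int[Qn]_z (0 : R)); last exact: expect_cst.
apply: eq_Rintegral => z _.
transitivity (\int[Q]_w (G z * F (tuple_upd k (z, w)))).
  by apply: eq_Rintegral => w _; rewrite GE mulrC.
rewrite expectZ ?F0 ?mulr0//.
apply: (bounded_mfun_section1 (f := F \o tuple_upd k)).
by apply: bounded_mfun_comp => //; exact: measurable_tuple_upd.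
Qed.

Lemma tuple_prob_tnth i A : measurable A -> Q A = Qn ((@tnth n T)^~ i @^-1` A).
Proof.
move=> mA; rewrite tnth_preimage_box tuple_prob_box; last by move=> j; case: ifP.
rewrite (bigD1 i)//= eqxx big1 ?mule1// => j /negbTE ->.
exact: probability_setT.
Qed.

Lemma expect_tnth i (u : T -> R) : bounded_mfun u ->
  \int[Qn]_z u (tnth z i) = \int[Q]_w u w.
Proof.
by move=> bu; rewrite (expect_ext (measurable_tnth i) (@tuple_prob_tnth i) bu).
Qed.

Lemma tuple_prob_tnth2 i j A : i != j -> measurable A ->
  (Q \x Q)%E A = Qn ((fun z => (tnth z i, tnth z j)) @^-1` A).
Proof.
move=> ij mA.
have mf : measurable_fun setT (fun z : n.-tuple T => (tnth z i, tnth z j)).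
  by apply: measurable_fun_pair; exact: measurable_tnth.
pose fm := isMeasurableFun.Build _ _ _ _ (fun z : n.-tuple T => (tnth z i, tnth z j)) mf.
pose f : {mfun n.-tuple T >-> (T * T)%type} :=
  HB.pack (fun z : n.-tuple T => (tnth z i, tnth z j)) fm.
transitivity (distribution Qn f A); last by [].
apply: product_measure_unique => // B C mB mC.
transitivity (Qn (tuple_box
    (fun k => if k == i then B else if k == j then C else setT))).
  apply: (congr1 Qn); apply/seteqP; split => z /=.
    by move=> [zB zC] k; case: eqVneq => [->//|_]; case: eqVneq => [->|].
  move=> zBC; split; first by have := zBC i; rewrite eqxx.
  by have := zBC j; rewrite eqxx eq_sym (negbTE ij).
rewrite tuple_prob_box; last by move=> k; case: ifP => // _; case: ifP.
have ji : (j == i) = false by rewrite eq_sym; exact: negbTE.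
rewrite (bigD1 i)//= eqxx (bigD1 j)/= ?ji// eqxx big1 ?mule1//.
by move=> k /andP[/negbTE -> /negbTE ->]; exact: probability_setT.
Qed.

Lemma expect_tnth2 i j (u : T * T -> R) : i != j -> bounded_mfun u ->
  \int[Qn]_z u (tnth z i, tnth z j) = \int[(Q \x Q)%E]_w u w.
Proof.
move=> ij bu.
have mf : measurable_fun setT (fun z : n.-tuple T => (tnth z i, tnth z j)).
  by apply: measurable_fun_pair; exact: measurable_tnth.
by rewrite (expect_ext mf (fun A => @tuple_prob_tnth2 i j A ij) bu).
Qed.

End resampling.

Lemma expect_sqr_sum (I : finType) d (T : measurableType d) (R : realType)
    (P : probability T R) (A : {set I}) (F : I -> T -> R) :
  (forall i, bounded_mfun (F i)) ->
  \int[P]_x ((\sum_(i in A) F i x) ^+ 2) =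
  \sum_(i in A) \sum_(j in A) \int[P]_x (F i x * F j x).
Proof.
move=> bF.
have bFF i j : bounded_mfun (fun x => F i x * F j x) by exact: bounded_mfunM.
transitivity (\int[P]_x (\sum_(i in A) \sum_(j in A) F i x * F j x)).
  apply: eq_Rintegral => x _; rewrite expr2 mulr_suml.
  by apply: eq_bigr => i _; rewrite mulr_sumr.
rewrite expect_sum; last by move=> i; exact: bounded_mfun_sum.
by apply: eq_bigr => i _; rewrite expect_sum.
Qed.

Lemma expect_sqr_sum_iid d (T : measurableType d) (R : realType)
    (Q : probability T R) n (I : {set 'I_n}) (u : T -> R) :
  bounded_mfun u -> \int[Q]_w u w = 0 ->
  \int[tuple_prob n Q]_z ((\sum_(i in I) u (tnth z i)) ^+ 2) =
  #|I|%:R * \int[Q]_w (u w ^+ 2).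
Proof.
move=> bu u0.
have bui (i : 'I_n) : bounded_mfun (fun z : n.-tuple T => u (tnth z i)).
  by apply: bounded_mfun_comp => //; exact: measurable_tnth.
rewrite (expect_sqr_sum _ _ bui) mulr_natl -sumr_const; apply: eq_bigr => i iI.
rewrite (bigD1 i)//= big1 ?addr0 => [|j /andP[_ ji]].
  by rewrite (expect_tnth Q i (bounded_mfunM bu bu)).
apply: (expect_orthogonal (k := i)) => //.
- by move=> z w; rewrite tnth_upd (negbTE ji).
- by move=> z; rewrite -u0; apply: eq_Rintegral => w _; rewrite tnth_upd eqxx.
Qed.

(** * The test based on a bilinear statistic *)

Section bilinear_statistic.
Context d1 d2 (T1 : measurableType d1) (T2 : measurableType d2) (R : realType).
Variables (P1 : probability T1 R) (P2 : probability T2 R).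
Variable h : T1 * T2 -> R.
Hypothesis bh : bounded_mfun h.
Hypothesis h1_0 : forall y, \int[P1]_x h (x, y) = 0.
Hypothesis h2_0 : forall x, \int[P2]_y h (x, y) = 0.
Variable V : R.
Hypothesis hV : \int[(P1 \x P2)%E]_z (h z ^+ 2) <= V.

Definition bilinear_stat n m (p : n.-tuple T1 * m.-tuple T2) : R :=
  \sum_(i < m) \sum_(j < n) h (tnth p.1 j, tnth p.2 i).

Lemma bounded_bilinear_stat n m : bounded_mfun (@bilinear_stat n m).
Proof.
apply: bounded_mfun_sum => i; apply: bounded_mfun_sum => j.
apply: bounded_mfun_comp => //; apply: measurable_fun_pair.
  exact: (measurableT_comp (measurable_tnth j) measurable_fst).
exact: (measurableT_comp (measurable_tnth i) measurable_snd).
Qed.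

Section fixed_law.
Variable Q : probability (T1 * T2)%type R.
Hypothesis Q1 : forall A, measurable A -> P1 A = Q (fst @^-1` A).
Hypothesis Q2 : forall A, measurable A -> P2 A = Q (snd @^-1` A).
Variable W : R.
Hypothesis hW : \int[Q]_z (h z ^+ 2) <= W.
Local Notation mu := (\int[Q]_z h z).
Variables (n : nat).
Local Notation Qn := (tuple_prob n Q).

Let u (p : 'I_n * 'I_n) (z : n.-tuple (T1 * T2)) : R :=
  h ((tnth z p.1).1, (tnth z p.2).2).

Let mcross : measurable_fun setT
  (fun w : (T1 * T2) * (T1 * T2) => (w.1.1, w.2.2)).
Proof.
apply: measurable_fun_pair.
  exact: (measurableT_comp measurable_fst measurable_fst).
exact: (measurableT_comp measurable_snd measurable_snd).
Qed.

Let bu p : bounded_mfun (u p).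
Proof.
apply: bounded_mfun_comp => //; apply: measurable_fun_pair.
  exact: (measurableT_comp measurable_fst (measurable_tnth _)).
exact: (measurableT_comp measurable_snd (measurable_tnth _)).
Qed.

Let hx y : bounded_mfun (fun x => h (x, y)).
Proof. exact: bounded_mfun_section2. Qed.

Let hy x : bounded_mfun (fun y => h (x, y)).
Proof. exact: bounded_mfun_section1. Qed.

Let bh2 : bounded_mfun (fun z => h z ^+ 2).
Proof. exact: bounded_mfunM. Qed.

Lemma expect_cross_sqr p : p.1 != p.2 -> \int[Qn]_z (u p z ^+ 2) <= V.
Proof.
move=> p12; apply: le_trans hV; rewrite le_eqVlt; apply/orP; left; apply/eqP.
have bc := bounded_mfun_comp bh2 mcross.
rewrite (expect_tnth2 Q p12 bc) (expect_fubini1 Q Q bc) (expect_fubini1 P1 P2 bh2).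
have bx : bounded_mfun (fun x => \int[P2]_y (h (x, y) ^+ 2)).
  exact: (bounded_mfun_expect P1 P2 bh2).
rewrite (expect_ext measurable_fst Q1 bx); apply: eq_Rintegral => w _ /=.
by rewrite (expect_ext measurable_snd Q2 (bounded_mfunM (hy w.1) (hy w.1))).
Qed.

(** If an index of [p] is not an index of [q], the corresponding entry is
    resampled: [u q] does not see it, and [u p] averages to zero because
    [h] does so in each argument. The remaining cases are [q = p] and
    [q = (p.2, p.1)]. *)
Lemma expect_cross_orthogonal p q : p.1 != p.2 -> p != q -> q != (p.2, p.1) ->
  \int[Qn]_z (u p z * u q z) = 0.
Proof.
move=> p12 pq qp.
have [k1|k1] := boolP ((p.1 != q.1) && (p.1 != q.2)).
  apply: (expect_orthogonal (k := p.1)) => //.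
  - move=> z w; rewrite /u !tnth_upd.
    by case/andP: k1; rewrite eq_sym => /negbTE ->; rewrite eq_sym => /negbTE ->.
  - move=> z; rewrite -(h1_0 (tnth z p.2).2) (expect_ext measurable_fst Q1 (hx _)).
    apply: eq_Rintegral => w _; rewrite /u !tnth_upd eqxx.
    by rewrite eq_sym (negbTE p12).
have [k2|k2] := boolP ((p.2 != q.1) && (p.2 != q.2)).
  apply: (expect_orthogonal (k := p.2)) => //.
  - move=> z w; rewrite /u !tnth_upd.
    by case/andP: k2; rewrite eq_sym => /negbTE ->; rewrite eq_sym => /negbTE ->.
  - move=> z; rewrite -(h2_0 (tnth z p.1).1) (expect_ext measurable_snd Q2 (hy _)).
    apply: eq_Rintegral => w _; rewrite /u !tnth_upd eqxx.
    by rewrite (negbTE p12).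
exfalso; move: p q p12 pq qp k1 k2 => [i j] [i' j'] /=.
rewrite !xpair_eqE /= !negb_and !negbK => ij pq qp.
by case/orP=> /eqP E1; case/orP=> /eqP E2; move: ij pq qp; rewrite E1 E2 !eqxx.
Qed.

(** The pair [(p.2, p.1)] involves the same two entries as [p], so that
    orthogonality fails; the inequality between the arithmetic and
    geometric means takes its place. *)
Lemma expect_cross_le p q : p.1 != p.2 -> q.1 != q.2 ->
  \int[Qn]_z (u p z * u q z) <= V * ((q == p)%:R + (q == (p.2, p.1))%:R).
Proof.
move=> p12 q12.
have V0 : 0 <= V by apply: le_trans hV; apply: Rintegral_ge0 => z _; exact: sqr_ge0.
have [->|qp] := eqVneq q p.
  rewrite mulrDr mulr1 ler_wpDr ?mulr_ge0 ?ler0n//; exact: expect_cross_sqr.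
have [->|qp'] := eqVneq q (p.2, p.1); last first.
  have pq : p != q by rewrite eq_sym.
  rewrite (expect_cross_orthogonal p12 pq qp').
  by rewrite mulr_ge0// addr_ge0 ?ler0n.
rewrite /= add0r mulr1; set p' := (p.2, p.1).
apply: (@le_trans _ _ (\int[Qn]_z (2^-1 * (u p z ^+ 2 + u p' z ^+ 2)))).
  apply: expect_le; first exact: bounded_mfunM.
    apply: bounded_mfunM; first exact: bounded_mfun_cst.
    by apply: bounded_mfunD; exact: bounded_mfunM.
  move=> z; rewrite -subr_ge0.
  rewrite (_ : _ - _ = 2^-1 * (u p z - u p' z) ^+ 2); last by field.
  by rewrite mulr_ge0 ?sqr_ge0.
rewrite expectZ ?expectD; try exact: bounded_mfunM;
  last by apply: bounded_mfunD; exact: bounded_mfunM.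
have := expect_cross_sqr p12.
have := @expect_cross_sqr p'; rewrite /= eq_sym => /(_ p12).
by lra.
Qed.

Variable I : {set 'I_n}.

(** The statistic [bilinear_stat] on the i.i.d. pairs behind [sample_pair],
    with [I] the range of the injection. *)
Definition labelled_stat (z : n.-tuple (T1 * T2)) : R :=
  \sum_(i in I) \sum_(j < n) h ((tnth z j).1, (tnth z i).2).

Lemma bounded_labelled_stat : bounded_mfun labelled_stat.
Proof.
apply: bounded_mfun_sum => i; apply: bounded_mfun_sum => j; exact: (bu (j, i)).
Qed.

(** The matched terms form a centred i.i.d. sum [D]. The mismatched ones, in
    [O], are pairwise orthogonal except for a pair of indices and its
    transpose, so that their second moment is linear in the number
    [n * #|I|] of terms. *)
Lemma labelled_stat_second_moment :
  \int[Qn]_z ((labelled_stat z - #|I|%:R * mu) ^+ 2) <=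
  2 * #|I|%:R * W + 4 * n%:R * #|I|%:R * V.
Proof.
pose D (z : n.-tuple (T1 * T2)) := \sum_(i in I) (h (tnth z i) - mu).
pose A := [set p : 'I_n * 'I_n | (p.2 \in I) && (p.1 != p.2)]%SET.
pose O z := \sum_(p in A) u p z.
have bhmu : bounded_mfun (fun w => h w - mu).
  by apply: bounded_mfunB => //; exact: bounded_mfun_cst.
have bD : bounded_mfun D.
  apply: bounded_mfun_sum => i; apply: bounded_mfun_comp bhmu _.
  exact: measurable_tnth.
have bO : bounded_mfun O by apply: bounded_mfun_sum => p.
have splitS z : labelled_stat z - #|I|%:R * mu = D z + O z.
  rewrite /D sumrB sumr_const addrAC; congr (_ - _); last by rewrite mulr_natl.
  have -> : O z = \sum_(i in I) \sum_(j < n | j != i) u (j, i) z.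
    rewrite (pair_big_dep (mem I) (fun i j => j != i) (fun i j => u (j, i) z)) /O.
    have swapK : involutive (fun p : 'I_n * 'I_n => (p.2, p.1)) by case.
    rewrite (reindex_inj (inv_inj swapK)) /=; apply: eq_big => // p.
    by rewrite finset.inE /= andbC [p.2 == _]eq_sym andbC.
  rewrite -big_split /=; apply: eq_bigr => i _; rewrite (bigD1 i)//=.
  by congr (h _ + _); case: (tnth z i).
have ED : \int[Qn]_z (D z ^+ 2) <= #|I|%:R * W.
  rewrite (expect_sqr_sum_iid I bhmu); last first.
    by rewrite expectB ?expect_cst ?subrr//; exact: bounded_mfun_cst.
  rewrite ler_wpM2l ?ler0n//; apply: le_trans hW.
  have -> : \int[Q]_w ((h w - mu) ^+ 2) = \int[Q]_w (h w ^+ 2) - mu ^+ 2.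
    transitivity (\int[Q]_w (h w ^+ 2 - (2 * mu * h w - mu ^+ 2))).
      by apply: eq_Rintegral => w _; ring.
    have bc := @bounded_mfun_cst _ (T1 * T2)%type R.
    rewrite expectB//; last by apply: bounded_mfunB => //; exact: bounded_mfunM.
    rewrite expectB//; last exact: bounded_mfunM.
    by rewrite expectZ// expect_cst; ring.
  by rewrite lerBlDr lerDl sqr_ge0.
have EO : \int[Qn]_z (O z ^+ 2) <= 2 * n%:R * #|I|%:R * V.
  rewrite (expect_sqr_sum Qn A bu).
  have V0 : 0 <= V by apply: le_trans hV; apply: Rintegral_ge0 => w _; exact: sqr_ge0.
  have sum1 (p : 'I_n * 'I_n) : \sum_(q in A) (q == p)%:R <= 1 :> R.
    have [pA|pA] := boolP (p \in A).
      by rewrite (bigD1 p)//= eqxx big1 ?addr0// => q /andP[_ /negbTE ->].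
    rewrite big1// => q qA; case: eqVneq => // qp.
    by rewrite -qp qA in pA.
  apply: (@le_trans _ _ (\sum_(p in A) V * 2)).
    apply: ler_sum => p; rewrite finset.inE => /andP[_ p12].
    apply: (@le_trans _ _ (\sum_(q in A) V * ((q == p)%:R + (q == (p.2, p.1))%:R))).
      apply: ler_sum => q; rewrite finset.inE => /andP[_ q12].
      exact: expect_cross_le.
    rewrite -mulr_sumr ler_wpM2l// big_split /= -[leRHS]/(1 + 1) lerD//.
  rewrite sumr_const -[leLHS]mulr_natl.
  have cA : (#|A| <= n * #|I|)%N.
    rewrite -[X in (X * _)%N]card_ord -cardsT -cardsX; apply: subset_leq_card.
    by apply/fintype.subsetP => p; rewrite !finset.inE /= => /andP[].
  have := cA; rewrite -(ler_nat R) natrM => cAR.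
  have H : #|A|%:R * (V * 2) <= (n%:R * #|I|%:R) * (V * 2).
    by rewrite ler_wpM2r// mulr_ge0.
  apply: le_trans H _; rewrite le_eqVlt; apply/orP; left; apply/eqP; ring.
have bD2 : bounded_mfun (fun z => 2 * D z ^+ 2).
  by apply: bounded_mfunM; [exact: bounded_mfun_cst|exact: bounded_mfunM].
have bO2 : bounded_mfun (fun z => 2 * O z ^+ 2).
  by apply: bounded_mfunM; [exact: bounded_mfun_cst|exact: bounded_mfunM].
apply: (@le_trans _ _ (\int[Qn]_z (2 * D z ^+ 2 + 2 * O z ^+ 2))).
  apply: expect_le; [|exact: bounded_mfunD|].
    apply: bounded_mfunM; apply: bounded_mfunB => //;
      by [exact: bounded_labelled_stat|exact: bounded_mfun_cst].
  move=> z; rewrite splitS -subr_ge0.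
  by rewrite (_ : _ - _ = (D z - O z) ^+ 2) ?sqr_ge0//; ring.
rewrite expectD// !expectZ; try exact: bounded_mfunM.
have -> : 4 * n%:R * #|I|%:R * V = 2 * (2 * n%:R * #|I|%:R * V) by ring.
by rewrite -mulrA lerD// ler_wpM2l.
Qed.

End fixed_law.
End bilinear_statistic.

Section bilinear_test.
Context d1 d2 (T1 : measurableType d1) (T2 : measurableType d2) (R : realType).
Variables (P1 : probability T1 R) (P2 : probability T2 R).
Variable PXY : probability (T1 * T2)%type R.
Hypothesis PX : forall A, measurable A -> marginalX PXY A = P1 A.
Hypothesis PY : forall A, measurable A -> marginalY PXY A = P2 A.
Variable h : T1 * T2 -> R.
Hypothesis bh : bounded_mfun h.
Hypothesis h1_0 : forall y, \int[P1]_x h (x, y) = 0.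
Hypothesis h2_0 : forall x, \int[P2]_y h (x, y) = 0.
Variables V W : R.
Hypothesis hV : \int[(P1 \x P2)%E]_z (h z ^+ 2) <= V.
Hypothesis hW : \int[PXY]_z (h z ^+ 2) <= W.
Local Notation mu := (\int[PXY]_z h z).
Hypothesis mu_gt0 : 0 < mu.
Variables n m : nat.
Hypothesis mn : (0 < m <= n)%N.

(** The statistic has mean 0 under the null law and [m * mu] under the planted
    one; the threshold is halfway. *)
Definition bilinear_test : set (n.-tuple T1 * m.-tuple T2) :=
  [set p | m%:R * mu / 2 <= bilinear_stat h p].

Let bS := bounded_bilinear_stat bh n m.

Lemma measurable_bilinear_test : measurable bilinear_test.
Proof.
rewrite -[X in measurable X]setTI; apply: measurable_fun_ler => //.
by case: bS.
Qed.

Let t := m%:R * mu / 2.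
Let t_gt0 : 0 < t.
Proof. by case/andP: mn => m0 _; rewrite divr_gt0// mulr_gt0// ltr0n. Qed.

Lemma bilinear_stat_sample_pair (f : 'I_m -> 'I_n) z : injective f ->
  bilinear_stat h (sample_pair f z) = labelled_stat h (f @: [set: 'I_m])%SET z.
Proof.
move=> finj; rewrite /labelled_stat big_imset /=; last by move=> i j _ _; exact: finj.
rewrite /bilinear_stat; apply: eq_big => [i|i _]; first by rewrite finset.in_setT.
by apply: eq_bigr => j _; rewrite !tnth_mktuple.
Qed.

(** Both errors are instances of this bound: [Q] is the product of [P1] and
    [P2] under the null law and [PXY] under the planted one. *)
Lemma sample_pair_test_error (Q : probability (T1 * T2)%type R) W'
    (f : 'I_m -> 'I_n) A :
  (forall B, measurable B -> P1 B = Q (fst @^-1` B)) ->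
  (forall B, measurable B -> P2 B = Q (snd @^-1` B)) ->
  \int[Q]_z (h z ^+ 2) <= W' -> injective f -> measurable A ->
  (forall p, A p -> t <= `|bilinear_stat h p - m%:R * \int[Q]_z h z|) ->
  (tuple_prob n Q (sample_pair f @^-1` A) <=
   ((2 * m%:R * W' + 4 * n%:R * m%:R * V) / t ^+ 2)%:E)%E.
Proof.
move=> Q1 Q2 hW' finj mA At.
have cI : #|(f @: [set: 'I_m])%SET| = m by rewrite card_imset// cardsT card_ord.
apply: (chebyshev_le (f := labelled_stat h (f @: [set: 'I_m])%SET)
  (m := m%:R * \int[Q]_z h z)) => //.
- exact: bounded_labelled_stat.
- by rewrite -[X in measurable X]setTI; exact: measurable_funP.
- by move=> z /= /At; rewrite bilinear_stat_sample_pair.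
- have := labelled_stat_second_moment bh h1_0 h2_0 hV Q1 Q2 hW' (f @: [set: 'I_m])%SET.
  by rewrite cI.
Qed.

Lemma null_test_error :
  (null_law PXY n m bilinear_test <= (6 * n%:R * m%:R * V / t ^+ 2)%:E)%E.
Proof.
case/andP: (mn) => m0 lemn.
have winj : injective (widen_ord lemn).
  by move=> i j /(congr1 val) /= ij; exact: val_inj.
rewrite (null_lawE PX PY measurable_bilinear_test).
rewrite (product_tuple_probE P1 P2 winj measurable_bilinear_test).
have Q1 B : measurable B -> P1 B = (P1 \x P2)%E (fst @^-1` B).
  move=> mB; rewrite (_ : _ @^-1` _ = B `*` setT); last first.
    by apply/seteqP; split => [x|x []].
  by rewrite product_probabilityE// probability_setT mule1.
have Q2 B : measurable B -> P2 B = (P1 \x P2)%E (snd @^-1` B).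
  move=> mB; rewrite (_ : _ @^-1` _ = setT `*` B); last first.
    by apply/seteqP; split => [x|x []].
  by rewrite product_probabilityE// probability_setT mul1e.
have V0 : 0 <= V by apply: le_trans hV; apply: Rintegral_ge0 => w _; exact: sqr_ge0.
apply: le_trans (sample_pair_test_error Q1 Q2 hV winj measurable_bilinear_test _) _.
  move=> p; rewrite (expect_fubini1 P1 P2 bh).
  rewrite (@eq_Rintegral _ _ _ _ _ (fun=> 0)); last by move=> x _; exact: h2_0.
  by rewrite expect_cst mulr0 subr0 => /le_trans; apply; exact: ler_norm.
rewrite lee_fin ler_pM2r ?invr_gt0 ?exprn_gt0//.
rewrite (_ : 6 * _ * _ * _ = 2 * n%:R * m%:R * V + 4 * n%:R * m%:R * V); last by ring.
rewrite lerD2r ler_wpM2r// ler_wpM2r ?ler0n// -[leLHS]mulr1 ler_wpM2l//.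
by rewrite ler1n (leq_trans m0).
Qed.

Lemma planted_test_error :
  (planted_law PXY (n := n) (m := m) (~` bilinear_test) <=
   ((2 * m%:R * W + 4 * n%:R * m%:R * V) / t ^+ 2)%:E)%E.
Proof.
case/andP: (mn) => m0 lemn.
have c0 := card_injections_gt0 lemn.
have cR : 0 < #|injections n m|%:R :> R by rewrite ltr0n.
have mA : measurable (~` bilinear_test).
  by apply: measurableC; exact: measurable_bilinear_test.
set b := (X in (_ <= X%:E)%E).
have step pi : pi \in injections n m ->
    (planted_law_given PXY pi (~` bilinear_test) <= b%:E)%E.
  rewrite finset.inE => /injectiveP pinj.
  rewrite planted_law_givenE//; apply: sample_pair_test_error => //.
  - by move=> B mB; rewrite -PX.
  - by move=> B mB; rewrite -PY.
  move=> p /negP; rewrite -ltNge => Sp.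
  rewrite distrC (le_trans _ (ler_norm _))// lerBrDr.
  rewrite (_ : m%:R * _ = t + t); last by rewrite /t; field.
  by rewrite lerD2l ltW.
rewrite /planted_law.
apply: (@le_trans _ _ ((#|injections n m|%:R^-1)%:E *
    \sum_(pi in injections n m) b%:E)%E).
  by rewrite lee_wpmul2l ?lee_fin ?invr_ge0 ?(ltW cR)//; apply: lee_sum => pi /step.
rewrite sumEFin -EFinM lee_fin sumr_const -[X in _ * X]mulr_natl mulrA.
by rewrite mulVf ?gt_eqF// mul1r.
Qed.

End bilinear_test.

(** * The bilinear test in the Gaussian model *)

Section normal_facts.
Variable R : realType.
Local Notation mu := (@lebesgue_measure R).
Local Notation N01 := (std_normal R).

Lemma std_normalN A : measurable A -> N01 A = N01 (-%R @^-1` A).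
Proof.
move=> mA.
have mN : measurable (-%R @^-1` A : set R).
  by rewrite -[X in measurable X]setTI; exact: oppr_measurable.
have m1 (B : set R) : measurable B ->
    measurable_fun setT (fun x : R => ((\1_B x)%:E * (normal_pdf 0 1 x)%:E)%E).
  move=> mB; apply: emeasurable_funM; apply/measurable_EFinP.
    exact: measurable_indic.
  exact: measurable_normal_pdf.
have N01E B : measurable B ->
    N01 B = (\int[mu]_x ((\1_B x)%:E * (normal_pdf 0 1 x)%:E))%E.
  move=> mB; rewrite -ge0_integral_normal; last 2 first.
  - exact/measurable_EFinP/measurable_indic.
  - by move=> x; rewrite lee_fin.
  by rewrite integral_indic// setIT.
rewrite !N01E//.
transitivity (\int[pushforward mu (-%R : measurableTypeR R -> measurableTypeR R)]_x
    ((\1_A x)%:E * (normal_pdf 0 1 x)%:E))%E.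
  apply: eq_measure_integral => B mB _.
  exact: (esym (lebesgue_measureN mB)).
rewrite ge0_integral_pushforward//; last 2 first.
- exact: m1.
- by move=> x _; rewrite mule_ge0 ?lee_fin ?normal_pdf_ge0.
by apply: eq_integral => x _ /=; rewrite !normal_pdf01E sqrrN.
Qed.

Lemma expect_odd (phi : R -> R) : bounded_mfun phi ->
  (forall x, phi (- x) = - phi x) -> \int[N01]_x phi x = 0.
Proof.
move=> bphi phiN.
have E : \int[N01]_x phi x = \int[N01]_x phi (- x).
  have mopp : measurable_fun setT (-%R : R -> R) by exact: oppr_measurable.
  exact: (expect_ext mopp std_normalN bphi).
have : \int[N01]_x phi (- x) = - \int[N01]_x phi x.
  rewrite -mulN1r -expectZ//; apply: eq_Rintegral => x _.
  by rewrite phiN mulN1r.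
by rewrite -E; lra.
Qed.

Lemma std_normal_itv_ge (a b r : R) : a < b -> (forall x, a < x < b -> `|x| <= r) ->
  ((normal_pdf 0 1 r * (b - a))%:E <= N01 `]a, b[%classic)%E.
Proof.
move=> ab abr.
have -> : N01 `]a, b[%classic = (\int[mu]_(x in `]a, b[) (normal_pdf 0 1 x)%:E)%E by [].
have -> : ((normal_pdf 0 1 r * (b - a))%:E =
    \int[mu]_(x in `]a, b[) (normal_pdf 0 1 r)%:E)%E.
  by rewrite integral_cst//= lebesgue_measure_itv/= lte_fin ab -EFinB -EFinM.
apply: ge0_le_integral => //.
- by move=> x _; rewrite lee_fin normal_pdf_ge0.
- by apply/measurable_EFinP/measurable_funTS; exact: measurable_normal_pdf.
move=> x; rewrite /= in_itv /= lee_fin => xab.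
rewrite !normal_pdf01E ler_wpM2l ?invr_ge0 ?sqrtr_ge0// ler_expR.
rewrite ler_wpM2r// lerN2 -real_normK ?num_real//.
have r0 : 0 <= r by apply: le_trans (abr _ xab).
by rewrite lerXn2r ?nnegrE// abr.
Qed.

Lemma normal_pdf_gt0 (x : R) : 0 < normal_pdf 0 1 x :> R.
Proof.
by rewrite normal_pdf01E mulr_gt0 ?expR_gt0// invr_gt0 sqrtr_gt0 mulrn_wgt0// pi_gt0.
Qed.

(** The correlated normal pair as a function of two independent standard
    normal variables. *)
Definition corr_map (r : R) (p : R * R) : R * R :=
  (p.1, r * p.1 + Num.sqrt (1 - r ^+ 2) * p.2).

Lemma measurable_corr_map r : measurable_fun setT (corr_map r).
Proof.
apply: measurable_fun_pair; first exact: measurable_fst.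
by apply: measurable_funD; exact: measurable_funM.
Qed.

Lemma bigauss_prob_corr_map r A : `|r| < 1 -> measurable A ->
  bigauss_prob r A = (N01 \x N01)%E (corr_map r @^-1` A).
Proof.
move=> r1 mA.
have mA' : measurable (corr_map r @^-1` A).
  by rewrite -[X in measurable X]setTI; exact: measurable_corr_map.
have m1A : measurable_fun setT (fun p : R * R => (\1_A p)%:E : \bar R).
  exact/measurable_EFinP/measurable_indic.
have m1A' : measurable_fun setT (fun p : R * R => (\1_(corr_map r @^-1` A) p)%:E : \bar R).
  exact/measurable_EFinP/measurable_indic.
transitivity (\int[(N01 \x N01)%E]_p (\1_(corr_map r @^-1` A) p)%:E)%E; last first.
  by rewrite integral_indic// setIT.
rewrite bigauss_prob_density// integral_setE_indic.
have mm : measurable_fun setT (fun z : R * R => (mehler r z.1 z.2)%:E).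
  by apply/measurable_EFinP; exact: measurable_mehler.
rewrite [LHS]fubini_tonelli1; last 2 first.
- exact: emeasurable_funM.
- by move=> z; rewrite mule_ge0 ?lee_fin ?mehler_ge0.
rewrite [RHS]fubini_tonelli1//.
apply: eq_integral => x _; rewrite /fubini_F /=.
rewrite (ge0_integral_mehler x r1 (g := fun y => (\1_A (x, y))%:E))//.
exact: (measurableT_comp m1A (pair1_measurable x)).
Qed.

Lemma expect_bigauss r (g : R * R -> R) : `|r| < 1 -> bounded_mfun g ->
  \int[bigauss_prob r]_p g p =
  \int[N01]_x \int[N01]_z g (x, r * x + Num.sqrt (1 - r ^+ 2) * z).
Proof.
move=> r1 bg.
rewrite (expect_ext (measurable_corr_map r)
  (fun A mA => bigauss_prob_corr_map r1 mA) bg).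
apply: (expect_fubini1 N01 N01 (f := g \o corr_map r)).
by apply: bounded_mfun_comp => //; exact: measurable_corr_map.
Qed.

End normal_facts.

Section coordinate_sum_kernel.
Variables (R : realType) (d : nat) (r : R).
Hypothesis r1 : `|r| < 1.
Hypothesis d0 : (0 < d)%N.
Local Notation N01 := (std_normal R).
Local Notation Nd := (tuple_prob d N01).
Variables (f : R * R -> R) (M v c : R).
Hypothesis mf : measurable_fun setT f.
Hypothesis fM : forall p, `|f p| <= M.
Hypothesis f1_0 : forall y, \int[N01]_x f (x, y) = 0.
Hypothesis f2_0 : forall x, \int[N01]_y f (x, y) = 0.
Hypothesis fv : \int[(N01 \x N01)%E]_p (f p ^+ 2) <= v.
Hypothesis fc : \int[bigauss_prob r]_p f p = c.

Definition coord_sum (p : d.-tuple R * d.-tuple R) : R :=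
  \sum_(a < d) f (tnth p.1 a, tnth p.2 a).

Let bf : bounded_mfun f. Proof. by split => //; exists M. Qed.

Lemma bounded_coord_sum : bounded_mfun coord_sum.
Proof.
apply: bounded_mfun_sum => a; apply: bounded_mfun_comp => //.
apply: measurable_fun_pair.
  exact: (measurableT_comp (measurable_tnth a) measurable_fst).
exact: (measurableT_comp (measurable_tnth a) measurable_snd).
Qed.

Let coord_sum_unzip (w : d.-tuple (R * R)) :
  coord_sum (sample_pair (@id 'I_d) w) = \sum_(a in [set: 'I_d]%SET) f (tnth w a).
Proof.
apply: eq_big => [a|a _]; first by rewrite finset.in_setT.
by rewrite !tnth_mktuple; case: (tnth w a).
Qed.

Lemma coord_sum1_0 y : \int[Nd]_x coord_sum (x, y) = 0.
Proof.
rewrite expect_sum => [|a]; last first.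
  apply: (bounded_mfun_comp (bounded_mfun_section2 bf (tnth y a))).
  exact: measurable_tnth.
rewrite big1// => a _.
by rewrite (expect_tnth N01 a (bounded_mfun_section2 bf (tnth y a))).
Qed.

Lemma coord_sum2_0 x : \int[Nd]_y coord_sum (x, y) = 0.
Proof.
rewrite expect_sum => [|a]; last first.
  apply: (bounded_mfun_comp (bounded_mfun_section1 bf (tnth x a))).
  exact: measurable_tnth.
rewrite big1// => a _.
by rewrite (expect_tnth N01 a (bounded_mfun_section1 bf (tnth x a))).
Qed.

Lemma expect_coord_sum_sqr_null :
  \int[(Nd \x Nd)%E]_p (coord_sum p ^+ 2) <= d%:R * v.
Proof.
have ext (A : set (d.-tuple R * d.-tuple R)) : measurable A -> (Nd \x Nd)%E A =
    tuple_prob d (N01 \x N01)%E (sample_pair (@id 'I_d) @^-1` A).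
  by move=> mA; exact: product_tuple_probE.
have bc := bounded_coord_sum.
rewrite (expect_ext (measurable_sample_pair (@id 'I_d)) ext (bounded_mfunM bc bc)).
rewrite (@eq_Rintegral _ _ _ _ _ (fun w : d.-tuple (R * R) =>
  (\sum_(a in [set: 'I_d]%SET) f (tnth w a)) ^+ 2)); last first.
  by move=> w _; rewrite coord_sum_unzip.
rewrite (expect_sqr_sum_iid [set: 'I_d]%SET bf).
  by rewrite cardsT card_ord ler_wpM2l.
rewrite (expect_fubini1 N01 N01 bf) (@eq_Rintegral _ _ _ _ _ (fun=> 0)).
  exact: expect_cst.
by move=> x _; exact: f2_0.
Qed.

Let ext A : measurable A -> gaussian_pair_law d r A =
  tuple_prob d (bigauss_prob r) (sample_pair (@id 'I_d) @^-1` A).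
Proof. by []. Qed.

Lemma expect_coord_sum : \int[gaussian_pair_law d r]_p coord_sum p = d%:R * c.
Proof.
rewrite (expect_ext (measurable_sample_pair (@id 'I_d)) ext bounded_coord_sum).
rewrite (@eq_Rintegral _ _ _ _ _ (fun w : d.-tuple (R * R) =>
  \sum_(a in [set: 'I_d]%SET) f (tnth w a))); last first.
  by move=> w _; rewrite coord_sum_unzip.
rewrite expect_sum => [|a]; last first.
  by apply: bounded_mfun_comp bf _; exact: measurable_tnth.
under eq_bigr => a _ do rewrite (expect_tnth (bigauss_prob r) a bf) fc.
by rewrite sumr_const cardsT card_ord mulr_natl.
Qed.

(** The variance is linear in [d] and the squared mean is quadratic, since the
    coordinates are independent under the pair law as well. *)
Lemma expect_coord_sum_sqr : \int[gaussian_pair_law d r]_p (coord_sum p ^+ 2) <=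
  2 * d%:R * M ^+ 2 + 2 * d%:R ^+ 2 * c ^+ 2.
Proof.
have bc := bounded_coord_sum.
have bcst := @bounded_mfun_cst.
rewrite (expect_ext (measurable_sample_pair (@id 'I_d)) ext (bounded_mfunM bc bc)).
pose u (p : R * R) := f p - c.
have bu : bounded_mfun u by apply: bounded_mfunB.
pose S (w : d.-tuple (R * R)) := \sum_(a in [set: 'I_d]%SET) u (tnth w a).
have bS : bounded_mfun S.
  by apply: bounded_mfun_sum => a; apply: bounded_mfun_comp bu _; exact: measurable_tnth.
have bS2 : bounded_mfun (fun w => 2 * S w ^+ 2).
  by apply: bounded_mfunM => //; exact: bounded_mfunM.
apply: (@le_trans _ _ (\int[tuple_prob d (bigauss_prob r)]_w
    (2 * S w ^+ 2 + 2 * (d%:R * c) ^+ 2))).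
  apply: expect_le; [|exact: bounded_mfunD|].
    apply: (bounded_mfun_comp (bounded_mfunM bc bc)).
    exact: (measurable_sample_pair (@id 'I_d)).
  move=> w; rewrite coord_sum_unzip.
  have -> : \sum_(a in [set: 'I_d]%SET) f (tnth w a) = S w + d%:R * c.
    by rewrite /S sumrB sumr_const cardsT card_ord -[c *+ d]mulr_natl subrK.
  rewrite -subr_ge0 (_ : _ - _ = (S w - d%:R * c) ^+ 2) ?sqr_ge0//; ring.
rewrite expectD// expect_cst expectZ; last exact: bounded_mfunM.
rewrite (expect_sqr_sum_iid [set: 'I_d]%SET bu); last first.
  by rewrite expectB// expect_cst fc subrr.
rewrite cardsT card_ord.
have Eu : \int[bigauss_prob r]_w (u w ^+ 2) <= M ^+ 2.
  have -> : \int[bigauss_prob r]_w (u w ^+ 2) =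
      \int[bigauss_prob r]_w (f w ^+ 2) - c ^+ 2.
    transitivity (\int[bigauss_prob r]_w (f w ^+ 2 - (2 * c * f w - c ^+ 2))).
      by apply: eq_Rintegral => w _; rewrite /u; ring.
    rewrite expectB; [|exact: bounded_mfunM|]; last first.
      by apply: bounded_mfunB => //; exact: bounded_mfunM.
    rewrite expectB//; last exact: bounded_mfunM.
    by rewrite expectZ// expect_cst fc; ring.
  apply: (@le_trans _ _ (\int[bigauss_prob r]_w (f w ^+ 2))).
    by rewrite lerBlDr lerDl sqr_ge0.
  rewrite -[leRHS](expect_cst (bigauss_prob r)); apply: expect_le => //.
    exact: bounded_mfunM.
  move=> p; rewrite -real_normK ?num_real// lerXn2r ?nnegrE//.
  exact: le_trans (fM p).
have -> : 2 * d%:R * M ^+ 2 + 2 * d%:R ^+ 2 * c ^+ 2 =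
    2 * (d%:R * M ^+ 2) + 2 * (d%:R * c) ^+ 2 by ring.
by rewrite lerD2r ler_wpM2l// ler_wpM2l.
Qed.

(** With [h] the coordinate sum of [f], the mean of the statistic is
    [m * (d * c)] and its variance is of order [n * m * (d * v)], up to
    the contribution of the matched pairs. *)
Lemma gaussian_test n m : (0 < m <= n)%N -> 0 < c ->
  exists A, [/\ measurable A,
    (null_law (gaussian_pair_law d r) n m A <=
      (24 * (n%:R / m%:R) * (v / (d%:R * c ^+ 2)))%:E)%E &
    (planted_law (gaussian_pair_law d r) (n := n) (m := m) (~` A) <=
      (16 / m%:R * (M ^+ 2 / (d%:R * c ^+ 2) + 1) +
       16 * (n%:R / m%:R) * (v / (d%:R * c ^+ 2)))%:E)%E].
Proof.
move=> mn c0.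
have dR : 0 < d%:R :> R by rewrite ltr0n.
have mR : 0 < m%:R :> R by case/andP: mn => m0 _; rewrite ltr0n.
have dens := fun A mA => @gaussian_pair_law_density R d r A r1 mA.
have PX A : measurable A -> marginalX (gaussian_pair_law d r) A = Nd A.
  apply: (density_marginalX (l := @mehler_tuple R d r)) => //.
  - exact: measurable_mehler_tuple.
  - by move=> *; exact: mehler_tuple_ge0.
  - by move=> x; exact: integral_mehler_tuple.
have PY A : measurable A -> marginalY (gaussian_pair_law d r) A = Nd A.
  apply: (density_marginalY (l := @mehler_tuple R d r)) => //.
  - exact: measurable_mehler_tuple.
  - by move=> *; exact: mehler_tuple_ge0.
  - move=> y; under eq_integral do rewrite mehler_tupleC.
    exact: integral_mehler_tuple.
have mu0 : 0 < \int[gaussian_pair_law d r]_p coord_sum p.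
  by rewrite expect_coord_sum mulr_gt0.
exists (@bilinear_test _ _ _ _ _ (gaussian_pair_law d r) coord_sum n m); split.
- apply: measurable_bilinear_test; exact: bounded_coord_sum.
- apply: le_trans (null_test_error PX PY bounded_coord_sum coord_sum1_0
    coord_sum2_0 expect_coord_sum_sqr_null mu0 mn) _.
  rewrite expect_coord_sum lee_fin le_eqVlt; apply/orP; left; apply/eqP.
  by field; rewrite !gt_eqF.
- apply: le_trans (planted_test_error PX PY bounded_coord_sum coord_sum1_0
    coord_sum2_0 expect_coord_sum_sqr_null expect_coord_sum_sqr mu0 mn) _.
  rewrite expect_coord_sum lee_fin le_eqVlt; apply/orP; left; apply/eqP.
  by field; rewrite !gt_eqF.
Qed.

End coordinate_sum_kernel.

Section odd_kernel.
Variables (R : realType) (K : nat) (phi : 'I_K -> R -> R).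
Local Notation N01 := (std_normal R).
Hypothesis bphi : forall b, bounded_mfun (phi b).
Hypothesis phiN : forall b x, phi b (- x) = - phi b x.
Hypothesis phi_disj : forall b b' x, b != b' -> phi b x * phi b' x = 0.
Hypothesis phi2 : forall b, \int[N01]_x (phi b x ^+ 2) <= 1.

(** Oddness makes the mean in each argument zero. When the functions have
    disjoint supports, the second moment under independence is a sum over
    [b], hence at most [K], whereas a strong correlation may raise the
    mean to nearly [K]. *)
Definition odd_kernel (p : R * R) : R := \sum_(b < K) phi b p.1 * phi b p.2.

Let bp1 b : bounded_mfun (fun p : R * R => phi b p.1).
Proof. by apply: bounded_mfun_comp (bphi b) _; exact: measurable_fst. Qed.

Let bp2 b : bounded_mfun (fun p : R * R => phi b p.2).
Proof. by apply: bounded_mfun_comp (bphi b) _; exact: measurable_snd. Qed.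

Lemma bounded_odd_kernel : bounded_mfun odd_kernel.
Proof. by apply: bounded_mfun_sum => b; exact: bounded_mfunM. Qed.

Lemma odd_kernel1_0 y : \int[N01]_x odd_kernel (x, y) = 0.
Proof.
apply: expect_odd; first exact: bounded_mfun_section2 bounded_odd_kernel _.
move=> x; rewrite /odd_kernel -sumrN; apply: eq_bigr => b _ /=.
by rewrite phiN mulNr.
Qed.

Lemma odd_kernel2_0 x : \int[N01]_y odd_kernel (x, y) = 0.
Proof.
apply: expect_odd; first exact: bounded_mfun_section1 bounded_odd_kernel _.
move=> y; rewrite /odd_kernel -sumrN; apply: eq_bigr => b _ /=.
by rewrite phiN mulrN.
Qed.

Lemma expect_odd_kernel_sqr :
  \int[(N01 \x N01)%E]_p (odd_kernel p ^+ 2) <= K%:R.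
Proof.
have sqrE p : odd_kernel p ^+ 2 = \sum_(b < K) (phi b p.1 ^+ 2 * phi b p.2 ^+ 2).
  rewrite expr2 /odd_kernel mulr_suml; apply: eq_bigr => b _.
  rewrite mulr_sumr (bigD1 b)//= big1 ?addr0; first by ring.
  move=> b' b'b; rewrite mulrACA phi_disj ?mul0r// eq_sym//.
rewrite (@eq_Rintegral _ _ _ _ _
  (fun p => \sum_(b < K) (phi b p.1 ^+ 2 * phi b p.2 ^+ 2))); last first.
  by move=> p _; exact: sqrE.
have bb b : bounded_mfun (fun p : R * R => phi b p.1 ^+ 2 * phi b p.2 ^+ 2).
  by apply: bounded_mfunM; exact: bounded_mfunM.
rewrite expect_sum// -[K in leRHS]card_ord -sum1_card natr_sum.
apply: ler_sum => b _; rewrite (expect_fubini1 N01 N01 (bb b)) /=.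
have b2 : bounded_mfun (fun x => phi b x ^+ 2) by exact: bounded_mfunM.
have E0 : 0 <= \int[N01]_x (phi b x ^+ 2) by apply: Rintegral_ge0 => x _; exact: sqr_ge0.
rewrite (@eq_Rintegral _ _ _ _ _
    (fun x => \int[N01]_y (phi b y ^+ 2) * phi b x ^+ 2)).
  by rewrite expectZ// mulr_ile1.
by move=> x _; rewrite expectZ// mulrC.
Qed.

Lemma expect_odd_kernel_bigauss r : `|r| < 1 ->
  \int[bigauss_prob r]_p odd_kernel p = \sum_(b < K)
  \int[N01]_x \int[N01]_z (phi b x * phi b (r * x + Num.sqrt (1 - r ^+ 2) * z)).
Proof.
move=> r1; rewrite expect_sum; last by move=> b; exact: bounded_mfunM.
apply: eq_bigr => b _.
by rewrite (expect_bigauss r1 (bounded_mfunM (bp1 b) (bp2 b))).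
Qed.

End odd_kernel.

(** * Sufficient condition for strong detection *)

(** The ratio [n / m] stays below [2 / alpha], so that the errors in
    [gaussian_test] are small once [K / (d * c ^+ 2)] is small and [n] is
    large compared with [M ^+ 2 / (d * c ^+ 2)]. *)
Lemma gaussian_detection_sufficient (R : realType) (alpha : R) (dim : nat -> nat)
    (rho : nat -> R) :
  0 < alpha <= 1 -> (forall n, 0 < rho n < 1) ->
  (forall e : R, 0 < e -> exists L : R, 0 <= L /\ \forall n \near \oo, (0 < dim n)%N /\
     exists K (phi : 'I_K -> R -> R) (M : R),
     [/\ (forall b, bounded_mfun (phi b)) /\ (forall b x, phi b (- x) = - phi b x),
         forall b b' x, b != b' -> phi b x * phi b' x = 0,
         forall b, \int[std_normal R]_x (phi b x ^+ 2) <= 1,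
         forall p, `|odd_kernel phi p| <= M &
         let c := \int[bigauss_prob (rho n)]_p odd_kernel phi p in
         [/\ 0 < c, K%:R <= e * ((dim n)%:R * c ^+ 2) &
                    M ^+ 2 <= L * ((dim n)%:R * c ^+ 2)]]) ->
  gaussian_strong_detection alpha dim rho.
Proof.
move=> /andP[a0 a1] hrho H; apply/gaussian_strong_detectionP => e e0.
pose e' := alpha * e / 200.
have e'0 : 0 < e' by rewrite divr_gt0// mulr_gt0.
have [L [L0 HL]] := H _ e'0.
apply: filterS3 HL (nbhs_infty_ger (2 / alpha))
  (nbhs_infty_ger (64 * (L + 1) / (alpha * e))) => n.
move=> [dn [K [phi [M [[bphi phiN] phiD phi2 kM [c0 cK cM]]]]]] n2 nL.
set c := \int[_]_p _ in c0 cK cM.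
set m := Num.truncn (alpha * n%:R).
have an0 : 0 <= alpha * n%:R by rewrite mulr_ge0// ltW.
have /andP[_ mlt] := truncn_itv an0.
have an2 : 2 <= alpha * n%:R by rewrite mulrC -ler_pdivrMr.
have mge : alpha * n%:R / 2 <= m%:R.
  by move: mlt; rewrite -/m -natr1 => mlt; lra.
have mn : (0 < m <= n)%N.
  rewrite -(ltr0n R) (lt_le_trans _ mge)/=; last by lra.
  by rewrite -[leqRHS](@natrK R) le_truncn// ler_piMl.
have m0 : 0 < m%:R :> R by rewrite ltr0n; case/andP: mn.
have r1 : `|rho n| < 1 by have /andP[r0 ?] := hrho n; rewrite gtr0_norm.
have D0 : 0 < (dim n)%:R * c ^+ 2 by rewrite mulr_gt0 ?exprn_gt0// ltr0n.
have nm : n%:R / m%:R <= 2 / alpha.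
  by rewrite ler_pdivrMr// mulrAC ler_pdivlMr//; lra.
have X1 : K%:R / ((dim n)%:R * c ^+ 2) <= e' by rewrite ler_pdivrMr.
have X2 : M ^+ 2 / ((dim n)%:R * c ^+ 2) <= L by rewrite ler_pdivrMr.
have X3 : (n%:R / m%:R) * (K%:R / ((dim n)%:R * c ^+ 2)) <= e / 100.
  apply: (@le_trans _ _ (2 / alpha * e')).
    by rewrite ler_pM// divr_ge0// ltW.
  by rewrite le_eqVlt; apply/orP; left; apply/eqP; rewrite /e'; field; rewrite gt_eqF.
have X4 : 16 / m%:R * (M ^+ 2 / ((dim n)%:R * c ^+ 2) + 1) <= e / 2.
  apply: (@le_trans _ _ (16 / m%:R * (L + 1))).
    by rewrite ler_wpM2l ?divr_ge0 ?lerD2r// ltW.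
  rewrite mulrAC ler_pdivrMr//.
  apply: (@le_trans _ _ (e / 2 * (alpha * n%:R / 2))); last first.
    by rewrite ler_wpM2l// divr_ge0// ltW.
  move: nL; rewrite ler_pdivrMr ?mulr_gt0// => nL.
  by lra.
have [A [mA A0 A1]] := gaussian_test r1 dn (proj1 (bounded_odd_kernel bphi)) kM
  (odd_kernel1_0 bphi phiN) (odd_kernel2_0 bphi phiN)
  (expect_odd_kernel_sqr bphi phiD phi2) (erefl c) mn c0.
exists A; split => //.
- apply: le_lt_trans A0 _; rewrite lte_fin -mulrA; lra.
- apply: le_lt_trans A1 _; rewrite lte_fin -[16 * _ * _]mulrA; lra.
Qed.

(** * The necessary conditions *)

Section necessity.
Variables (R : realType) (rho : nat -> R).
Hypothesis hrho : forall n, 0 < rho n < 1.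

Let onem_gt0 n : 0 < 1 - rho n ^+ 2.
Proof. by have /andP[r0 r1] := hrho n; rewrite onemX2_gt0// gtr0_norm. Qed.

Lemma cvg_corr_fixed_dim (d : nat) :
  (forall N : nat, \forall n \near \oo, N%:R < (1 - rho n ^+ 2) ^- d) ->
  rho n ^+ 2 @[n --> \oo] --> (1 : R).
Proof.
move=> H; apply/cvgrPdist_lt => e e0.
have := H (Num.truncn (e ^- d)).+1; apply: filterS => n.
rewrite ger0_norm ?ltW//; apply: contraTT; rewrite -!leNgt => er.
apply: (@le_trans _ _ (e ^- d)).
  by rewrite lef_pV2 ?posrE ?exprn_gt0// lerXn2r ?nnegrE// ltW.
by rewrite ltW// real_truncnS_gt// num_real.
Qed.

(** If [rho n ^+ 2 * d n <= A] with [d n] large, then [rho n ^+ 2 <= 1 / 2],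
    where [(1 - q)^-1 <= expR (2 * q)], and [(1 - rho n ^+ 2) ^- d n] is
    at most [expR (2 * A)]. *)
Lemma cvg_corr_growing_dim (d : nat -> nat) : d n @[n --> \oo] --> \oo ->
  (forall N : nat, \forall n \near \oo, N%:R < (1 - rho n ^+ 2) ^- d n) ->
  rho n ^+ 2 * (d n)%:R @[n --> \oo] --> +oo.
Proof.
move=> dy H; apply/cvgryPge => A0.
pose A := Num.max A0 1.
have A1 : 1 <= A by rewrite le_max lexx orbT.
have dA : \forall n \near \oo, 2 * A <= (d n)%:R.
  have /cvgnyPge := dy => /(_ (Num.truncn (2 * A)).+1); apply: filterS => n.
  rewrite -(ler_nat R); apply: le_trans.
  by rewrite ltW// real_truncnS_gt// num_real.
have := H (Num.truncn (expR (2 * A))).+1; apply: filterS2 dA => n dA.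
apply: contraTT; rewrite -leNgt -ltNge => qd.
have {}qd : rho n ^+ 2 * (d n)%:R <= A by rewrite (le_trans (ltW qd))// le_max lexx.
set q := rho n ^+ 2 in qd *.
have q0 : 0 <= q by exact: sqr_ge0.
have q2 : q <= 2^-1.
  rewrite -(ler_pM2r (_ : 0 < 2 * A)); last by lra.
  by apply: le_trans (ler_wpM2l q0 dA) _; lra.
have qe : (1 - q)^-1 <= expR (2 * q).
  apply: le_trans (expR_ge1Dx _); rewrite -[leLHS]mul1r ler_pdivrMr; last by lra.
  have : 0 <= q * (1 - 2 * q) by rewrite mulr_ge0//; lra.
  by lra.
apply: (@le_trans _ _ (expR (2 * A))); last first.
  by rewrite ltW// real_truncnS_gt// num_real.
rewrite -exprVn; apply: (@le_trans _ _ (expR (2 * q) ^+ d n)).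
  by rewrite lerXn2r ?nnegrE ?expR_ge0// invr_ge0; lra.
by rewrite -expRM_natr ler_expR; lra.
Qed.

End necessity.

(** * The sign kernel *)

Section sign_kernel.
Variable R : realType.
Local Notation N01 := (std_normal R).

Lemma measurable_sgr : measurable_fun setT (Num.sg : R -> R).
Proof.
rewrite (_ : Num.sg = fun x : R => if x < 0 then -1 else if 0 < x then 1 else 0).
  apply: measurable_fun_ifT => //; first exact: measurable_fun_ltr.
  by apply: measurable_fun_ifT => //; exact: measurable_fun_ltr.
by apply/funext => x; case: sgrP.
Qed.

Lemma bounded_sgr : bounded_mfun (Num.sg : R -> R).
Proof.
split; first exact: measurable_sgr.
by exists 1 => x; rewrite normr_sg; case: (x != 0).
Qed.

Definition sign_corr_const : R :=
  2 * normal_pdf 0 1 1 * fine (N01 `]1, 2[%classic).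

Lemma sign_corr_const_gt0 : 0 < sign_corr_const.
Proof.
rewrite /sign_corr_const !mulr_gt0 ?normal_pdf_gt0//.
rewrite -lte_fin fineK ?fin_num_measure//.
apply: (lt_le_trans _ (@std_normal_itv_ge R 1 2 2 _ _)).
- by rewrite lte_fin mulr_gt0 ?normal_pdf_gt0//; lra.
- by lra.
- by move=> x /andP[x1 x2]; rewrite ler_norml; apply/andP; split; lra.
Qed.

(** When [`|b| < `|a|], both [a + b] and [a - b] have the sign of [a];
    otherwise at least one of them has it, unless [a = 0]. *)
Lemma sg_add_sub_ge (a b : R) :
  (if `|b| < `|a| then 1 else 0) <= Num.sg a * (2^-1 * (Num.sg (a + b) + Num.sg (a - b))).
Proof.
have [ba|ab] := ltP `|b| `|a|.
  have [a0|a0|a0] := ltgtP a 0; last by rewrite a0 normr0 normr_lt0 in ba.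
  - move: ba; rewrite (ltr0_norm a0) ltr_norml opprK => /andP[b1 b2].
    by rewrite (ltr0_sg a0) !ltr0_sg; lra.
  - move: ba; rewrite (gtr0_norm a0) ltr_norml => /andP[b1 b2].
    by rewrite (gtr0_sg a0) !gtr0_sg; lra.
have [a0|a0|->] := ltgtP a 0; last by rewrite sgr0 mul0r.
- rewrite (ltr0_sg a0); move: ab; rewrite (ltr0_norm a0) => ab.
  have [b0|b0|b0] := ltgtP b 0; last by rewrite b0 normr0 in ab; lra.
    rewrite (ltr0_norm b0) in ab; rewrite (ltr0_sg (_ : a + b < 0)); last by lra.
    by case: (sgrP (a - b)) => ?; lra.
  rewrite (gtr0_norm b0) in ab; rewrite (ltr0_sg (_ : a - b < 0)); last by lra.
  by case: (sgrP (a + b)) => ?; lra.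
- rewrite (gtr0_sg a0); move: ab; rewrite (gtr0_norm a0) => ab.
  have [b0|b0|b0] := ltgtP b 0; last by rewrite b0 normr0 in ab; lra.
    rewrite (ltr0_norm b0) in ab; rewrite [Num.sg (a - b)]gtr0_sg; last by lra.
    by case: (sgrP (a + b)) => ?; lra.
  rewrite (gtr0_norm b0) in ab; rewrite [Num.sg (a + b)]gtr0_sg; last by lra.
  by case: (sgrP (a - b)) => ?; lra.
Qed.

(** Averaging the integrand over [z] and [- z] makes it non-negative, and
    equal to 1 when [1 < x < 2] and [`|z| < r]. This event has probability
    at least [sign_corr_const * r], because the normal density is at least
    [normal_pdf 0 1 1] on [[-1, 1]]. *)
Lemma sign_corr_ge (r : R) : 0 < r < 1 ->
  sign_corr_const * r <=
  \int[N01]_x \int[N01]_z (Num.sg x * Num.sg (r * x + Num.sqrt (1 - r ^+ 2) * z)).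
Proof.
move=> /andP[r0 r1].
set s := Num.sqrt (1 - r ^+ 2).
have s0 : 0 <= s by exact: sqrtr_ge0.
have s1 : s <= 1.
  by rewrite -[leRHS]sqrtr1 ler_wsqrtr// lerBlDr lerDl sqr_ge0.
have maff (k : R) x : measurable_fun setT (fun z : R => r * x + k * z).
  by apply: measurable_funD => //; exact: measurable_funM.
have bs (k : R) x : bounded_mfun (fun z : R => Num.sg (r * x + k * z)).
  exact: bounded_mfun_comp bounded_sgr (maff k x).
have sym x : \int[N01]_z Num.sg (r * x + s * z) =
    \int[N01]_z (2^-1 * (Num.sg (r * x + s * z) + Num.sg (r * x - s * z))).
  have bs' : bounded_mfun (fun z : R => Num.sg (r * x - s * z)).
    by have := bs (- s) x; under eq_fun do rewrite mulNr.
  rewrite expectZ ?expectD//; last exact: bounded_mfunD.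
  have mopp : measurable_fun setT (-%R : R -> R) by exact: oppr_measurable.
  have -> : \int[N01]_z Num.sg (r * x - s * z) = \int[N01]_z Num.sg (r * x + s * z).
    rewrite (expect_ext mopp (@std_normalN R) bs'); apply: eq_Rintegral => z _.
    by rewrite mulrN opprK.
  lra.
pose g (p : R * R) := Num.sg p.1 *
  (2^-1 * (Num.sg (r * p.1 + s * p.2) + Num.sg (r * p.1 - s * p.2))).
pose k (p : R * R) : R := \1_(`]1, 2[%classic) p.1 * \1_(`]-r, r[%classic) p.2.
have maff2 (t : R) : measurable_fun setT (fun p : R * R => r * p.1 + t * p.2).
  by apply: measurable_funD; exact: measurable_funM.
have bs2 (t : R) : bounded_mfun (fun p : R * R => Num.sg (r * p.1 + t * p.2)).
  exact: bounded_mfun_comp bounded_sgr (maff2 t).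
have bs2' : bounded_mfun (fun p : R * R => Num.sg (r * p.1 - s * p.2)).
  by have := bs2 (- s); under eq_fun do rewrite mulNr.
have bg : bounded_mfun g.
  apply: bounded_mfunM.
    by apply: bounded_mfun_comp bounded_sgr _; exact: measurable_fst.
  apply: bounded_mfunM; first exact: bounded_mfun_cst.
  exact: bounded_mfunD.
have bA : bounded_mfun (\1_(`]1, 2[%classic) : R -> R) by exact: bounded_mfun_indic.
have bB : bounded_mfun (\1_(`]-r, r[%classic) : R -> R) by exact: bounded_mfun_indic.
have bk : bounded_mfun k.
  apply: bounded_mfunM; [apply: bounded_mfun_comp bA _|apply: bounded_mfun_comp bB _].
    exact: measurable_fst.
  exact: measurable_snd.
have kg p : k p <= g p.
  rewrite /k /g !indicE.
  have sgr_x : Num.sg p.1 = Num.sg (r * p.1) by rewrite sgrM (gtr0_sg r0) mul1r.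
  rewrite sgr_x; apply: le_trans (sg_add_sub_ge _ _).
  have [|_] := boolP (p.1 \in _); last by rewrite mul0r; case: ifP.
  have [|_] := boolP (p.2 \in _); last by rewrite mulr0; case: ifP.
  rewrite !inE /= !in_itv /= => /andP[z1 z2] /andP[x1 x2].
  rewrite mul1r ifT//; rewrite !normrM (ger0_norm s0) (gtr0_norm r0).
  have zr : `|p.2| < r by rewrite ltr_norml z1.
  rewrite (gtr0_norm (_ : 0 < p.1)); last by lra.
  apply: (@le_lt_trans _ _ `|p.2|); first by rewrite ler_piMl.
  apply: lt_trans zr _; rewrite -[ltLHS]mulr1 ltr_pM2l//.
have -> : \int[N01]_x \int[N01]_z (Num.sg x * Num.sg (r * x + s * z)) =
    \int[(N01 \x N01)%E]_p g p.
  rewrite (expect_fubini1 N01 N01 bg); apply: eq_Rintegral => x _.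
  rewrite expectZ// sym -expectZ//; apply: bounded_mfunM.
    exact: bounded_mfun_cst.
  apply: bounded_mfunD => //.
  by have := bs (- s) x; under eq_fun do rewrite mulNr.
apply: le_trans (expect_le (N01 \x N01)%E bk bg kg).
rewrite (expect_fubini1 N01 N01 bk) /k /=.
have NA (A : set R) : measurable A -> \int[N01]_x \1_A x = fine (N01 A).
  by move=> mA; rewrite -expect_indic.
rewrite (@eq_Rintegral _ _ _ _ _
  (fun x : R => fine (N01 `]-r, r[%classic) * \1_(`]1, 2[%classic) x)); last first.
  by move=> x _; rewrite expectZ// NA// mulrC.
rewrite expectZ// NA//.
have Br : normal_pdf 0 1 1 * (r - - r) <= fine (N01 `]-r, r[%classic).
  rewrite -lee_fin fineK ?fin_num_measure//; apply: std_normal_itv_ge.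
    by lra.
  by move=> x /andP[x1 x2]; rewrite ler_norml; apply/andP; split; lra.
have N0 : 0 <= fine (N01 `]1, 2[%classic) by exact/fine_ge0/measure_ge0.
rewrite /sign_corr_const mulrAC ler_wpM2r//.
by move: Br; lra.
Qed.

End sign_kernel.

(** With the sign as the only function of [odd_kernel], the mean [c] is at
    least a constant times [rho n], so that [d * c ^+ 2] tends to
    infinity. *)
Lemma gaussian_detection_growing_dim (R : realType) (alpha : R) (d : nat -> nat)
    (rho : nat -> R) : 0 < alpha <= 1 -> (forall n, 0 < rho n < 1) ->
  rho n ^+ 2 * (d n)%:R @[n --> \oo] --> +oo ->
  gaussian_strong_detection alpha d rho.
Proof.
move=> halpha hrho /cvgryPge qd; apply: gaussian_detection_sufficient => // e e0.
pose c0 := sign_corr_const R.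
have c00 : 0 < c0 by exact: sign_corr_const_gt0.
exists e; split; first exact: ltW.
apply: filterS2 (qd (e * c0 ^+ 2)^-1) (qd 1) => n qdn qd1.
have r01 := hrho n; have /andP[r0 r1] := r01.
have dn : (0 < d n)%N.
  by rewrite lt0n; apply/eqP => dn; move: qd1; rewrite dn mulr0 ler10.
have rn : `|rho n| < 1 by rewrite gtr0_norm.
split => //; exists 1%N, (fun=> Num.sg), 1.
have bphi : forall b : 'I_1, bounded_mfun (Num.sg : R -> R).
  by move=> _; exact: bounded_sgr.
have cE : c0 * rho n <= \int[bigauss_prob (rho n)]_p odd_kernel (fun _ : 'I_1 => Num.sg) p.
  by rewrite (expect_odd_kernel_bigauss bphi rn) big_ord1; exact: sign_corr_ge.
have sq1 (x : R) : Num.sg x ^+ 2 <= 1.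
  by rewrite -real_normK ?num_real// normr_sg; case: (x != 0); rewrite ?expr1n ?expr0n.
set c := \int[_]_p _ in cE *.
have cc : 0 < c by apply: lt_le_trans cE; rewrite mulr_gt0.
have main : 1 <= e * ((d n)%:R * c ^+ 2).
  have c2 : (c0 * rho n) ^+ 2 <= c ^+ 2.
    by rewrite lerXn2r ?nnegrE// ltW// mulr_gt0.
  apply: (@le_trans _ _ (e * ((d n)%:R * (c0 * rho n) ^+ 2))).
    have -> : e * ((d n)%:R * (c0 * rho n) ^+ 2) =
      (e * c0 ^+ 2) * (rho n ^+ 2 * (d n)%:R) by ring.
    by rewrite -ler_pdivrMl ?mulr1// mulr_gt0// exprn_gt0.
  by rewrite !ler_wpM2l// ltW.
split => //.
- by split => // _ x; rewrite sgrN.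
- by move=> b b' x; rewrite (ord1 b) (ord1 b') eqxx.
- move=> _; rewrite -[leRHS](expect_cst (std_normal R)); apply: expect_le => //.
    by apply: bounded_mfunM; exact: bounded_sgr.
  exact: bounded_mfun_cst.
- move=> p; rewrite /odd_kernel big_ord1 normrM !normr_sg.
  by case: (_ != 0); case: (_ != 0); rewrite ?mulr0 ?mul0r ?mulr1.
- by split => //; rewrite expr1n.
Qed.

(** * The shell kernel *)

Lemma expect_cvg d (T : measurableType d) (R : realType) (P : probability T R)
    (F_ : nat -> T -> R) (F : T -> R) (M : R) :
  (forall n, measurable_fun setT (F_ n)) -> (forall n x, `|F_ n x| <= M) ->
  bounded_mfun F -> (forall x, F_ n x @[n --> \oo] --> F x) ->
  \int[P]_x F_ n x @[n --> \oo] --> \int[P]_x F x.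
Proof.
move=> mF_ FM bF FF.
have iM : P.-integrable setT (fun=> M%:E).
  exact: (bounded_mfun_integrable P (bounded_mfun_cst _ M)).
have mF' n : measurable_fun setT (fun x => (F_ n x)%:E).
  by apply/measurable_EFinP; exact: mF_.
have mF : measurable_fun setT (fun x => (F x)%:E).
  by apply/measurable_EFinP; case: bF.
have aeF : {ae P, forall x, setT x -> (F_ n x)%:E @[n --> \oo] --> (F x)%:E}.
  apply: aeW => x _; apply: cvg_EFin; first exact: nearW.
  exact: FF.
have aeM : {ae P, forall x n, setT x -> (`|(F_ n x)%:E| <= M%:E)%E}.
  by apply: aeW => x n _; rewrite /= lee_fin.
have [_ _ cv] := dominated_convergence measurableT mF' mF aeF iM aeM.
rewrite expectE// in cv.
exact: (fine_cvg cv).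
Qed.

Section shell_kernel.
Variable R : realType.
Local Notation N01 := (std_normal R).

(** The shells are open, so that [shell b x * shell b y] is continuous in [y]
    at [y = x] for every [x], including the boundary points, where the
    first factor vanishes. *)
Definition shell (b : nat) (x : R) : R :=
  if (b%:R < `|x|) && (`|x| < b.+1%:R) then Num.sg x else 0.

Lemma shellN b x : shell b (- x) = - shell b x.
Proof. by rewrite /shell normrN sgrN; case: ifP; rewrite ?oppr0. Qed.

Lemma shell_disj b b' x : b != b' -> shell b x * shell b' x = 0.
Proof.
move=> bb'; rewrite /shell; case: ifP => [/andP[x1 x2]|]; last by rewrite mul0r.
case: ifP => [/andP[x3 x4]|]; last by rewrite mulr0.
have := lt_trans x1 x4; have := lt_trans x3 x2; rewrite !ltr_nat !ltnS => h1 h2.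
by move: bb'; rewrite eqn_leq h1 h2.
Qed.

Lemma shell_le1 b x : `|shell b x| <= 1.
Proof.
by rewrite /shell; case: ifP; rewrite ?normr0 // normr_sg; case: (x != 0).
Qed.

Lemma measurable_shell b : measurable_fun setT (shell b).
Proof.
apply: measurable_fun_ifT => //; last exact: measurable_sgr.
by apply: measurable_and; apply: measurable_fun_ltr => //; exact: measurableT_comp.
Qed.

Lemma bounded_shell b : bounded_mfun (shell b).
Proof. by split; [exact: measurable_shell|exists 1; exact: shell_le1]. Qed.

Definition shell_mass b := \int[N01]_x (shell b x ^+ 2).

Lemma shell_mass_gt0 b : 0 < shell_mass b.
Proof.
have bs := bounded_shell b.
pose A : set R := `]b%:R, b.+1%:R[%classic.
have mA : measurable A by exact: measurable_itv.
have bA : bounded_mfun (\1_A : R -> R) by exact: bounded_mfun_indic.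
apply: (@lt_le_trans _ _ (\int[N01]_x \1_A x)).
  rewrite -lte_fin expect_indic//.
  apply: (lt_le_trans _ (@std_normal_itv_ge R b%:R b.+1%:R b.+1%:R _ _)).
  - by rewrite lte_fin mulr_gt0 ?normal_pdf_gt0// -natr1; lra.
  - by rewrite -natr1; lra.
  - move=> x /andP[x1 x2]; rewrite ger0_norm ltW//.
    by apply: le_lt_trans x1; exact: ler0n.
apply: expect_le => //; first exact: bounded_mfunM.
move=> x; rewrite indicE; case: (boolP (x \in A)) => [|_]; last exact: sqr_ge0.
rewrite inE /A /= in_itv /= => /andP[x1 x2].
have x0 : 0 < x by apply: le_lt_trans x1; exact: ler0n.
by rewrite /shell gtr0_norm// x1 x2 gtr0_sg// expr1n.
Qed.

Definition shell_phi b (x : R) : R := (Num.sqrt (shell_mass b))^-1 * shell b x.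

Lemma bounded_shell_phi b : bounded_mfun (shell_phi b).
Proof. by apply: bounded_mfunM; [exact: bounded_mfun_cst|exact: bounded_shell]. Qed.

Lemma shell_phi_sqr b : \int[N01]_x (shell_phi b x ^+ 2) = 1.
Proof.
have bs := bounded_shell b; have p0 := shell_mass_gt0 b.
rewrite (@eq_Rintegral _ _ _ _ _ (fun x => (shell_mass b)^-1 * shell b x ^+ 2)).
  rewrite expectZ; last exact: bounded_mfunM.
  by rewrite -/(shell_mass b) mulVf// gt_eqF.
by move=> x _; rewrite exprMn exprVn sqr_sqrtr// ltW.
Qed.

Lemma cvg_shell b (x : R) (y : nat -> R) : y n @[n --> \oo] --> x ->
  shell b x * shell b (y n) @[n --> \oo] --> shell b x ^+ 2.
Proof.
move=> yx; have [xb|xb] := boolP ((b%:R < `|x|) && (`|x| < b.+1%:R)); last first.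
  rewrite /shell (negbTE xb) expr0n /=.
  by under eq_fun do rewrite mul0r; exact: cvg_cst.
have b0 : 0 <= b%:R :> R by exact: ler0n.
suff H : \forall n \near \oo, shell b (y n) = shell b x.
  apply: cvg_near_cst; apply: filterS H => n ->.
  by rewrite expr2.
case/andP: (xb) => x1 x2.
have [x0|x0|x0] := ltgtP x 0; last by move: x1; rewrite x0 normr0 ltNge b0.
- rewrite (ltr0_norm x0) in x1 x2.
  have H1 : \forall n \near \oo, - b.+1%:R < y n.
    by apply: (cvgr_gt _ yx); rewrite ltrNl.
  have H2 : \forall n \near \oo, y n < - b%:R.
    by apply: (cvgr_lt _ yx); rewrite ltrNr.
  apply: filterS2 H1 H2 => n y1 y2.
  have yn0 : y n < 0 by apply: lt_le_trans y2 _; rewrite oppr_le0.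
  rewrite /shell xb (ltr0_norm yn0) (ltr0_sg yn0) (ltr0_sg x0) ifT//.
  by rewrite ltrNr y2 ltrNl.
- rewrite (gtr0_norm x0) in x1 x2.
  have H1 : \forall n \near \oo, b%:R < y n by apply: (cvgr_gt _ yx).
  have H2 : \forall n \near \oo, y n < b.+1%:R by apply: (cvgr_lt _ yx).
  apply: filterS2 H1 H2 => n y1 y2.
  have yn0 : 0 < y n by apply: le_lt_trans y1.
  by rewrite /shell xb (gtr0_norm yn0) (gtr0_sg yn0) (gtr0_sg x0) y1 y2.
Qed.

Variable rho : nat -> R.
Hypothesis hrho : forall n, 0 < rho n < 1.
Hypothesis rho1 : rho n ^+ 2 @[n --> \oo] --> (1 : R).

Lemma cvg_corr_map_snd x z :
  rho n * x + Num.sqrt (1 - rho n ^+ 2) * z @[n --> \oo] --> x.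
Proof.
have r1 : rho n @[n --> \oo] --> (1 : R).
  rewrite -[X in _ --> X](@sqrtr1 R).
  have -> : rho = fun n => Num.sqrt (rho n ^+ 2).
    apply/funext => n; rewrite sqrtr_sqr gtr0_norm//.
    by have /andP[] := hrho n.
  exact: (cvg_comp _ _ rho1 (@sqrt_continuous R 1)).
have s0 : Num.sqrt (1 - rho n ^+ 2) @[n --> \oo] --> (0 : R).
  rewrite -[X in _ --> X](@sqrtr0 R) -(subrr 1).
  apply: (cvg_comp (fun n => 1 - rho n ^+ 2) Num.sqrt); last exact: sqrt_continuous.
  by apply: cvgB => //; exact: cvg_cst.
rewrite -[X in _ --> X]addr0 -{2}[x]mul1r -(mul0r z).
by apply: cvgD; apply: cvgM => //; exact: cvg_cst.
Qed.

(** As the correlation tends to 1, [corr_map] tends to the diagonal, and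
    dominated convergence gives the second moment of [shell_phi b] as the
    limit. *)
Lemma cvg_shell_corr b :
  \int[N01]_x \int[N01]_z
    (shell_phi b x * shell_phi b (rho n * x + Num.sqrt (1 - rho n ^+ 2) * z))
  @[n --> \oo] --> (1 : R).
Proof.
have p0 := shell_mass_gt0 b.
pose G n (p : R * R) := shell b p.1 * shell b (corr_map (rho n) p).2.
have bG n : bounded_mfun (G n).
  apply: bounded_mfunM; apply: bounded_mfun_comp (bounded_shell b) _.
    exact: measurable_fst.
  exact: (measurableT_comp measurable_snd (measurable_corr_map (rho n))).
have bF : bounded_mfun (fun p : R * R => shell b p.1 ^+ 2).
  have bs1 : bounded_mfun (fun p : R * R => shell b p.1).
    by apply: bounded_mfun_comp (bounded_shell b) _; exact: measurable_fst.
  exact: bounded_mfunM.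
have E n : \int[N01]_x \int[N01]_z
    (shell_phi b x * shell_phi b (rho n * x + Num.sqrt (1 - rho n ^+ 2) * z)) =
    (shell_mass b)^-1 * \int[(N01 \x N01)%E]_p G n p.
  rewrite -expectZ// (expect_fubini1 N01 N01); last first.
    by apply: bounded_mfunM => //; exact: bounded_mfun_cst.
  apply: eq_Rintegral => x _; apply: eq_Rintegral => z _.
  rewrite /shell_phi /G /corr_map /= mulrACA -invfM -expr2.
  by rewrite sqr_sqrtr// ltW.
under eq_fun do rewrite E.
have <- : (shell_mass b)^-1 * \int[(N01 \x N01)%E]_p (shell b p.1 ^+ 2) = 1.
  rewrite (expect_fubini1 N01 N01 bF) /=.
  rewrite (@eq_Rintegral _ _ _ _ _ (fun x : R => shell b x ^+ 2)).
    by rewrite -/(shell_mass b) mulVf// gt_eqF.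
  by move=> x _; rewrite expect_cst.
apply: cvgM; first exact: cvg_cst.
apply: (expect_cvg (M := 1)) => //.
- by move=> n; case: (bG n).
- by move=> n p; rewrite /G normrM mulr_ile1// shell_le1.
- by move=> p; apply: cvg_shell; exact: cvg_corr_map_snd.
Qed.

End shell_kernel.

(** In fixed dimension, [d * c ^+ 2 / K] can become large only through the
    choice of [K]. With [K] shells the mean [c] tends to [K], so that
    [c ^+ 2 / K] eventually exceeds [K / 4]. *)
Lemma gaussian_detection_fixed_dim (R : realType) (alpha : R) (d : nat)
    (rho : nat -> R) : 0 < alpha <= 1 -> (forall n, 0 < rho n < 1) -> (0 < d)%N ->
  rho n ^+ 2 @[n --> \oo] --> (1 : R) ->
  gaussian_strong_detection alpha (fun=> d) rho.
Proof.
move=> halpha hrho d0 rho1; apply: gaussian_detection_sufficient => // e e0.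
pose K := (Num.truncn (4 / e)).+1.
have Ke : 4 / e <= K%:R by rewrite ltW// real_truncnS_gt// num_real.
have K0 : 0 < K%:R :> R by rewrite ltr0n.
pose phi (b : 'I_K) := @shell_phi R b.
have bphi b : bounded_mfun (phi b) by exact: bounded_shell_phi.
have [_ [M kM]] := bounded_odd_kernel bphi.
pose L := 4 * M ^+ 2 / K%:R ^+ 2.
have L0 : 0 <= L.
  by apply: divr_ge0; [apply: mulr_ge0; [|exact: sqr_ge0]|exact: sqr_ge0].
exists L; split=> //.
have cv : \sum_(b < K) \int[std_normal R]_x \int[std_normal R]_z
    (phi b x * phi b (rho n * x + Num.sqrt (1 - rho n ^+ 2) * z))
    @[n --> \oo] --> \sum_(b < K) (1 : R).
  by apply: cvg_big => [|b _]; [exact: add_continuous|exact: cvg_shell_corr].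
rewrite sumr_const card_ord in cv.
have K2 : K%:R / 2 < K%:R :> R by lra.
have : \forall n \near \oo, K%:R / 2 < \sum_(b < K) \int[std_normal R]_x
    \int[std_normal R]_z
      (phi b x * phi b (rho n * x + Num.sqrt (1 - rho n ^+ 2) * z)).
  exact: (cvgr_gt _ cv).
apply: filterS => n cn; split => //.
exists K, phi, M; have /andP[r0 r1] := hrho n.
have rn : `|rho n| < 1 by rewrite gtr0_norm.
have cE := expect_odd_kernel_bigauss bphi rn.
rewrite -cE in cn; set c := \int[_]_p _ in cn *.
have c0 : 0 < c by apply: lt_trans cn; lra.
have c2 : K%:R ^+ 2 / 4 <= c ^+ 2.
  have -> : K%:R ^+ 2 / 4 = (K%:R / 2) ^+ 2 :> R by field.
  by rewrite lerXn2r ?nnegrE// ltW// divr_gt0.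
have dc2 : K%:R ^+ 2 / 4 <= d%:R * c ^+ 2.
  by apply: le_trans c2 _; rewrite ler_peMl ?sqr_ge0// ler1n.
split => //.
- split => // b x; rewrite /phi /shell_phi shellN mulrN//.
- move=> b b' x bb'; rewrite /phi /shell_phi mulrACA shell_disj ?mulr0//.
- by move=> b; rewrite shell_phi_sqr.
- split => //.
    apply: (@le_trans _ _ (e * (K%:R ^+ 2 / 4))); last by rewrite ler_wpM2l// ltW.
    move: Ke; rewrite ler_pdivrMr// => Ke.
    have -> : e * (K%:R ^+ 2 / 4) = (K%:R * e) / 4 * K%:R :> R by field.
    by rewrite ler_peMl ?ler0n//; lra.
  apply: (@le_trans _ _ (L * (K%:R ^+ 2 / 4))).
    by rewrite /L le_eqVlt; apply/orP; left; apply/eqP; field; rewrite gt_eqF.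
  by rewrite ler_wpM2l// divr_ge0 ?mulr_ge0 ?sqr_ge0.
Qed.

Theorem corollary2 (R : realType) (alpha : R) (rho : nat -> R)
    (halpha : 0 < alpha <= 1) (hrho : forall n, 0 < rho n < 1) :
  (forall d : nat, (0 < d)%N ->
     (gaussian_strong_detection alpha (fun=> d) rho <->
      rho n ^+ 2 @[n --> \oo] --> (1 : R)))
  /\
  (forall d : nat -> nat, d n @[n --> \oo] --> \oo ->
     (gaussian_strong_detection alpha d rho <->
      rho n ^+ 2 * (d n)%:R @[n --> \oo] --> +oo)).
Proof.
split=> [d d0|d dy]; split.
- move=> det; apply: (cvg_corr_fixed_dim hrho (d := d)) => N.
  exact: (gaussian_detection_necessary N halpha hrho det).
- exact: gaussian_detection_fixed_dim.
- move=> det; apply: cvg_corr_growing_dim => // N.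
  exact: (gaussian_detection_necessary N halpha hrho det).
- exact: gaussian_detection_growing_dim.
Qed.
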